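(* Let $0<\alpha<2n$, $\vec P=(p_1,p_2)$ with $1<p_1,p_2<\infty$, $0<p\le p_0<\infty$ and $0<q\le q_0<\infty$ be such that $\frac1p=\frac1{p_1}+\frac1{p_2}$, $\frac1{q_0}=\frac1{p_0}-\frac{\alpha}{n}$ and $\frac1q=\frac1p-\frac{\alpha}{n}$. Let $b_1,b_2$ be locally integrable functions on $\mathbb{R}^n$ and $\vec b=(b_1,b_2)$. Then: (1) if $b_1,b_2\in\mathrm{BMO}(\mathbb{R}^n)$, then $[\Pi\vec b,I_\alpha]$ is a bounded operator from $\mathcal{M}^{p_0}_{\vec P}$ to $M^{q_0}_q$; (2) if $b_1=b_2$ and $[\Pi\vec b,I_\alpha]$ is a bounded operator from $\mathcal{M}^{p_0}_{\vec P}$ to $M^{q_0}_q$, then $b_1,b_2\in\mathrm{BMO}(\mathbb{R}^n)$.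
   Context: **Morrey space.** For $0<q\le q_0<\infty$, $M^{q_0}_q$ is the space of measurable $f$ on $\mathbb{R}^n$ with $\|f\|_{M^{q_0}_q}:=\sup_Q |Q|^{1/q_0}\big(\frac1{|Q|}\int_Q|f|^q\,dx\big)^{1/q}<\infty$, the supremum over all cubes $Q$ (sides parallel to the axes). **Multi-Morrey norm.** $\mathcal{M}^{p_0}_{\vec P}$ is the set of pairs $(f_1,f_2)$ of measurable functions on $\mathbb{R}^n$ with $\|(f_1,f_2)\|_{\mathcal{M}^{p_0}_{\vec P}}:=\sup_Q|Q|^{1/p_0}\prod_{i=1}^2\big(\frac1{|Q|}\int_Q|f_i|^{p_i}dx\big)^{1/p_i}<\infty$. **Operators.** The bilinear fractional integral is $I_\alpha(f_1,f_2)(x)=\iint \frac{f_1(y_1)f_2(y_2)}{(|x-y_1|^2+|x-y_2|^2)^{n-\alpha/2}}\,dy_1dy_2$, and its iterated commutator is $$[\Pi\vec b,I_\alpha](f_1,f_2)(x)=\int_{\mathbb{R}^n}\int_{\mathbb{R}^n}\frac{(b_1(x)-b_1(y_1))(b_2(x)-b_2(y_2))f_1(y_1)f_2(y_2)}{(|x-y_1|^2+|x-y_2|^2)^{n-\alpha/2}}\,dy_1dy_2 .$$ **Boundedness** of a bilinear operator $S$ from $\mathcal{M}^{p_0}_{\vec P}$ to $M^{q_0}_q$ means that $S$ is defined on all of $\mathcal{M}^{p_0}_{\vec P}$ and there is a constant $C$ with $\|S(f_1,f_2)\|_{M^{q_0}_q}\le C\|(f_1,f_2)\|_{\mathcal{M}^{p_0}_{\vec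 P}}$ for all $(f_1,f_2)\in\mathcal{M}^{p_0}_{\vec P}$. *)

(* Defs.v *)
From HB Require Import structures.
From mathcomp Require Import all_boot all_order all_algebra.
From mathcomp Require Import all_classical all_reals all_analysis.

Set Implicit Arguments.
Unset Strict Implicit.
Unset Printing Implicit Defensive.
Import Order.TTheory GRing.Theory Num.Theory.
Import numFieldNormedType.Exports.

Local Open Scope classical_set_scope.
Local Open Scope ring_scope.

Lemma sigma_finite_product_measure d1 d2 (T1 : measurableType d1)
    (T2 : measurableType d2) (R : realType)
    (m1 : {sigma_finite_measure set T1 -> \bar R})
    (m2 : {sigma_finite_measure set T2 -> \bar R}) :
  sigma_finite [set: T1 * T2] (m1 \x m2)%E.
Proof.
have /sigma_finiteP[F [TF ndF Foo]] := sigma_finiteT m1.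
have /sigma_finiteP[G [TG ndG Goo]] := sigma_finiteT m2.
exists (fun n => F n `*` G n).
  rewrite -setXTT TF TG predeqE => -[x y]; split.
    move=> [/= [n _ Fnx] [k _ Gky]]; exists (maxn n k) => //; split.
    - by move: x Fnx; exact/subsetPset/ndF/leq_maxl.
    - by move: y Gky; exact/subsetPset/ndG/leq_maxr.
  by move=> [n _ []/= ? ?]; split; exists n.
move=> k; have [? ?] := Foo k; have [? ?] := Goo k.
split; first exact: measurableX.
by rewrite product_measure1E// lte_mul_pinfty// ge0_fin_numE.
Qed.

Section lebesgue_tuple.
Context (R : realType).
Local Notation T n := (n.-tuple (measurableTypeR R)).
Local Open Scope ereal_scope.

Definition cons_pair n (x : measurableTypeR R * T n) : T n.+1 :=
  [tuple of x.1 :: x.2].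

Lemma measurable_cons_pair n : measurable_fun [set: _] (@cons_pair n).
Proof. exact: measurable_cons. Qed.

Section cons_measure.
Context n (m : {sigma_finite_measure set (T n) -> \bar R}).

Definition cons_measure : set (T n.+1) -> \bar R :=
  pushforward (lebesgue_measure \x m) (@cons_pair n).

Let cm0 : cons_measure set0 = 0.
Proof. by rewrite /cons_measure /pushforward preimage_set0 measure0. Qed.

Let cm_ge0 A : 0 <= cons_measure A.
Proof. by rewrite /cons_measure /pushforward measure_ge0. Qed.

Let cm_sigma_additive : semi_sigma_additive cons_measure.
Proof.
move=> F mF tF mUF; rewrite /cons_measure /pushforward preimage_bigcup.
have mc A : measurable A -> measurable (@cons_pair n @^-1` A).
  by move=> mA; rewrite -[X in measurable X]setTI; exact: measurable_cons_pair.
apply: measure_semi_sigma_additive.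
- by move=> k; exact: mc.
- apply/trivIsetP => /= i j _ _ ij; rewrite -preimage_setI.
  by move/trivIsetP : tF => /(_ _ _ _ _ ij) ->//; rewrite preimage_set0.
- by rewrite -preimage_bigcup; exact: mc.
Qed.

HB.instance Definition _ := isMeasure.Build _ _ _ cons_measure
  cm0 cm_ge0 cm_sigma_additive.

Let cm_sigma_finite : sigma_finite [set: T n.+1] cons_measure.
Proof.
have [F FT mF] : sigma_finite [set: _] (lebesgue_measure \x m).
  exact: sigma_finite_product_measure.
pose g (z : T n.+1) : measurableTypeR R * T n := (thead z, [tuple of behead z]).
have gK : cancel (@cons_pair n) g.
  by move=> [x t]; congr pair; rewrite /= ?theadE//; exact/val_inj.
have mg : measurable_fun [set: _] g.
  apply/measurable_fun_pairP; split; first exact: measurable_tnth.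
  exact: measurable_behead.
exists (fun k => g @^-1` F k).
  by rewrite -preimage_bigcup -FT preimage_setT.
move=> k; have [mFk Fkoo] := mF k; split.
  by rewrite -[X in measurable X]setTI; exact: mg.
rewrite /cons_measure /pushforward -comp_preimage.
by rewrite (_ : g \o _ = id)//; apply/funext => z /=; rewrite gK.
Qed.

HB.instance Definition _ := @Measure_isSigmaFinite.Build _ _ _ cons_measure
  cm_sigma_finite.

End cons_measure.

(* n-fold product of the one-dimensional Lebesgue measure, on the Borel (product)
   sigma-algebra of n.-tuple R *)
Fixpoint borel_lebesgue n : {sigma_finite_measure set (T n) -> \bar R} :=
  if n is n'.+1 then cons_measure (borel_lebesgue n')
  else dirac [tuple].

End lebesgue_tuple.

Lemma measurable_box (R : realType) n (a b : 'I_n -> R) :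
  measurable [set x : n.-tuple (measurableTypeR R) |
    forall i, a i <= tnth x i <= b i].
Proof.
have -> : [set x : n.-tuple (measurableTypeR R) |
    forall i, a i <= tnth x i <= b i] =
    \bigcap_(i in [set: 'I_n]) ((fun x : n.-tuple (measurableTypeR R) =>
      tnth x i) @^-1` `[a i, b i]%classic).
  by apply/seteqP; split => x /= h i; [move=> _|]; have := h i;
    rewrite /= in_itv //=; exact.
apply: fin_bigcap_measurable => // i _; rewrite -[X in measurable X]setTI.
by apply: measurable_tnth => //; exact: measurable_itv.
Qed.

Lemma borel_lebesgue_box (R : realType) n (a b : 'I_n -> R)
    (hab : forall i, a i <= b i) :
  borel_lebesgue R n [set x | forall i, a i <= tnth x i <= b i] =
  (\prod_(i < n) (b i - a i))%:E.
Proof.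
elim: n a b hab => [|n IH] a b hab.
  by rewrite big_ord0 /= diracE mem_set// => -[].
rewrite big_ord_recl /= /cons_measure /pushforward.
rewrite (_ : _ @^-1` _ = `[a ord0, b ord0] `*`
  [set x : n.-tuple _ |
    forall i, a (lift ord0 i) <= tnth x i <= b (lift ord0 i)]); last first.
  apply/seteqP; split => -[x t] /=; rewrite in_itv /=.
    move=> h; split; first exact: (h ord0).
    by move=> i; have := h (lift ord0 i); rewrite tnthS.
  by move=> [h0 h] i; case: (unliftP ord0 i) => [j ->|->]; rewrite ?tnthS.
rewrite product_measure1E//; last exact: measurable_box.
rewrite IH// EFinM /= lebesgue_measure_itv /= lte_fin.
have := hab ord0; rewrite le_eqVlt => /orP[/eqP ->|->]; last by rewrite EFinB.
by rewrite ltxx subrr.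
Qed.

Section morrey.
Context (R : realType) (n : nat).

(* R^n with its Lebesgue sigma-algebra: the Caratheodory-measurable sets of the
   outer measure induced by [borel_lebesgue], that is, the completion of the
   Borel sigma-algebra *)
Definition Rn := caratheodory_type ((@borel_lebesgue R n : set _ -> \bar R)^*)%mu.
HB.instance Definition _ := Measurable.on Rn.

Definition lebesgue : set Rn -> \bar R :=
  @completed_measure_extension _ _ _ (@borel_lebesgue R n).
HB.instance Definition _ := Measure.on lebesgue.

Lemma lebesgue_sigma_finite : sigma_finite [set: Rn] lebesgue.
Proof. exact/completed_measure_extension_sigma_finite/sigma_finiteT. Qed.

HB.instance Definition _ :=
  @Measure_isSigmaFinite.Build _ _ _ lebesgue lebesgue_sigma_finite.

Definition rcoord (x : Rn) (i : 'I_n) : R := tnth (x : n.-tuple R) i.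

Definition sqdist (x y : Rn) : R := \sum_(i < n) (rcoord x i - rcoord y i) ^+ 2.

Definition cube (a : Rn) (r : R) : set Rn :=
  [set x | forall i, rcoord a i <= rcoord x i <= rcoord a i + r].

Definition is_cube (Q : set Rn) := exists a r, 0 < r /\ Q = cube a r.

Local Open Scope ereal_scope.

Definition pmean (q : R) (f : Rn -> R) (Q : set Rn) : \bar R :=
  ((lebesgue Q)^-1 * \int[lebesgue]_(x in Q) ((`|f x| `^ q)%R)%:E) `^ q^-1.

Definition morrey_norm (q0 q : R) (f : Rn -> R) : \bar R :=
  ereal_sup [set (lebesgue Q `^ q0^-1) * pmean q f Q | Q in is_cube].

Definition morrey (q0 q : R) (f : Rn -> R) : Prop :=
  measurable_fun [set: Rn] f /\ morrey_norm q0 q f < +oo.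

(* The convention 0 * +oo = 0 applies to the product of the two means. *)
Definition multi_morrey_norm (p0 p1 p2 : R) (f1 f2 : Rn -> R) : \bar R :=
  ereal_sup [set (lebesgue Q `^ p0^-1) * (pmean p1 f1 Q * pmean p2 f2 Q)
            | Q in is_cube].

Definition multi_morrey (p0 p1 p2 : R) (f1 f2 : Rn -> R) : Prop :=
  [/\ measurable_fun [set: Rn] f1, measurable_fun [set: Rn] f2 &
      multi_morrey_norm p0 p1 p2 f1 f2 < +oo].

(* Compactness is that of 'rV[R]_n: tuples carry no topology. *)
Definition loc_integrable (b : Rn -> R) : Prop :=
  measurable_fun [set: Rn] b /\
  forall K : set Rn,
    compact [set (\row_(i < n) rcoord x i : 'rV[R]_n)%R | x in K] ->
    \int[lebesgue]_(x in K) (`|b x|%R)%:E < +oo.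

Definition average (b : Rn -> R) (Q : set Rn) : R :=
  ((fine (lebesgue Q))^-1 * \int[lebesgue]_(x in Q) b x)%R.

Definition bmo_norm (b : Rn -> R) : \bar R :=
  ereal_sup [set (lebesgue Q)^-1 *
                 \int[lebesgue]_(x in Q) (`|b x - average b Q|%R)%:E
            | Q in is_cube].

Definition BMO (b : Rn -> R) : Prop :=
  loc_integrable b /\ bmo_norm b < +oo.

Definition commutator_integrand (b1 b2 : Rn -> R) (alpha : R)
    (f1 f2 : Rn -> R) (x : Rn) (y : Rn * Rn) : R :=
  ((b1 x - b1 y.1) * (b2 x - b2 y.2) * f1 y.1 * f2 y.2 /
   (sqdist x y.1 + sqdist x y.2) `^ (n%:R - alpha / 2))%R.

(* The double integral converges absolutely for almost every x. *)
Definition commutator_defined (b1 b2 : Rn -> R) (alpha : R)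
    (f1 f2 : Rn -> R) : Prop :=
  {ae lebesgue, forall x, (lebesgue \x lebesgue).-integrable [set: Rn * Rn]
     (EFin \o commutator_integrand b1 b2 alpha f1 f2 x)}.

Definition commutator (b1 b2 : Rn -> R) (alpha : R)
    (f1 f2 : Rn -> R) (x : Rn) : R :=
  (\int[lebesgue \x lebesgue]_y commutator_integrand b1 b2 alpha f1 f2 x y)%R.

(* An operator S that makes sense on the pairs satisfying [dom] is bounded from
   the multi-Morrey space to the Morrey space. *)
Definition bounded_operator (p0 p1 p2 q0 q : R)
    (dom : (Rn -> R) -> (Rn -> R) -> Prop)
    (S : (Rn -> R) -> (Rn -> R) -> Rn -> R) : Prop :=
  (forall f1 f2, multi_morrey p0 p1 p2 f1 f2 ->
     dom f1 f2 /\ morrey q0 q (S f1 f2)) /\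
  exists C : R, forall f1 f2, multi_morrey p0 p1 p2 f1 f2 ->
    morrey_norm q0 q (S f1 f2) <= C%:E * multi_morrey_norm p0 p1 p2 f1 f2.

Definition commutator_bounded (b1 b2 : Rn -> R) (alpha p0 p1 p2 q0 q : R) :
    Prop :=
  bounded_operator p0 p1 p2 q0 q
    (commutator_defined b1 b2 alpha) (commutator b1 b2 alpha).

End morrey.

Lemma lebesgue_cube (R : realType) n (a : Rn R n) (r : R) : 0 < r ->
  lebesgue (cube a r) = (r ^+ n)%:E.
Proof.
move=> r0.
have -> : r ^+ n = \prod_(i < n) ((rcoord a i + r) - rcoord a i).
  by under eq_bigr do rewrite addrAC subrr add0r; rewrite prodr_const card_ord.
rewrite -borel_lebesgue_box; last by move=> i; rewrite lerDl ltW.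
rewrite -[RHS]measurable_mu_extE //.
exact: measurable_box.
Qed.

(* Main.v *)
(* (1) For x in a cube Q of side r the kernel is dominated by a sum over scales.
   When y_1 and y_2 are close to Q, it is bounded by the contribution of a dyadic
   cell containing x, y_1 and y_2: grids shifted by a third in some coordinates
   provide such a cell of side comparable to the distance. Otherwise it is bounded
   by (2^k r)^(alpha - 2n) on the first dilate of Q containing both points. On a
   cell or a dilate, Hoelder and John-Nirenberg bound the integral of
   |b_i(x) - b_i(y)| |f_i(y)| by |b_i(x) - c| + C, with c the average of b_i,
   times an L^(p_i) mean of f_i. For one grid, the sum over the generations is
   bounded from L^(p_1) x L^(p_2) to L^q by Hedberg's splitting of the
   generations, John-Nirenberg and Doob's maximal inequality; the dilates give a
   geometric series, as the averages of b_i over consecutive dilates differ by a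
   bounded amount and 1/q_0 > 0.
   (2) Let m be a median of b on a cube Q of side r, and test the commutator on
   f_1 = f_2 = 1_E, where E is the part of Q on which b <= m (resp. b >= m), of
   measure at least |Q|/2. On the other side of m the integrand is nonnegative and
   the commutator is at least c r^alpha (b(x) - m)^2, so the mean of |b - m|^(2q)
   over Q is bounded, and 2q > 1. *)
Require Import Defs.
From HB Require Import structures.
From mathcomp Require Import all_boot all_order all_algebra.
From mathcomp Require Import all_classical all_reals all_analysis.
From mathcomp Require Import measurable_realfun ring lra zify.

Set Implicit Arguments.
Unset Strict Implicit.
Unset Printing Implicit Defensive.
Import Order.TTheory GRing.Theory Num.Theory.
Import numFieldNormedType.Exports.

Local Open Scope classical_set_scope.
Local Open Scope ring_scope.

(** * Power inequalities *)

Section powR_inequalities.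
Context {R : realType}.
Implicit Types x y q : R.

(** The exponent 1/q may exceed 1, so L^q need not be normed, and neither duality nor the triangle
    inequality sums the generations of a grid. A term is written D_k U_k, where D_k is constant on
    cells and U_k is a product of oscillation factors, with moments bounded only on the cells of
    generation k. The q-th power of the sum is made linear by spending a quarter of the exponent of
    D_k; Hedberg's splitting sums what remains, and Cauchy-Schwarz on each cell trades U_k for a
    maximal function. On cells the Hoelder exponent of f_i lies strictly between 1 and p_i, so that
    Doob's inequality controls the maximal means in L^(p_i). This analysis takes place on abstract
    nested partitions, whose constants depend on the grid through the ratio of volumes alone; hence
    the uniformity over cubes and shifts. A second obstacle is the product of means: with 0 * oo = 0
    the norm is blind to a cube where one mean vanishes and the other is infinite. Either some f_i
    vanishes almost everywhere, or large cubes show that both functions are locally in L^(p_i). *)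

Lemma powR_add_le x y q : 0 <= x -> 0 <= y -> 0 <= q ->
  (x + y) `^ q <= 2 `^ q * (x `^ q + y `^ q).
Proof.
move=> x0 y0 q0.
wlog xy : x y x0 y0 / x <= y => [h|].
  have [xy|yx] := leP x y; first exact: h.
  by rewrite addrC [X in _ * X]addrC; apply: h => //; exact: ltW.
apply: (@le_trans _ _ ((2 * y) `^ q)).
  by apply: ge0_ler_powR; rewrite ?nnegrE ?addr_ge0 ?mulr_ge0//; lra.
by rewrite powRM// ler_wpM2l ?powR_ge0// lerDr powR_ge0.
Qed.

Lemma powR_add_le1 x y q : 0 <= x -> 0 <= y -> 0 < q <= 1 ->
  (x + y) `^ q <= x `^ q + y `^ q.
Proof.
move=> x0 y0 /andP[q0 q1].
have [xy0|xy0] := eqVneq (x + y) 0.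
  by rewrite xy0 powR0 ?gt_eqF// addr_ge0 ?powR_ge0.
have xyp : 0 < x + y by rewrite lt0r xy0 addr_ge0.
have step z : 0 <= z -> z <= x + y -> z / (x + y) * (x + y) `^ q <= z `^ q.
  move=> z0 zxy; have [->|zn] := eqVneq z 0.
    by rewrite mul0r mul0r powR_ge0.
  have zp : 0 < z by rewrite lt0r zn.
  have {2}-> : z = z / (x + y) * (x + y) by rewrite divfK.
  rewrite [leRHS]powRM ?divr_ge0 ?addr_ge0// ler_wpM2r ?powR_ge0//.
  rewrite ger1_powR// divr_gt0//= ler_pdivrMr// mul1r//.
rewrite (le_trans _ (lerD (step x x0 _) (step y y0 _))) ?lerDl ?lerDr//.
by rewrite -mulrDl -mulrDl divff// mul1r.
Qed.

Lemma powR_sum_le1 (I : Type) (s : seq I) (F : I -> R) q : 0 < q <= 1 ->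
  (forall i, 0 <= F i) -> (\sum_(i <- s) F i) `^ q <= \sum_(i <- s) F i `^ q.
Proof.
move=> q01 F0; elim: s => [|i s IH].
  by rewrite !big_nil powR0//; case/andP: q01 => ? _; rewrite gt_eqF.
rewrite !big_cons (le_trans (powR_add_le1 _ _ q01))// ?sumr_ge0//.
by rewrite lerD2l.
Qed.

(** Young's inequality for t and 1, that is t <= t^q / q + 1 - 1/q: the graph of t^q lies above its
    tangent at 1. Both forms of Jensen's inequality below rest on it. *)
Lemma powR_bernoulli t q : 0 <= t -> 1 <= q -> 1 + q * (t - 1) <= t `^ q.
Proof.
move=> t0; rewrite le_eqVlt => /predU1P[<-|q1]; first by rewrite powRr1//; lra.
have q0 : 0 < q by lra.
have qi : 0 < (1 - q^-1)^-1 by rewrite invr_gt0 subr_gt0 invf_lt1.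
have /(_ _)/wrap[] := @conjugate_powR R t 1 q (1 - q^-1)^-1 t0 ler01 q0 qi.
  by rewrite invrK subrKC.
rewrite mulr1 powR1 mul1r invrK => h.
have : q * t <= q * (t `^ q / q + (1 - q^-1)) by rewrite ler_pM2l.
rewrite mulrDr mulrCA mulfV ?gt_eqF// mulr1 mulrBr mulfV ?gt_eqF//; lra.
Qed.

(** Jensen's inequality for the weights [w]: the tangents of the q-th power at the weighted mean [m]
    are summed, and their linear parts cancel. *)
Lemma powR_sum_ge1 (I : Type) (s : seq I) (w y : I -> R) q : 1 <= q ->
  (forall i, 0 <= w i) -> (forall i, 0 <= y i) ->
  (\sum_(i <- s) w i * y i) `^ q <=
  (\sum_(i <- s) w i) `^ (q - 1) * \sum_(i <- s) w i * y i `^ q.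
Proof.
move=> q1 w0 y0; have q0 : 0 < q by lra.
set W := \sum_(i <- s) w i; set S := \sum_(i <- s) w i * y i.
have W0 : 0 <= W by rewrite sumr_ge0.
have S0 : 0 <= S by rewrite sumr_ge0// => i _; rewrite mulr_ge0.
have [S_0|Sn] := eqVneq S 0.
  rewrite S_0 powR0 ?gt_eqF// mulr_ge0 ?powR_ge0// sumr_ge0// => i _.
  by rewrite mulr_ge0 ?powR_ge0.
have Sp : 0 < S by rewrite lt0r Sn.
have Wp : 0 < W.
  rewrite lt0r W0 andbT; apply: contra_neq Sn => W_0.
  have wz : forall t : seq I, \sum_(i <- t) w i = 0 -> \sum_(i <- t) w i * y i = 0.
    elim=> [|i t IH]; rewrite ?big_nil// !big_cons => /eqP.
    rewrite paddr_eq0// ?sumr_ge0// => /andP[/eqP-> /eqP/IH->].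
    by rewrite mul0r addr0.
  exact: wz.
pose m := S / W.
have mp : 0 < m by rewrite divr_gt0.
have key i : w i * (m `^ q * (1 + q * (y i / m - 1))) <= w i * y i `^ q.
  rewrite ler_wpM2l//.
  rewrite (@le_trans _ _ (m `^ q * (y i / m) `^ q))//.
    by rewrite ler_wpM2l ?powR_ge0// powR_bernoulli// divr_ge0// ltW.
  by rewrite -powRM ?divr_ge0 ?(ltW mp)// mulrCA mulfV ?gt_eqF// mulr1.
have : \sum_(i <- s) w i * (m `^ q * (1 + q * (y i / m - 1))) <=
       \sum_(i <- s) w i * y i `^ q by apply: ler_sum.
have -> : \sum_(i <- s) w i * (m `^ q * (1 + q * (y i / m - 1))) = m `^ q * W.
  under eq_bigr => i _.
    rewrite (_ : _ * _ = m `^ q * (1 - q) * w i + m `^ q * q / m * (w i * y i));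
      last by field; rewrite gt_eqF.
    over.
  rewrite big_split/= -!mulr_sumr -/W -/S.
  have -> : S = m * W by rewrite /m divfK// gt_eqF.
  by field; rewrite gt_eqF.
move=> /(ler_wpM2l (powR_ge0 W (q - 1))); apply: le_trans.
rewrite mulrCA [X in _ * X]mulrC mulr_powRB1// -powRM ?(ltW mp)//.
by rewrite /m divfK// gt_eqF.
Qed.

(** The added 1 makes the base at least 1. This covers the subadditive case [q <= 1] and, for larger
    q, allows the exponent [q - 1] of Jensen's inequality to be raised to q. *)
Lemma powR_sum_le (I : Type) (s : seq I) (F : I -> R) q : 0 < q ->
  (forall i, 0 <= F i) ->
  (\sum_(i <- s) F i) `^ q <= ((size s)%:R + 1) `^ q * \sum_(i <- s) F i `^ q.
Proof.
move=> q0 F0.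
have S0 : 0 <= \sum_(i <- s) F i `^ q by rewrite sumr_ge0// => i _; rewrite powR_ge0.
have s1 : 1 <= (size s)%:R + 1 :> R by rewrite lerDr.
have [q1|q1] := leP q 1.
  apply: le_trans (powR_sum_le1 _ _ F0) _; first by rewrite q0.
  rewrite ler_peMl//; have := ler_powR s1 (ltW q0); by rewrite powRr0.
have := @powR_sum_ge1 _ s (fun=> 1) F q (ltW q1) (fun=> ler01) F0.
under eq_bigr do rewrite mul1r.
under [X in _ <= _ * X]eq_bigr do rewrite mul1r.
move/le_trans; apply; rewrite ler_wpM2r//.
rewrite big_const_seq count_predT iter_addr_0 -mulr_natr mul1r.
apply: (@le_trans _ _ (((size s)%:R + 1) `^ (q - 1))).
  by apply: ge0_ler_powR; rewrite ?nnegrE ?lerDl//; lra.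
by apply: (ler_powR s1); lra.
Qed.

End powR_inequalities.

(** * Two-sided geometric sums and Hedberg's splitting *)

Section hedberg.
Context {R : realType}.
Implicit Types (Y delta t : R).

Lemma geo_sum_le delta N : 0 < delta < 1 ->
  \sum_(k < N) delta ^+ k <= (1 - delta)^-1.
Proof.
move=> /andP[d0 d1]; rewrite -[leRHS]mul1r ler_pdivlMr ?subr_gt0//.
elim: N => [|N IH]; first by rewrite big_ord0 mul0r.
suff -> : (\sum_(k < N.+1) delta ^+ k) * (1 - delta) = 1 - delta ^+ N.+1.
  by rewrite gerBl exprn_ge0// ltW.
elim: N.+1 => [|M IHM]; first by rewrite big_ord0 mul0r expr0 subrr.
by rewrite big_ord_recr/= mulrDl IHM exprS; ring.
Qed.

(** The terms are geometric on either side of the index where [Y * delta ^+ k] crosses 1, so the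
    bound depends on neither Y nor N. *)
Lemma sum_min_inv_le delta N Y : 0 < delta < 1 -> 0 < Y ->
  \sum_(k < N) Num.min (Y * delta ^+ k) (Y * delta ^+ k)^-1 <= 2 / (1 - delta).
Proof.
move=> d01; have /andP[d0 d1] := d01.
have d1' : 0 < 1 - delta by rewrite subr_gt0.
have small M Z : 0 < Z -> Z <= 1 ->
    \sum_(k < M) Num.min (Z * delta ^+ k) (Z * delta ^+ k)^-1 <= (1 - delta)^-1.
  move=> Z0 Z1; apply: le_trans (geo_sum_le M d01); apply: ler_sum => k _.
  by rewrite ge_min ler_piMl// exprn_ge0// ltW.
(* The correction [delta / Z] makes the bound reproduce itself exactly when the first term [Z^-1] is
   split off and Z becomes [Z * delta]. *)
have large M Z : 1 <= Z ->
    \sum_(k < M) Num.min (Z * delta ^+ k) (Z * delta ^+ k)^-1 <=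
    (2 - delta / Z) / (1 - delta).
  elim: M Z => [|M IH] Z Z1.
    have Z0 : 0 < Z by lra.
    rewrite big_ord0 divr_ge0 ?(ltW d1')// subr_ge0 ler_pdivrMr//; nra.
  have Z0 : 0 < Z by lra.
  have Zi1 : Z^-1 <= 1 by rewrite invf_le1.
  have Zi0 : 0 < Z^-1 by rewrite invr_gt0.
  rewrite big_ord_recl expr0 mulr1.
  under eq_bigr do rewrite lift0 exprS mulrA.
  apply: (@le_trans _ _ (Z^-1 + \sum_(i < M)
     Num.min (Z * delta * delta ^+ i) (Z * delta * delta ^+ i)^-1)).
    by rewrite lerD2r ge_min lexx orbT.
  have [Zd|Zd] := leP 1 (Z * delta).
    apply: (le_trans (lerD (lexx _) (IH _ Zd))).
    rewrite le_eqVlt; apply/orP; left; apply/eqP.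
    by field; rewrite ?gt_eqF.
  apply: (le_trans (lerD (lexx _) (small _ _ _ (ltW Zd)))).
    by rewrite mulr_gt0.
  rewrite ler_pdivlMr// mulrDl mulVf ?gt_eqF//; nra.
move=> Y0; have [Y1|Y1] := leP Y 1.
  apply: (le_trans (small _ _ Y0 Y1)).
  by rewrite ler_peMl ?invr_ge0 ?(ltW d1')// ler1n.
apply: (le_trans (large _ _ (ltW Y1))).
by rewrite ler_pM2r ?invr_gt0// gerBl divr_ge0// ltW.
Qed.


(** As the volume [v0 * delta ^+ k] shrinks, the first bound on [D k] decreases and the second
    grows. They agree at the volume G^(-1/(a+c)), with common value G^(c/(a+c)), and away from it
    [D k] decays geometrically. The constant is chosen before v0, G and N. *)
Lemma sum_hedberg (delta a c theta : R) : 0 < delta < 1 -> 0 < a -> 0 < c ->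
  0 < theta -> exists2 C, 0 < C &
  forall (v0 G : R) (N : nat) (D : nat -> R), 0 < v0 -> 0 <= G ->
  (forall k, 0 <= D k) ->
  (forall k, (k < N)%N -> D k <= (v0 * delta ^+ k) `^ a * G) ->
  (forall k, (k < N)%N -> D k <= (v0 * delta ^+ k) `^ (- c)) ->
  \sum_(k < N) D k `^ theta <= C * (G `^ (c / (a + c))) `^ theta.
Proof.
move=> /andP[d0 d1] a0 c0 t0; have ac0 : 0 < a + c by rewrite addr_gt0.
(* For every X > 0, the minimum of X^a and X^(-c), raised to [theta], is at most the minimum of
   X^eta and its inverse. The sum is thus of the form of [sum_min_inv_le] with ratio delta^eta. *)
pose eta := theta * Num.min a c.
have m0 : 0 < Num.min a c by rewrite lt_min a0.
have eta0 : 0 < eta by rewrite mulr_gt0.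
have de : 0 < delta `^ eta < 1.
  rewrite powR_gt0//=; have := @gt0_ltr_powR _ eta eta0 delta 1.
  by rewrite powR1; apply => //; rewrite nnegrE ltW.
exists (2 / (1 - delta `^ eta)).
  by rewrite divr_gt0// subr_gt0; case/andP: de.
move=> v0 G N D v00 G0 D0 Da Dc.
have [G_0|Gn] := eqVneq G 0.
  have C0 : 0 <= 2 / (1 - delta `^ eta).
    by rewrite divr_ge0// subr_ge0 ltW//; case/andP: de.
  rewrite big1 => [|k _]; first by rewrite mulr_ge0// powR_ge0.
   have : D k <= 0 by rewrite (le_trans (Da k _))// G_0 mulr0.
  move=> Dk; have -> : D k = 0 by apply/eqP; rewrite eq_le Dk D0.
  by rewrite powR0// gt_eqF.
have Gp : 0 < G by rewrite lt0r Gn.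
set H := G `^ (c / (a + c)).
have Hp : 0 < H by rewrite powR_gt0.
(* [X k] is the volume of generation k in units of the balancing volume [w^-1]. *)
pose w := G `^ ((a + c)^-1).
have wp : 0 < w by rewrite powR_gt0.
pose X k := v0 * w * delta ^+ k.
have Xp k : 0 < X k by rewrite !mulr_gt0// exprn_gt0.
have DX k : (k < N)%N -> D k <= H * Num.min (X k `^ a) (X k `^ (- c)).
  move=> kN; have vk : 0 <= v0 * delta ^+ k by rewrite mulr_ge0 ?exprn_ge0 ?ltW.
  have XE : X k = (v0 * delta ^+ k) * w by rewrite /X; ring.
  rewrite minr_pMr ?(ltW Hp)// le_min; apply/andP; split.
    rewrite (le_trans (Da k kN))// XE [X in _ <= _ * X]powRM ?(ltW wp)// mulrCA ler_wpM2l ?powR_ge0//.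
    rewrite /H /w -powRrM -powRD; last by rewrite Gn implybT.
    rewrite (_ : _ + _ = 1) ?powRr1//.
    by field; rewrite gt_eqF.
  rewrite (le_trans (Dc k kN))// XE [X in _ <= _ * X]powRM ?(ltW wp)// mulrCA -[leLHS]mulr1.
  rewrite ler_wpM2l ?powR_ge0//.
  rewrite /H /w -powRrM -powRD; last by rewrite Gn implybT.
  by rewrite (_ : _ + _ = 0) ?powRr0//; field; rewrite gt_eqF.
have YE k : X k `^ eta = (v0 * w) `^ eta * (delta `^ eta) ^+ k.
  rewrite /X powRM ?exprn_ge0 ?mulr_ge0 ?ltW//; congr (_ * _).
  by rewrite -(powR_mulrn k (ltW d0)) -(powR_mulrn k (powR_ge0 _ _)) powRAC.
have vwe : 0 < (v0 * w) `^ eta by rewrite powR_gt0 ?mulr_gt0.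
apply: (@le_trans _ _ (\sum_(k < N) H `^ theta *
    Num.min ((v0 * w) `^ eta * (delta `^ eta) ^+ k)
      ((v0 * w) `^ eta * (delta `^ eta) ^+ k)^-1)).
  apply: ler_sum => -[k kN] _ /=; rewrite -YE.
  have min0 : 0 <= Num.min (X k `^ a) (X k `^ (- c)).
    by rewrite le_min !powR_ge0.
  apply: (@le_trans _ _ ((H * Num.min (X k `^ a) (X k `^ (- c))) `^ theta)).
    by apply: ge0_ler_powR; rewrite ?nnegrE ?(ltW t0) ?mulr_ge0 ?(ltW Hp)// DX.
  rewrite powRM ?(ltW Hp)// ler_wpM2l ?powR_ge0// -powRN.
  have [X1|X1] := leP (X k) 1.
    have h : X k `^ a `^ theta <= X k `^ eta.
      rewrite -powRrM; apply: ger_powR; first by rewrite Xp.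
      by rewrite mulrC ler_pM2l// ge_min lexx.
    apply: (@le_trans _ _ (X k `^ a `^ theta)).
      by apply: ge0_ler_powR; rewrite ?nnegrE ?(ltW t0) ?powR_ge0// ge_min lexx.
    apply: (le_trans h); rewrite le_min lexx/=.
    by apply: ger_powR; rewrite ?Xp//; lra.
  have h : X k `^ (- c) `^ theta <= X k `^ (- eta).
    rewrite -powRrM; apply: ler_powR; first exact: ltW.
    by rewrite mulNr lerN2 mulrC ler_pM2l// ge_min lexx orbT.
  apply: (@le_trans _ _ (X k `^ (- c) `^ theta)).
    by apply: ge0_ler_powR; rewrite ?nnegrE ?(ltW t0) ?powR_ge0// ge_min lexx orbT.
  apply: (le_trans h); rewrite le_min lexx andbT.
  by apply: ler_powR; rewrite ?(ltW X1)//; lra.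
by rewrite -mulr_sumr mulrC ler_pM2r ?powR_gt0// sum_min_inv_le.
Qed.

End hedberg.

Section integral_inequalities.
Context {R : realType} d (T : measurableType d) (mu : {measure set T -> \bar R}).
Local Open Scope ereal_scope.

Lemma measurable_EFin_powR (D : set T) (f : T -> R) (q : R) :
  measurable_fun D f -> measurable_fun D (EFin \o (fun x => f x `^ q)%R).
Proof. by move=> mf; apply/measurable_EFinP/(measurableT_comp (measurable_powR q)). Qed.

(* The norms are replaced by real upper bounds, so that no extended-real power
   occurs. *)
Lemma hoelder_le (D : set T) (f g : T -> R) (p p' A B : R) :
  measurable D -> measurable_fun D f -> measurable_fun D g ->
  (forall x, D x -> 0 <= f x)%R -> (forall x, D x -> 0 <= g x)%R ->
  (0 < p)%R -> (0 < p')%R -> (p^-1 + p'^-1 = 1)%R -> (0 < A)%R -> (0 < B)%R ->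
  \int[mu]_(x in D) (f x `^ p)%:E <= (A `^ p)%:E ->
  \int[mu]_(x in D) (g x `^ p')%:E <= (B `^ p')%:E ->
  \int[mu]_(x in D) (f x * g x)%:E <= (A * B)%:E.
Proof.
move=> mD mf mg f0 g0 p0 p'0 pp' A0 B0 fA gB.
(* Young's inequality for f / A and g / B is multiplied by [A * B]; [u] and [v] are the resulting
   coefficients of f^p and g^p'. *)
pose u := (A * B / (p * A `^ p))%R; pose v := (A * B / (p' * B `^ p'))%R.
have u0 : (0 <= u)%R by rewrite divr_ge0 ?mulr_ge0 ?powR_ge0 ?ltW.
have v0 : (0 <= v)%R by rewrite divr_ge0 ?mulr_ge0 ?powR_ge0 ?ltW.
apply: (@le_trans _ _ (\int[mu]_(x in D) (u%:E * (f x `^ p)%:E + v%:E * (g x `^ p')%:E))).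
  apply: ge0_le_integral => //.
  - by move=> x Dx; rewrite lee_fin mulr_ge0 ?f0 ?g0.
  - by apply/measurable_EFinP/measurable_funM.
  - apply: emeasurable_funD; apply: emeasurable_funM => //;
      exact: measurable_EFin_powR.
  - move=> x Dx; rewrite -!EFinM -EFinD lee_fin.
    have := conjugate_powR (divr_ge0 (f0 x Dx) (ltW A0))
      (divr_ge0 (g0 x Dx) (ltW B0)) p0 p'0 pp'.
    move=> /(ler_wpM2l (ltW (mulr_gt0 A0 B0))) h.
    rewrite [leLHS](_ : _ = A * B * (f x / A * (g x / B)))%R; last first.
      by field; rewrite ?gt_eqF.
    apply: (le_trans h); rewrite !powRM ?invr_ge0 ?f0 ?g0 ?(ltW A0) ?(ltW B0)//.
    rewrite -(powR_inv1 (ltW A0)) -(powR_inv1 (ltW B0)) -!powRrM !mulN1r !powRN.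
    rewrite /u /v le_eqVlt; apply/orP; left; apply/eqP.
    by field; rewrite ?gt_eqF ?powR_gt0.
rewrite ge0_integralD//; last 4 first.
- by move=> x Dx; rewrite -EFinM lee_fin mulr_ge0 ?powR_ge0.
- by apply: emeasurable_funM => //; exact: measurable_EFin_powR.
- by move=> x Dx; rewrite -EFinM lee_fin mulr_ge0 ?powR_ge0.
- by apply: emeasurable_funM => //; exact: measurable_EFin_powR.
rewrite !ge0_integralZl_EFin//; last 4 first.
- by move=> x _; rewrite lee_fin powR_ge0.
- exact: measurable_EFin_powR.
- by move=> x _; rewrite lee_fin powR_ge0.
- exact: measurable_EFin_powR.
apply: (@le_trans _ _ (u%:E * (A `^ p)%:E + v%:E * (B `^ p')%:E)).
  by apply: leeD; apply: lee_wpmul2l; rewrite ?lee_fin.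
rewrite -!EFinM -EFinD lee_fin /u /v le_eqVlt; apply/orP; left; apply/eqP.
have pq : (p' = p / (p - 1))%R.
  have pn : (p^-1 != 0)%R by rewrite invr_eq0 gt_eqF.
  have p1 : (p - 1 != 0)%R.
    apply/eqP => p1; have pE : p = 1%R by lra.
    move: pp'; rewrite pE invr1 => /(canRL (addKr 1%R)); rewrite addNr => /eqP.
    by rewrite invr_eq0 gt_eqF.
  have : (p' * p * (p^-1 + p'^-1) = p' * p)%R by rewrite pp' mulr1.
  rewrite (_ : p' * p * (p^-1 + p'^-1) = p' + p)%R; last by field; rewrite !gt_eqF.
  by move=> h; apply/(canRL (mulfK p1)); rewrite mulrBr mulr1 -h; ring.
have -> : (A * B / (p * A `^ p) * A `^ p + A * B / (p' * B `^ p') * B `^ p' =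
  A * B * (p^-1 + p'^-1))%R by field; rewrite ?gt_eqF ?powR_gt0.
by rewrite pp' mulr1.
Qed.

End integral_inequalities.

(** * Nested partitions *)

(** Isolates what the maximal and John-Nirenberg inequalities use of dyadic cubes, so that their
    constants see the grid through [delta] alone. Measurability of the relation as a subset of the
    product yields measurable cells, by sections, and measurable averages, by Tonelli's theorem.
    Generation 0 is the coarsest. *)
Record grid d (T : measurableType d) (R : realType)
    (mu : {sigma_finite_measure set T -> \bar R}) (delta : R) := Grid {
  same : nat -> rel T;
  vol0 : R;
  grid_delta : 0 < delta < 1;
  same_refl : forall k x, same k x x;
  same_sym : forall k x y, same k x y = same k y x;
  same_trans : forall k x y z, same k x y -> same k y z -> same k x z;
  sameS : forall k x y, same k.+1 x y -> same k x y;
  measurable_same : forall k, measurable [set z : T * T | same k z.1 z.2];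
  vol0_gt0 : 0 < vol0;
  measure_same : forall k x, mu [set y | same k x y] = (vol0 * delta ^+ k)%:E
}.

Section grid_averages.
Context d (T : measurableType d) (R : realType).
Context (mu : {sigma_finite_measure set T -> \bar R}) (delta : R).
Context (G : grid mu delta).
Let delta01 : 0 < delta < 1 := grid_delta G.

Definition cell k x : set T := [set y | same G k x y].
Definition vol k : R := vol0 G * delta ^+ k.
Definition cellwise U k (g : T -> U) := forall x y, same G k x y -> g x = g y.
Definition avg k (g : T -> R) x : R := (vol k)^-1 * \int[mu]_(y in cell k x) g y.
Definition locint (g : T -> R) :=
  measurable_fun [set: T] g /\ forall k x, mu.-integrable (cell k x) (EFin \o g).

Lemma vol_gt0 k : 0 < vol k.
Proof. by rewrite mulr_gt0 ?vol0_gt0// exprn_gt0//; case/andP: delta01. Qed.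

Lemma vol_neq0 k : vol k != 0. Proof. by rewrite gt_eqF// vol_gt0. Qed.

Lemma volS k : vol k.+1 = delta * vol k.
Proof. by rewrite /vol exprS mulrCA. Qed.

Lemma same_le j k x y : (j <= k)%N -> same G k x y -> same G j x y.
Proof.
move=> /subnKC <-; elim: (k - j)%N => [|m IH]; first by rewrite addn0.
by rewrite addnS => /sameS /IH.
Qed.

Lemma cellwise_le U j k (g : T -> U) : (j <= k)%N -> cellwise j g -> cellwise k g.
Proof. by move=> jk cg x y /(same_le jk); exact: cg. Qed.

Lemma measurable_cell k x : measurable (cell k x).
Proof.
rewrite [cell k x](_ : _ = xsection [set z : T * T | same G k z.1 z.2] x).
  by apply: measurable_xsection; exact: measurable_same.
by apply/seteqP; split => y; rewrite /xsection/= ?inE.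
Qed.
Local Hint Resolve measurable_cell : core.

Lemma measure_cell k x : mu (cell k x) = (vol k)%:E.
Proof. exact: measure_same. Qed.

Lemma cell_eq k x y : same G k x y -> cell k x = cell k y.
Proof.
move=> xy; apply/seteqP; split => z; rewrite /cell/=.
  by apply: same_trans; rewrite same_sym.
exact: same_trans.
Qed.

Lemma avg_cellwise k g : cellwise k (avg k g).
Proof. by move=> x y /cell_eq; rewrite /avg => ->. Qed.

Lemma in_cell k x y : (y \in cell k x) = same G k x y.
Proof. by apply/idP/idP; rewrite inE. Qed.

Lemma in_same k x y :
  ((x, y) \in [set z : T * T | same G k z.1 z.2]) = same G k x y.
Proof. by apply/idP/idP; rewrite inE. Qed.

Local Open Scope ereal_scope.

Lemma fubini_cell k (h : T -> \bar R) x :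
  \int[mu]_(y in cell k x) h y =
  \int[mu]_y ((h \o snd) \_ [set z : T * T | same G k z.1 z.2]) (x, y).
Proof.
rewrite integral_mkcond; apply: eq_integral => y _.
by rewrite !patchE in_cell in_same.
Qed.

Lemma measurable_snd_cell k (h : T -> \bar R) : measurable_fun [set: T] h ->
  measurable_fun [set: T * T] ((h \o snd) \_ [set z : T * T | same G k z.1 z.2]).
Proof.
move=> mh; apply/(measurable_restrictT _ (measurable_same _ _)).
by apply: measurable_funTS; exact: measurableT_comp.
Qed.

Lemma measurable_int_cell k (h : T -> \bar R) : measurable_fun [set: T] h ->
  (forall x, 0 <= h x) ->
  measurable_fun [set: T] (fun x => \int[mu]_(y in cell k x) h y).
Proof.
move=> mh h0; under eq_fun do rewrite fubini_cell.
apply: (@measurable_fun_fubini_tonelli_F _ _ _ _ _ mu _ (measurable_snd_cell k mh)).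
by move=> z; rewrite patchE; case: ifP => //=.
Qed.

(** Tonelli's theorem on the set of pairs in a common cell: by symmetry the inner variable runs over
    a cell after the exchange, [g] is constant there, and the cell has measure [vol k]. *)
Lemma tonelli_cell k (g h : T -> \bar R) :
  measurable_fun [set: T] g -> measurable_fun [set: T] h ->
  (forall x, 0 <= g x) -> (forall x, 0 <= h x) -> cellwise k g ->
  \int[mu]_x (g x * \int[mu]_(y in cell k x) h y) =
  \int[mu]_x (g x * h x * (vol k)%:E).
Proof.
move=> mg mh g0 h0 cg.
pose E := [set z : T * T | same G k z.1 z.2].
pose f (z : T * T) := g z.1 * ((h \o snd) \_ E) z.
have mf : measurable_fun [set: T * T] f.
  apply: emeasurable_funM; last exact: measurable_snd_cell.
  exact: measurableT_comp.
have p0 z : 0 <= ((h \o snd) \_ E) z by rewrite patchE; case: ifP => //=.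
have f0 z : 0 <= f z by rewrite mule_ge0.
have m1 x : measurable_fun [set: T] (fun y => ((h \o snd) \_ E) (x, y)).
  by apply: (measurableT_comp (measurable_snd_cell k mh)); exact: measurable_pair1.
transitivity (\int[mu]_x \int[mu]_y f (x, y)).
  apply: eq_integral => x _; rewrite fubini_cell.
  by rewrite -ge0_integralZl.
rewrite (fubini_tonelli f mf f0); apply: eq_integral => y _.
transitivity (\int[mu]_(x in cell k y) (g y * h y)).
  rewrite [RHS]integral_mkcond; apply: eq_integral => x _.
  rewrite /f !patchE in_cell in_same/= same_sym; case: ifPn => [/cg->//|_].
  by rewrite mule0.
by rewrite integral_cst//; congr (_ * _); exact: measure_cell.
Qed.

End grid_averages.

(* Names the constant under the section notations [avg]. *)
Local Notation avg_def := avg (only parsing).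

Section grid_averages2.
Context d (T : measurableType d) (R : realType).
Context (mu : {sigma_finite_measure set T -> \bar R}) (delta : R).
Context (G : grid mu delta).
Let delta01 : 0 < delta < 1 := grid_delta G.
Local Notation cell := (cell G).
Local Notation vol := (vol G).
Local Notation avg := (avg G).
Local Notation locint := (locint G).
Local Notation cellwise := (cellwise G).
Local Hint Resolve measurable_cell : core.

Implicit Types (f g h : T -> R).

Let vgt0 k : 0 < vol k. Proof. exact: vol_gt0. Qed.

Let voln0 k : vol k != 0. Proof. exact: vol_neq0. Qed.

Lemma locint0 g : measurable_fun [set: T] g ->
  (forall x, mu.-integrable (cell 0 x) (EFin \o g)) -> locint g.
Proof.
move=> mg ig; split=> // k x; apply: integrableS (ig x) => //.
by move=> y; exact: same_le.
Qed.

Lemma locint_le f g : measurable_fun [set: T] f -> locint g ->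
  (forall x, `|f x| <= `|g x|) -> locint f.
Proof.
move=> mf [mg ig] fg; split => // k x.
apply: (le_integrable _ _ _ (ig k x)) => //.
  by apply/measurable_EFinP; exact: measurable_funTS.
by move=> y _; rewrite lee_fin.
Qed.

Lemma locintD f g : locint f -> locint g -> locint (fun x => f x + g x).
Proof.
move=> [mf If] [mg Ig]; split; first exact: measurable_funD.
move=> k x; rewrite (_ : _ \o _ = (EFin \o f) \+ (EFin \o g))%E//.
exact: integrableD.
Qed.

Lemma locintZ c f : locint f -> locint (fun x => c * f x).
Proof.
move=> [mf If]; split; first by apply: measurable_funM.
by move=> k x; exact: (integrableZl (measurable_cell G k x) c (If k x)).
Qed.

Lemma locintN f : locint f -> locint (fun x => - f x).
Proof. by under [X in _ -> locint X]eq_fun do rewrite -mulN1r; exact: locintZ. Qed.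

Lemma locintB f g : locint f -> locint g -> locint (fun x => f x - g x).
Proof. by move=> If Ig; apply: locintD => //; exact: locintN. Qed.

Lemma locint_norm f : locint f -> locint (fun x => `|f x|).
Proof.
move=> If; apply: (locint_le _ If) => [|x]; last by rewrite normr_id.
by case: If => mf _; exact: measurableT_comp.
Qed.

Lemma locint_cst c : locint (fun=> c).
Proof.
split=> // k x; apply/integrableP; split=> /=.
  exact/measurable_EFinP.
apply: (@le_lt_trans _ _ (`|c| * vol k)%:E); last exact: ltry.
rewrite le_eqVlt; apply/orP; left; apply/eqP.
rewrite EFinM -(measure_cell G k x).
exact: (integral_cst mu (measurable_cell G k x) `|c|%:E).
Qed.

Lemma EFin_avg k g x : locint g ->
  (\int[mu]_(y in cell k x) (g y)%:E)%E = (avg k g x * vol k)%:E.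
Proof.
move=> [_ ig]; rewrite /avg_def mulrAC mulVf// mul1r /Rintegral fineK//.
exact: (integrable_fin_num _ (ig k x)).
Qed.

Lemma avgD k f g x : locint f -> locint g ->
  avg k (fun y => f y + g y) x = avg k f x + avg k g x.
Proof. by move=> [_ If] [_ Ig]; rewrite /avg_def RintegralD// mulrDr. Qed.

Lemma avgZ k c f x : locint f -> avg k (fun y => c * f y) x = c * avg k f x.
Proof. by move=> [_ If]; rewrite /avg_def RintegralZl// mulrCA. Qed.

Lemma avgB k f g x : locint f -> locint g ->
  avg k (fun y => f y - g y) x = avg k f x - avg k g x.
Proof. by move=> [_ If] [_ Ig]; rewrite /avg_def RintegralB// mulrBr. Qed.

Lemma avg_cst k c x : avg k (fun=> c) x = c.
Proof.
by rewrite /avg_def Rintegral_cst//= measure_cell/= mulrCA mulVf// mulr1.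
Qed.

Lemma avg_le k f g x : locint f -> locint g ->
  (forall y, same G k x y -> f y <= g y) -> avg k f x <= avg k g x.
Proof.
move=> [_ If] [_ Ig] fg; rewrite ler_pM2l ?invr_gt0//.
exact: le_Rintegral.
Qed.

Lemma avg_ge0 k f x : (forall y, 0 <= f y) -> 0 <= avg k f x.
Proof. by move=> f0; rewrite mulr_ge0 ?invr_ge0 ?(ltW (vgt0 _))// Rintegral_ge0. Qed.

Lemma avg_norm k f x : locint f -> `|avg k f x| <= avg k (fun y => `|f y|) x.
Proof.
move=> [_ If]; rewrite normrM ger0_norm ?invr_ge0 ?(ltW (vgt0 _))//.
by rewrite ler_pM2l ?invr_gt0// le_normr_Rintegral.
Qed.

Lemma measurable_avg k g : measurable_fun [set: T] g ->
  measurable_fun [set: T] (avg k g).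
Proof.
move=> mg; apply: measurable_funM => //; apply: measurableT_comp => //.
under eq_fun do rewrite integralE.
have mE : measurable_fun [set: T] (EFin \o g) by exact/measurable_EFinP.
by apply: emeasurable_funB; apply: measurable_int_cell => //;
  [exact: measurable_funepos|exact: measurable_funeneg].
Qed.

Local Open Scope ereal_scope.

(** Averaging is the conditional expectation onto the cells of generation k. The factor [vol k] of
    [tonelli_cell] is positive and finite, hence cancels even if the integrals are infinite. *)
Lemma int_avg k (g h : T -> R) (D : set T) : measurable D ->
  (forall x y, same G k x y -> D x -> D y) ->
  measurable_fun [set: T] g -> locint h ->
  (forall x, 0 <= g x)%R -> (forall x, 0 <= h x)%R -> cellwise k g ->
  \int[mu]_(x in D) (g x * avg k h x)%:E = \int[mu]_(x in D) (g x * h x)%:E.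
Proof.
move=> mD sD mg lh g0 h0 cg; have mh := lh.1.
(* D is a union of cells, so its indicator can be absorbed into the cellwise factor. *)
pose g' x := (g x * \1_D x)%R.
have g'0 x : (0 <= g' x)%R by rewrite mulr_ge0// indicE.
have mg' : measurable_fun [set: T] g'.
  by apply: measurable_funM => //; exact: measurable_indic.
have cg' : cellwise k g'.
  move=> x y xy; rewrite /g' (cg x y xy) !indicE; congr (_ * (nat_of_bool _)%:R)%R.
  by apply/idP/idP; rewrite !inE; apply: sD => //; rewrite same_sym.
have E u : \int[mu]_(x in D) (g x * u x)%:E = \int[mu]_x (g' x * u x)%:E.
  rewrite integral_mkcond; apply: eq_integral => x _.
  by rewrite patchE /g' indicE; case: ifP => _; rewrite ?mulr1// mulr0 mul0r.
rewrite !E.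
have ml : measurable_fun [set: T] (EFin \o (fun x => g' x * avg k h x)%R).
  by apply/measurable_EFinP/measurable_funM => //; exact: measurable_avg.
have mr : measurable_fun [set: T] (EFin \o (fun x => g' x * h x)%R).
  by apply/measurable_EFinP/measurable_funM.
have key : (\int[mu]_x (g' x * avg k h x)%:E) * (vol k)%:E =
           (\int[mu]_x (g' x * h x)%:E) * (vol k)%:E.
  rewrite -!ge0_integralZr//; last 4 first.
  - by move=> x _; rewrite lee_fin mulr_ge0.
  - by rewrite lee_fin ltW.
  - by move=> x _; rewrite lee_fin mulr_ge0// avg_ge0.
  - by rewrite lee_fin ltW.
  transitivity (\int[mu]_x ((g' x)%:E * \int[mu]_(y in cell k x) (h y)%:E)).
    by apply: eq_integral => x _; rewrite EFin_avg// -!EFinM; congr EFin; ring.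
  have mEg : measurable_fun [set: T] (EFin \o g') by exact/measurable_EFinP.
  have mEh : measurable_fun [set: T] (EFin \o h) by exact/measurable_EFinP.
  have cEg : cellwise k (EFin \o g') by move=> x y xy; rewrite /= (cg' x y xy).
  exact: (tonelli_cell mEg mEh g'0 h0 cEg).
have vp : 0 < (vol k)%:E by rewrite lte_fin.
apply/eqP; rewrite eq_le -(@lee_pmul2r _ (vol k)%:E isT vp) key lexx/=.
by rewrite -(@lee_pmul2r _ (vol k)%:E isT vp) key lexx.
Qed.

(** Jensen's inequality, by averaging the tangent of the s-th power at the mean [m]. *)
Lemma avg_powR_le k h x (s : R) : (1 <= s)%R -> locint h ->
  locint (fun y => h y `^ s)%R -> (forall y, 0 <= h y)%R ->
  (avg k h x `^ s <= avg k (fun y => h y `^ s) x)%R.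
Proof.
move=> s1 lh lhs h0; set m := avg k h x.
have m0 : (0 <= m)%R by exact: avg_ge0.
have [mz|mn] := eqVneq m 0%R.
  by rewrite mz powR0 ?avg_ge0// => [y|]; rewrite ?powR_ge0//; lra.
have mp : (0 < m)%R by rewrite lt0r mn.
have E : avg k (fun y => m `^ s * (1 - s) + m `^ s * s / m * h y)%R x = (m `^ s)%R.
  rewrite avgD; [|exact: locint_cst|exact: locintZ].
  by rewrite avg_cst avgZ// -/m; field.
rewrite -[leLHS]E; apply: avg_le => //.
  by apply: locintD; [exact: locint_cst|exact: locintZ].
move=> y _; have hm : (0 <= h y / m)%R by rewrite divr_ge0.
have := powR_bernoulli hm s1; move=> /(ler_wpM2l (powR_ge0 m s)).
rewrite -powRM// mulrCA divff// mulr1; apply: le_trans.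
by rewrite le_eqVlt; apply/orP; left; apply/eqP; field.
Qed.

End grid_averages2.

(** * Doob's maximal inequality *)

Section doob.
Context d (T : measurableType d) (R : realType).
Context (mu : {sigma_finite_measure set T -> \bar R}) (delta : R).
Context (G : grid mu delta).
Let delta01 : 0 < delta < 1 := grid_delta G.
Local Notation cell := (cell G).
Local Notation vol := (vol G).
Local Notation avg := (avg G).
Local Notation locint := (locint G).
Local Notation cellwise := (cellwise G).
Implicit Types (f g h : T -> R).

Fixpoint maxavg h k x : R :=
  if k is k'.+1 then Num.max (maxavg h k' x) (avg k h x) else avg 0 h x.

Lemma avg_le_maxavg h j k x : (j <= k)%N -> avg j h x <= maxavg h k x.
Proof.
elim: k => [|k IH]; first by rewrite leqn0 => /eqP ->.
rewrite leq_eqVlt => /predU1P[->|]; first by rewrite /= le_max lexx orbT.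
by rewrite ltnS => /IH jk; rewrite /= le_max jk.
Qed.

Lemma maxavg_cellwise h k : cellwise k (maxavg h k).
Proof.
elim: k => [|k IH] x y xy /=; first exact: avg_cellwise.
by rewrite (IH x y (sameS xy)) (avg_cellwise _ xy).
Qed.

Lemma measurable_maxavg h k : measurable_fun [set: T] h ->
  measurable_fun [set: T] (maxavg h k).
Proof.
move=> mh; elim: k => [|k IH] /=; first exact: measurable_avg.
by apply: measurable_maxr => //; exact: measurable_avg.
Qed.

Section nonneg.
Context (h : T -> R) (lh : locint h) (h0 : forall x, 0 <= h x).

Lemma maxavg_ge0 k x : 0 <= maxavg h k x.
Proof.
by apply: le_trans (avg_le_maxavg h x (leq0n k)); exact: avg_ge0.
Qed.

(** The induction step of Doob's inequality in pointwise form, used in place of level sets. If the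
    new average b exceeds the old maximum a, it amounts to Young's inequality a^(s-1) b <= (1 - 1/s)
    a^s + b^s / s; otherwise the maximum does not change and the two sides coincide. *)
Lemma maxavg_powR_le (s : R) k x : 1 < s ->
  (1 - s^-1) * maxavg h k.+1 x `^ s + maxavg h k x `^ (s - 1) * avg k.+1 h x <=
  (1 - s^-1) * maxavg h k x `^ s + maxavg h k.+1 x `^ (s - 1) * avg k.+1 h x.
Proof.
move=> s1; have s0 : 0 < s by lra.
have si1 : 0 < 1 - s^-1 by rewrite subr_gt0 invf_lt1.
rewrite /=; set a := maxavg h k x; set b := avg k.+1 h x.
have a0 : 0 <= a by exact: maxavg_ge0.
have b0 : 0 <= b by exact: avg_ge0.
have [ba|ab] := leP b a; first by rewrite lexx.
have -> : b `^ (s - 1) * b = b `^ s by rewrite mulrC mulr_powRB1.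
have s'0 : 0 < (1 - s^-1)^-1 by rewrite invr_gt0.
have := conjugate_powR (powR_ge0 a (s - 1)) b0 s'0 s0.
rewrite invrK subrK -powRrM => /(_ erefl).
rewrite (_ : (s - 1) * _ = s); last first.
  by field; rewrite gt_eqF//=; lra.
have : b `^ s / s = b `^ s - (1 - s^-1) * b `^ s by field; rewrite gt_eqF.
by move=> ->; lra.
Qed.

Local Open Scope ereal_scope.

(** Averaging contracts L^s. It supplies the finiteness that the cancellations in [doob] require. *)
Lemma int_avg_powR_le k (s : R) : (1 <= s)%R ->
  \int[mu]_x (h x `^ s)%:E < +oo ->
  \int[mu]_x (avg k h x `^ s)%:E <= \int[mu]_x (h x `^ s)%:E.
Proof.
move=> s1 hoo; have mh := lh.1.
have mhs := measurable_EFin_powR s mh.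
have lhs : locint (fun y => h y `^ s)%R.
  split; first exact/measurable_EFinP.
  move=> j x; apply: (@integrableS _ _ _ mu setT) => //.
    exact: measurable_cell.
  apply/integrableP; split => //.
  by under eq_integral do rewrite /= ger0_norm ?powR_ge0//.
apply: (@le_trans _ _ (\int[mu]_x (avg k (fun y => h y `^ s) x)%R%:E)).
  apply: ge0_le_integral => //.
  - by move=> x _; rewrite lee_fin powR_ge0.
  - by apply: measurable_EFin_powR; exact: measurable_avg.
  - by apply/measurable_EFinP/measurable_avg; case: lhs.
  - by move=> x _; rewrite lee_fin avg_powR_le.
have := @int_avg _ _ _ _ _ G k (cst 1%R) (fun y => h y `^ s)%R setT.
move=> /(_ _ _ _ _ _ _ _)/wrap[]//.
- by move=> x; rewrite powR_ge0.
- under eq_integral do rewrite mul1r.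
  by under [X in _ = X -> _]eq_integral do rewrite mul1r; move=> ->.
Qed.

Lemma doob (s : R) N : (1 < s)%R ->
  \int[mu]_x (maxavg h N x `^ s)%:E <=
  (2 `^ s / (s - 1))%:E * \int[mu]_x (h x `^ s)%:E.
Proof.
move=> s1; have s0 : (0 < s)%R by lra.
have si1 : (0 < 1 - s^-1)%R by rewrite subr_gt0 invf_lt1.
have mh := lh.1.
have mM k : measurable_fun [set: T] (maxavg h k) by exact: measurable_maxavg.
have hs0 : 0 <= \int[mu]_x (h x `^ s)%:E.
  by apply: integral_ge0 => x _; rewrite lee_fin powR_ge0.
have C0 : (0 < 2 `^ s / (s - 1))%R by rewrite divr_gt0 ?powR_gt0//; lra.
have [hy|] := eqVneq (\int[mu]_x (h x `^ s)%:E) +oo.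
  by rewrite hy gt0_muley ?leey// lte_fin.
rewrite -ltey => hoo.
pose I k := \int[mu]_x (maxavg h k x `^ s)%:E.
pose J k := \int[mu]_x (maxavg h k x `^ (s - 1) * h x)%:E.
have I0 k : 0 <= I k.
  by apply: integral_ge0 => x _; rewrite lee_fin powR_ge0.
have J0 k : 0 <= J k.
  by apply: integral_ge0 => x _; rewrite lee_fin mulr_ge0// powR_ge0.
have mMs k r : measurable_fun [set: T] (fun x => maxavg h k x `^ r)%R.
  by apply/measurable_EFinP/measurable_EFin_powR.
have mhs : measurable_fun [set: T] (fun x => h x `^ s)%R.
  by apply/measurable_EFinP/measurable_EFin_powR.
have Ioo k : I k < +oo.
  elim: k => [|k IH].
    exact: le_lt_trans (int_avg_powR_le 0 (ltW s1) hoo) hoo.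
  apply: (@le_lt_trans _ _ (I k + \int[mu]_x (avg k.+1 h x `^ s)%:E)); last first.
    apply: (lte_add_pinfty IH).
    exact: le_lt_trans (int_avg_powR_le k.+1 (ltW s1) hoo) hoo.
  have ma : measurable_fun [set: T] (fun x => avg k.+1 h x `^ s)%R.
    by apply/measurable_EFinP/measurable_EFin_powR/measurable_avg.
  rewrite -ge0_integralD//; last 4 first.
  - by move=> x _; rewrite lee_fin powR_ge0.
  - exact/measurable_EFinP.
  - by move=> x _; rewrite lee_fin powR_ge0.
  - exact/measurable_EFinP.
  apply: ge0_le_integral => //.
  - by move=> x _; rewrite lee_fin powR_ge0.
  - exact/measurable_EFinP/(mMs k.+1).
  - by apply: emeasurable_funD; exact/measurable_EFinP.
  - move=> x _; rewrite -EFinD lee_fin /= maxEle.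
    by case: ifP => _; rewrite ?lerDl ?lerDr powR_ge0.
(* With c = 1 this gives the finiteness of [J k]; at the end c is tuned so that [I N] can be
   absorbed. *)
have young k (c : R) : (0 < c)%R -> J k <=
    (c `^ s / s)%:E * \int[mu]_x (h x `^ s)%:E +
    (c `^ (- (1 - s^-1)^-1) * (1 - s^-1))%:E * I k.
  move=> c0; have s'0 : (0 < (1 - s^-1)^-1)%R by rewrite invr_gt0.
  rewrite -!ge0_integralZl_EFin//; last 6 first.
  - by move=> x _; rewrite lee_fin powR_ge0.
  - exact/measurable_EFinP.
  - by rewrite mulr_ge0 ?powR_ge0 ?ltW.
  - by move=> x _; rewrite lee_fin powR_ge0.
  - exact/measurable_EFinP.
  - by rewrite divr_ge0 ?powR_ge0 ?ltW.
  rewrite -ge0_integralD//; last 4 first.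
  - by move=> x _; rewrite -EFinM lee_fin mulr_ge0 ?divr_ge0 ?powR_ge0 ?ltW.
  - by apply: emeasurable_funM => //; exact/measurable_EFinP.
  - by move=> x _; rewrite -EFinM lee_fin !mulr_ge0 ?powR_ge0 ?ltW.
  - by apply: emeasurable_funM => //; exact/measurable_EFinP.
  apply: ge0_le_integral => //.
  - by move=> x _; rewrite lee_fin mulr_ge0 ?powR_ge0.
  - by apply/measurable_EFinP/measurable_funM.
  - by apply: emeasurable_funD; apply: emeasurable_funM => //; exact/measurable_EFinP.
  - move=> x _; rewrite -!EFinM -EFinD lee_fin; set m := maxavg h k x.
    have m0 : (0 <= m)%R by exact: maxavg_ge0.
    have := conjugate_powR (mulr_ge0 (ltW c0) (h0 x))
      (divr_ge0 (powR_ge0 m (s - 1)) (ltW c0)) s0 s'0.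
    rewrite invrK subrKC => /(_ erefl).
    rewrite (_ : c * h x * _ = m `^ (s - 1) * h x)%R; last first.
      by field; rewrite gt_eqF.
    rewrite powRM ?(ltW c0)//.
    have -> : ((m `^ (s - 1) / c) `^ (1 - s^-1)^-1 =
               m `^ s * c `^ (- (1 - s^-1)^-1))%R.
      rewrite powRM ?powR_ge0 ?invr_ge0 ?(ltW c0)// -(powR_inv1 (ltW c0)).
      rewrite -!powRrM mulN1r (_ : (s - 1) * _ = s)%R//.
      by field; rewrite gt_eqF//=; lra.
    move=> /le_trans; apply; rewrite le_eqVlt; apply/orP; left; apply/eqP.
    by ring.
have Joo k : J k < +oo.
  apply: le_lt_trans (young k 1%R ltr01) _.
  apply: lte_add_pinfty.
    have c1 : 0 <= (1 `^ s / s)%R%:E by rewrite lee_fin divr_ge0 ?powR_ge0 ?(ltW s0).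
    exact: (lte_mul_pinfty c1 isT hoo).
  have c2 : 0 <= (1 `^ (- (1 - s^-1)^-1) * (1 - s^-1))%R%:E.
    by rewrite lee_fin mulr_ge0 ?powR_ge0 ?(ltW si1).
  exact: (lte_mul_pinfty c2 isT (Ioo k)).
have ia := @int_avg _ _ _ _ _ G.
(* Integrate [maxavg_powR_le]. The maxima of generations k and k.+1 are constant on cells of
   generation k.+1, so there [avg k.+1 h] may be replaced by h, which produces [J k] and [J k.+1];
   the finite [J k] then cancels. *)
have main k : (1 - s^-1)%:E * I k <= J k.
  elim: k => [|k IH].
    have P0 x : (0 <= maxavg h 0 x `^ (s - 1))%R by rewrite powR_ge0.
    have cw : cellwise 0 (fun x => maxavg h 0 x `^ (s - 1))%R.
      by move=> x y xy; rewrite (maxavg_cellwise h xy).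
    rewrite /J -(ia 0%N _ h setT measurableT (fun _ _ _ _ => Logic.I) (mMs 0%N _) lh P0 h0 cw).
    apply: (@le_trans _ _ (1 * I 0%N)).
      by apply: lee_wpmul2r; [exact: I0|rewrite lee_fin gerBl invr_ge0 ltW].
    rewrite mul1e le_eqVlt; apply/orP; left; apply/eqP; apply: eq_integral => x _.
    by rewrite /= mulrC mulr_powRB1// avg_ge0.
  have E j : (j <= k.+1)%N ->
      \int[mu]_x (maxavg h j x `^ (s - 1) * avg k.+1 h x)%:E = J j.
    move=> jk; rewrite (ia k.+1 (fun x => maxavg h j x `^ (s - 1))%R h setT)//.
    - by move=> x; rewrite powR_ge0.
    - by move=> x y xy; rewrite (cellwise_le jk (@maxavg_cellwise h j) xy).
  have ma : measurable_fun [set: T] (avg k.+1 h) by exact: measurable_avg.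
  have : (1 - s^-1)%:E * I k.+1 + J k <= (1 - s^-1)%:E * I k + J k.+1.
    have mMe j : measurable_fun [set: T] (fun x => (maxavg h j x `^ s)%:E).
      exact/measurable_EFinP.
    have pMe j x : [set: T] x -> 0 <= (maxavg h j x `^ s)%:E.
      by move=> _; rewrite lee_fin powR_ge0.
    rewrite -(E k (leqnSn k)) -(E k.+1 (leqnn _)) /I.
    rewrite -(ge0_integralZl_EFin mu measurableT (pMe k.+1) (mMe k.+1) (ltW si1)).
    rewrite -(ge0_integralZl_EFin mu measurableT (pMe k) (mMe k) (ltW si1)).
    have mm j : measurable_fun [set: T]
        (EFin \o (fun x => maxavg h j x `^ (s - 1) * avg k.+1 h x)%R).
      by apply/measurable_EFinP/measurable_funM.
    have mI j : measurable_fun [set: T]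
        (fun x => (1 - s^-1)%:E * (maxavg h j x `^ s)%:E).
      by apply: emeasurable_funM => //; exact/measurable_EFinP.
    have pm j x : 0 <= (maxavg h j x `^ (s - 1) * avg k.+1 h x)%:E.
      by rewrite lee_fin mulr_ge0 ?powR_ge0 ?avg_ge0.
    have pI j x : 0 <= (1 - s^-1)%:E * (maxavg h j x `^ s)%:E.
      by rewrite -EFinM lee_fin mulr_ge0 ?powR_ge0 ?ltW.
    rewrite -(ge0_integralD mu measurableT (fun x _ => pI k.+1 x) (mI k.+1)
      (fun x _ => pm k x) (mm k)).
    rewrite -(ge0_integralD mu measurableT (fun x _ => pI k x) (mI k)
      (fun x _ => pm k.+1 x) (mm k.+1)).
    apply: ge0_le_integral => //.
    - by move=> x _; rewrite adde_ge0.
    - by apply: emeasurable_funD; [exact: (mI k.+1)|exact: mm].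
    - by apply: emeasurable_funD; [exact: mI|exact: (mm k.+1)].
    - by move=> x _; rewrite -!EFinM -!EFinD lee_fin maxavg_powR_le.
  move=> /le_trans/(_ (leeD2r _ IH)); rewrite [leRHS]addeC leeD2rE//.
  by rewrite ge0_fin_numE.
(* With c = 2^(1 - 1/s), the coefficient of [I N] on the right is half of that on the left, and c^s
   = 2^(s-1) accounts for the final constant. *)
have h2 := young N (2 `^ (1 - s^-1))%R (powR_gt0 _ (ltr0n _ 2)).
have := le_trans (main N) h2.
rewrite -!powRrM (_ : (1 - s^-1) * - (1 - s^-1)^-1 = -1)%R; last first.
  by field; rewrite !gt_eqF//=; lra.
rewrite powR_inv1//.
have IN : I N \is a fin_num by rewrite (ge0_fin_numE (I0 N)); exact: Ioo.
have hf : \int[mu]_x (h x `^ s)%:E \is a fin_num by rewrite ge0_fin_numE.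
rewrite -/(I N) -(fineK IN) -(fineK hf) -!EFinM -EFinD !lee_fin.
rewrite (_ : (1 - s^-1) * s = s - 1)%R; last by field; rewrite gt_eqF.
rewrite powRB; last by rewrite pnatr_eq0 implybT.
rewrite (powRr1 (ler0n _ 2)); set u := fine (I N); set v := fine _; set w := (2 `^ s)%R => H.
rewrite -(@ler_pM2l _ ((1 - s^-1) / 2))%R; last by rewrite divr_gt0.
rewrite (_ : (1 - s^-1) / 2 * (w / (s - 1) * v) = w / 2 / s * v)%R; last first.
  by field; rewrite !gt_eqF//=; lra.
by lra.
Qed.

End nonneg.

End doob.

(** * The John-Nirenberg inequality on a nested partition *)

Section exprn_inequalities.
Context {R : realDomainType}.
Implicit Types a b M : R.

Lemma expr_add_le a b r : 0 <= a -> 0 <= b ->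
  (a + b) ^+ r <= 2 ^+ r * (a ^+ r + b ^+ r).
Proof.
move=> a0 b0; wlog ab : a b a0 b0 / a <= b => [h|].
  have [ab|/ltW ba] := leP a b; first exact: h.
  by rewrite addrC [X in _ * X]addrC; apply: h.
apply: (@le_trans _ _ ((2 * b) ^+ r)).
  by rewrite lerXn2r ?nnegrE ?addr_ge0 ?mulr_ge0//; lra.
by rewrite exprMn ler_wpM2l ?exprn_ge0// lerDr exprn_ge0.
Qed.

Lemma subrX_le a b M r : 0 <= b -> b <= a -> a <= M ->
  a ^+ r.+1 - b ^+ r.+1 <= r.+1%:R * M ^+ r * (a - b).
Proof.
move=> b0 ba aM; elim: r => [|r IH]; first by rewrite !expr1 mul1r expr0 mul1r.
have a0 : 0 <= a by lra.
have M0 : 0 <= M by lra.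
have -> : a ^+ r.+2 - b ^+ r.+2 = a * (a ^+ r.+1 - b ^+ r.+1) + b ^+ r.+1 * (a - b).
  by rewrite (exprS a r.+1) (exprS b r.+1); ring.
have -> : r.+2%:R * M ^+ r.+1 * (a - b) =
    M * (r.+1%:R * M ^+ r * (a - b)) + M ^+ r.+1 * (a - b).
  by rewrite (exprS M r) -(natr1 r.+1); ring.
apply: lerD.
  apply: ler_pM => //; rewrite subr_ge0 lerXn2r ?nnegrE//.
by rewrite ler_wpM2r ?subr_ge0// lerXn2r ?nnegrE//; lra.
Qed.

(** A truncated power is Lipschitz, so approximation in mean is enough to control it; this transfers
    moment bounds from the averages of a function to the function itself. *)
Lemma minXr_le a b M r : 0 <= a -> 0 <= b -> 0 <= M ->
  Num.min a M ^+ r.+1 <= b ^+ r.+1 + r.+1%:R * M ^+ r * `|a - b|.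
Proof.
move=> a0 b0 M0; have c0 : 0 <= r.+1%:R * M ^+ r by rewrite mulr_ge0 ?exprn_ge0.
have m0 : 0 <= Num.min a M by rewrite le_min a0.
have [mb|bm] := leP (Num.min a M) b.
  apply: (@le_trans _ _ (b ^+ r.+1)); first by rewrite lerXn2r ?nnegrE.
  by rewrite lerDl mulr_ge0.
have mM : Num.min a M <= M by rewrite ge_min lexx orbT.
rewrite -lerBlDl; apply: le_trans (subrX_le r b0 (ltW bm) mM) _.
rewrite ler_wpM2l// ler_normr; apply/orP; left.
by rewrite lerD2r ge_min lexx.
Qed.

End exprn_inequalities.

Section john_nirenberg.
Context d (T : measurableType d) (R : realType).
Context (mu : {sigma_finite_measure set T -> \bar R}) (delta : R).
Context (G : grid mu delta).
Let delta01 : 0 < delta < 1 := grid_delta G.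
Local Hint Resolve measurable_cell : core.
Local Notation cell := (cell G).
Local Notation vol := (vol G).
Local Notation avg := (avg G).
Local Notation locint := (locint G).
Local Notation cellwise := (cellwise G).
Implicit Types (f g h : T -> R).

Lemma locint_bounded f M : measurable_fun [set: T] f ->
  (forall x, `|f x| <= M) -> locint f.
Proof.
move=> mf fM; apply: (locint_le mf (locint_cst G M)) => x.
by rewrite (le_trans (fM x))// ler_norm.
Qed.

Lemma locint_sum m (F : 'I_m -> T -> R) : (forall i, locint (F i)) ->
  locint (fun y => \sum_(i < m) F i y).
Proof.
elim: m F => [|m IH] F lF.
  by under eq_fun do rewrite big_ord0; exact: locint_cst.
under eq_fun do rewrite big_ord_recr/=.
by apply: locintD => //; exact: IH.
Qed.

Lemma avg_sum m (F : 'I_m -> T -> R) k x : (forall i, locint (F i)) ->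
  avg k (fun y => \sum_(i < m) F i y) x = \sum_(i < m) avg k (F i) x.
Proof.
elim: m F => [|m IH] F lF.
  by under eq_fun do rewrite big_ord0; rewrite big_ord0 avg_cst.
under eq_fun do rewrite big_ord_recr/=.
by rewrite avgD ?IH ?big_ord_recr//; exact: locint_sum.
Qed.

Lemma avg_tower k j g h x : (k <= j)%N -> measurable_fun [set: T] g ->
  (forall y, 0 <= g y) -> cellwise j g -> locint h -> (forall y, 0 <= h y) ->
  avg k (fun y => g y * avg j h y) x = avg k (fun y => g y * h y) x.
Proof.
move=> kj mg g0 cg lh h0; congr (_ * fine _).
apply: int_avg => //.
move=> y z yz xy; exact: (same_trans xy (same_le kj yz)).
Qed.

Context (b : T -> R) (B : R).
Context (lb : locint b) (B0 : 0 < B)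
  (osc : forall k x, avg k (fun y => `|b y - avg k b x|) x <= B).

Lemma measurable_avgb k : measurable_fun [set: T] (avg k b).
Proof. by apply: measurable_avg; case: lb. Qed.

(** The mean oscillation over a child is at most the one over its parent, around the same constant,
    divided by the ratio [delta] of the volumes. *)
Lemma avg_step k x : `|avg k.+1 b x - avg k b x| <= B / delta.
Proof.
have /andP[d0 d1] := delta01.
have lc : locint (fun=> avg k b x) by exact: locint_cst.
have lbc := locint_norm (locintB lb lc).
rewrite -[X in _ - X](avg_cst G k.+1 _ x) -avgB//.
apply: (le_trans (avg_norm _ _ _)) => //; first exact: locintB.
apply: (@le_trans _ _ (avg k (fun y => `|b y - avg k b x|) x / delta)); last first.
  by rewrite ler_pM2r ?invr_gt0.
rewrite /avg_def volS [leRHS]mulrAC (mulrC delta) invfM.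
rewrite ler_pM2l ?mulr_gt0 ?invr_gt0 ?vol_gt0//.
rewrite fine_le//; [exact: (integrable_fin_num _ (lbc.2 _ _))..|].
apply: ge0_subset_integral => //.
- by apply/measurable_EFinP/measurable_funTS; case: lbc.
- by move=> y; exact: sameS.
Qed.

Lemma avg_steps k i x : `|avg (k + i)%N b x - avg k b x| <= i%:R * (B / delta).
Proof.
elim: i => [|i IH]; first by rewrite addn0 subrr normr0 mul0r.
rewrite addnS (_ : _ - _ = (avg (k + i).+1 b x - avg (k + i) b x) +
  (avg (k + i) b x - avg k b x)); last by ring.
rewrite -natr1 mulrDl mul1r [leRHS]addrC.
by rewrite (le_trans (ler_normD _ _))// lerD ?avg_step.
Qed.

(** With lam = 2^(r+1) B and c = (lam + B / delta)^r, this is 2 lam^r + c, the solution of X = lam^r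
    + 2^r (c + X) / 2^(r+1). That equation closes the induction of [john_nirenberg_avg]. *)
Definition jn_const (r : nat) : R :=
  2 * (2 ^+ r.+1 * B) ^+ r + (2 ^+ r.+1 * B + B / delta) ^+ r.

Section first_exit.
Context (k r : nat) (x : T).
Let lam : R := 2 ^+ r.+1 * B.
Let lam0 : 0 < lam. Proof. by rewrite mulr_gt0 ?exprn_gt0. Qed.

(* stay i is the indicator of the points whose averages over the cells of
   generations k+1, ..., k+i stay lam-close to the average over the cell of
   generation k. *)
Fixpoint stay i (y : T) : R :=
  if i is i'.+1 then
    stay i' y * (`|avg (k + i) b y - avg k b y| <= lam)%R%:R
  else 1.

(** The first exit takes place at generation [k + i + 1], whereas [stay i] looks no further than
    [k + i]. *)
Definition exit i y : R := stay i y * (lam < `|avg (k + i.+1) b y - avg k b y|)%R%:R.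

Lemma stay01 i y : stay i y = 0 \/ stay i y = 1.
Proof.
elim: i => [|i [] /= ->]; [by right|by left; rewrite mul0r|].
by case: (_ <= _)%R; [right; rewrite mul1r|left; rewrite mulr0].
Qed.

Lemma exit01 i y : exit i y = 0 \/ exit i y = 1.
Proof.
rewrite /exit; case: (stay01 i y) => ->; first by left; rewrite mul0r.
by case: (_ < _)%R; [right; rewrite mul1r|left; rewrite mulr0].
Qed.

Lemma exit_ge0 i y : 0 <= exit i y.
Proof. by case: (exit01 i y) => ->. Qed.

Lemma stay_sum m y : stay m y + \sum_(i < m) exit i y = 1.
Proof.
elim: m => [|m IH]; first by rewrite big_ord0 addr0.
rewrite big_ord_recr/= addrCA -[RHS]IH addrC; congr (_ + _).
by rewrite -mulrDr /exit ltNge; case: (_ <= _)%R; rewrite ?addr0 ?add0r ?mulr1.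
Qed.

Lemma measurable_stay i : measurable_fun [set: T] (stay i).
Proof.
elim: i => [|i IH] //=; apply: measurable_funM => //.
apply: (@measurableT_comp _ _ _ _ _ _ (fun c : bool => c%:R : R)) => //.
apply: measurable_fun_ler => //; apply: measurableT_comp => //.
by apply: measurable_funB; exact: measurable_avgb.
Qed.

Lemma measurable_exit i : measurable_fun [set: T] (exit i).
Proof.
apply: measurable_funM; first exact: measurable_stay.
apply: (@measurableT_comp _ _ _ _ _ _ (fun c : bool => c%:R : R)) => //.
apply: measurable_fun_ltr => //; apply: measurableT_comp => //.
by apply: measurable_funB; exact: measurable_avgb.
Qed.

Lemma stay_cellwise i : cellwise (k + i) (stay i).
Proof.
elim: i => [|i IH] y z yz //=; move: (yz); rewrite {1}addnS => yz'.
by rewrite (IH y z (sameS yz')) (avg_cellwise b yz) (avg_cellwise b (same_le (leq_addr _ _) yz)).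
Qed.

Lemma exit_cellwise i : cellwise (k + i.+1) (exit i).
Proof.
move=> y z yz; rewrite /exit (stay_cellwise (same_le _ yz)) ?leq_add2l//.
by rewrite (avg_cellwise b yz) (avg_cellwise b (same_le (leq_addr _ _) yz)).
Qed.

Lemma locint_exit i : locint (exit i).
Proof.
apply: (@locint_bounded _ 1); first exact: measurable_exit.
by move=> y; case: (exit01 i y) => ->; rewrite ?normr0 ?normr1.
Qed.

(** Chebyshev's inequality over disjoint stopping cells: on a cell of first exit the average of |b -
    c| exceeds [lam], and together these cells carry at most the oscillation B. The size of [lam] is
    chosen so that the result beats the factor 2^r of [expr_add_le]. *)
Lemma sum_exit_le m : \sum_(i < m) avg k (exit i) x <= (2 ^+ r.+1)^-1.
Proof.
set c := avg k b x.
have lc : locint (fun=> c) by exact: locint_cst.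
have lbc := locint_norm (locintB lb lc).
have le1 i y : exit i y <= 1 by case: (exit01 i y) => ->.
have lE i : locint (fun y => exit i y * `|b y - c|).
  apply: (locint_le _ lbc).
    by apply: measurable_funM; [exact: measurable_exit|case: lbc].
  by move=> y; rewrite normrM ler_piMl// ger0_norm ?exit_ge0.
suff : lam * \sum_(i < m) avg k (exit i) x <= B.
  rewrite /lam -mulrA mulrCA -[leRHS]mulr1 ler_pM2l// => h.
  by rewrite -[leLHS]mul1r -(@ler_pM2l _ (2 ^+ r.+1)) ?exprn_gt0// mul1r mulfV ?expf_neq0.
rewrite mulr_sumr; apply: (@le_trans _ _ (\sum_(i < m) avg k (fun y => exit i y * `|b y - c|) x)).
  apply: ler_sum => i _; rewrite -avgZ; last exact: locint_exit.
  rewrite -(avg_tower x (leq_addr _ _) (measurable_exit i) (exit_ge0 i)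
    (@exit_cellwise i) lbc (fun y => normr_ge0 _)).
  have mA : measurable_fun [set: T] (avg (k + i.+1) (fun y => `|b y - c|)).
    by apply: measurable_avg => //; case: lbc.
  apply: avg_le => //; first by apply: locintZ => //; exact: locint_exit.
    apply: locint0; first by apply: measurable_funM => //; exact: measurable_exit.
    move=> z; apply/integrableP; split.
      by apply/measurable_EFinP/measurable_funTS/measurable_funM => //; exact: measurable_exit.
    rewrite (eq_integral (fun y => (exit i y * avg (k + i.+1) (fun y => `|b y - c|) y)%:E)).
      rewrite (@int_avg _ _ _ _ _ G (k + i.+1) (exit i)); last 7 first.
      - exact: measurable_cell.
      - by move=> u v uv zu; exact: same_trans zu (same_le _ uv).
      - exact: measurable_exit.
      - exact: lbc.
      - exact: exit_ge0.
      - by [].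
      - exact: exit_cellwise.
      by have /integrableP[_] := (lE i).2 0%N z; apply: le_lt_trans; apply: ge0_le_integral => //;
       [by move=> y _; rewrite lee_fin mulr_ge0 ?exit_ge0|
        by apply/measurable_EFinP/measurable_funTS; case: (lE i)|
        by apply/measurableT_comp => //; apply/measurable_EFinP/measurable_funTS; case: (lE i)|
        by move=> y _; rewrite lee_fin ler_norm].
    by move=> y _; rewrite /= ger0_norm// mulr_ge0 ?exit_ge0 ?avg_ge0.
  move=> y xy; rewrite mulrC; have := exit_ge0 i y; rewrite le_eqVlt.
  move=> /predU1P[<-|e0]; first by rewrite !mul0r.
  rewrite ler_pM2l//; move: e0; rewrite /exit; case: (ltP lam) => [h _|_]; last by rewrite mulr0 ltxx.
  apply: (le_trans (ltW h)); rewrite -(avg_cellwise b xy) -/c.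
  rewrite -[X in `|_ - X|](avg_cst G (k + i.+1) _ y) -avgB//.
  by apply: avg_norm => //; exact: locintB.
rewrite -avg_sum; last exact: lE.
apply: le_trans (osc k x); apply: avg_le => //; first exact: locint_sum.
move=> y _; rewrite -mulr_suml ler_piMl//.
by rewrite -(stay_sum m y) lerDr; case: (stay01 m y) => ->.
Qed.

(** A point that never exits has moved by at most [lam]. One that exits at generation [k + i + 1]
    was within [lam] one generation earlier, so by [avg_step] it has moved by at most
    [lam + B / delta] at the exit; the remaining displacement starts from the exit cell. *)
Lemma first_exit_le m y : `|avg (k + m) b y - avg k b y| ^+ r <=
  lam ^+ r + \sum_(i < m) exit i y *
    (2 ^+ r * ((lam + B / delta) ^+ r + `|avg (k + m) b y - avg (k + i.+1) b y| ^+ r)).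
Proof.
have bd0 : 0 <= B / delta by rewrite divr_ge0 ?ltW//; case/andP: delta01.
rewrite -[leLHS]mul1r -{1}(stay_sum m y) mulrDl; apply: lerD.
  case: m => [|m].
    by rewrite addn0 subrr normr0 mul1r lerXn2r ?nnegrE ?(ltW lam0).
  rewrite /=; case: (stay01 m y) => ->; first by rewrite !mul0r exprn_ge0// ltW.
  case: (leP _ lam) => h; rewrite ?mul1r ?mul0r ?exprn_ge0 ?(ltW lam0)//.
  by rewrite lerXn2r ?nnegrE ?(ltW lam0).
rewrite mulr_suml; apply: ler_sum => i _.
have := exit_ge0 i y; rewrite le_eqVlt => /predU1P[<-|e0]; first by rewrite !mul0r.
rewrite ler_pM2l//; apply: le_trans (expr_add_le _ _ _) => //; last first.
  by rewrite addr_ge0 ?(ltW lam0).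
rewrite lerXn2r ?nnegrE ?addr_ge0 ?(ltW lam0)//.
rewrite (_ : _ - _ = (avg (k + i.+1) b y - avg k b y) +
  (avg (k + m) b y - avg (k + i.+1) b y)); last by ring.
apply: (le_trans (ler_normD _ _)); rewrite lerD2r.
have hs : `|avg (k + i) b y - avg k b y| <= lam.
  move: e0; rewrite /exit; case: (nat_of_ord i) => [_|i'].
    by rewrite addn0 subrr normr0 ltW.
  by rewrite /=; case: (leP `|avg (k + i'.+1) b y - avg k b y|) => // _; rewrite mulr0 mul0r ltxx.
rewrite addnS (_ : _ - _ = (avg (k + i) b y - avg k b y) +
  (avg (k + i).+1 b y - avg (k + i) b y)); last by ring.
by apply: (le_trans (ler_normD _ _)); apply: lerD => //; exact: avg_step.
Qed.

End first_exit.

Lemma jn_const_ge0 r : 0 <= jn_const r.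
Proof.
have /andP[d0 _] := delta01.
have l0 q : 0 <= 2 ^+ q * B by rewrite mulr_ge0 ?exprn_ge0 ?(ltW B0).
rewrite /jn_const addr_ge0 ?mulr_ge0 ?exprn_ge0//.
by rewrite addr_ge0// divr_ge0 ?(ltW B0) ?(ltW d0).
Qed.

Lemma locint_avg_diff i j r : locint (fun y => `|avg i b y - avg j b y| ^+ r).
Proof.
apply: (@locint_bounded _ (((i + j)%:R * (B / delta)) ^+ r)).
  apply: measurable_funX; apply: measurableT_comp => //.
  by apply: measurable_funB; exact: measurable_avgb.
have bd0 : 0 <= B / delta by rewrite divr_ge0 ?ltW//; case/andP: delta01.
have n0 : 0 <= (i + j)%:R * (B / delta) by rewrite mulr_ge0.
move=> y; rewrite normrX normr_id lerXn2r ?nnegrE//.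
rewrite (_ : _ - _ = (avg i b y - avg 0 b y) - (avg j b y - avg 0 b y)); last by ring.
apply: (le_trans (ler_normB _ _)); rewrite natrD mulrDl; apply: lerD.
  exact: (avg_steps 0 i).
exact: (avg_steps 0 j).
Qed.

(** Strong induction on the number m of generations, for all starting cells at once: fewer
    generations remain after an exit. Replacing b by its averages of one fixed generation keeps all
    the functions bounded. *)
Lemma john_nirenberg_avg r m k x :
  avg k (fun y => `|avg (k + m) b y - avg k b y| ^+ r) x <= jn_const r.
Proof.
have /andP[d0 _] := delta01.
have bd0 : 0 <= B / delta by rewrite divr_ge0 ?ltW.
elim/ltn_ind: m k x => m IH k x.
pose lam : R := 2 ^+ r.+1 * B; pose c := (lam + B / delta) ^+ r.
have lam0 : 0 <= lam by rewrite /lam mulr_ge0 ?exprn_ge0 ?(ltW B0).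
have c0 : 0 <= c by rewrite /c exprn_ge0// addr_ge0.
pose H i y := 2 ^+ r * (c + `|avg (k + m) b y - avg (k + i.+1) b y| ^+ r).
have H0 i y : 0 <= H i y by rewrite /H mulr_ge0 ?exprn_ge0// addr_ge0// exprn_ge0.
have lH i : locint (H i).
  apply: locintZ; apply: locintD; first exact: locint_cst.
  exact: locint_avg_diff.
have leH i y : (i < m)%N -> avg (k + i.+1) (H i) y <= 2 ^+ r * (c + jn_const r).
  move=> im; rewrite avgZ; last first.
    by apply: locintD; [exact: locint_cst|exact: locint_avg_diff].
  rewrite ler_pM2l ?exprn_gt0// avgD; [|exact: locint_cst|exact: locint_avg_diff].
  rewrite avg_cst lerD2l.
  rewrite (_ : (k + m = (k + i.+1) + (m - i.+1))%N); last by rewrite -addnA subnKC.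
  by apply: IH; rewrite ltn_subrL ltn0Sn (leq_ltn_trans _ im).
have le1 i y : exit k r i y <= 1 by case: (exit01 k r i y) => ->.
have leX i : locint (fun y => exit k r i y * H i y).
  apply: (locint_le _ (lH i)).
    by apply: measurable_funM; [exact: measurable_exit|case: (lH i)].
  by move=> y; rewrite normrM ler_piMl// ger0_norm ?exit_ge0.
apply: (@le_trans _ _ (avg k (fun y => lam ^+ r + \sum_(i < m) exit k r i y * H i y) x)).
  apply: avg_le; first exact: locint_avg_diff.
    by apply: locintD; [exact: locint_cst|exact: (locint_sum (fun i : 'I_m => leX i))].
  by move=> y _; exact: first_exit_le.
rewrite avgD; [|exact: locint_cst|exact: (locint_sum (fun i : 'I_m => leX i))].
rewrite avg_cst avg_sum; last by move=> i; exact: leX.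
apply: (@le_trans _ _ (lam ^+ r +
    \sum_(i < m) 2 ^+ r * (c + jn_const r) * avg k (exit k r i) x)).
  rewrite lerD2l; apply: ler_sum => i _.
  rewrite -(avg_tower x (leq_addr i.+1 k) (measurable_exit k r i) (exit_ge0 k r i)
    (@exit_cellwise k r i) (lH i) (H0 i)).
  rewrite -avgZ; last exact: locint_exit.
  apply: avg_le.
  - apply: (@locint_bounded _ (2 ^+ r * (c + jn_const r))).
      apply: measurable_funM; first exact: measurable_exit.
      by apply: measurable_avg; case: (lH i).
    move=> y; rewrite normrM !ger0_norm ?exit_ge0 ?avg_ge0//.
    by apply: le_trans (leH i y (ltn_ord i)); rewrite ler_piMl ?avg_ge0.
  - by apply: locintZ; exact: locint_exit.
  - move=> y _; rewrite mulrC ler_wpM2r ?exit_ge0// leH//.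
rewrite -mulr_sumr.
apply: (@le_trans _ _ (lam ^+ r + 2 ^+ r * (c + jn_const r) * (2 ^+ r.+1)^-1)).
  rewrite lerD2l ler_wpM2l ?sum_exit_le//.
  by rewrite mulr_ge0 ?exprn_ge0// addr_ge0// jn_const_ge0.
rewrite /jn_const -/lam -/c exprS le_eqVlt; apply/orP; left; apply/eqP.
by field; rewrite expf_neq0// pnatr_eq0.
Qed.

Context (dense : forall k x e, 0 < e -> exists m,
  avg k (fun y => `|b y - avg (k + m) b y|) x <= e).

(** [dense] provides convergence of the averages in mean only, which the Lipschitz bound of the
    power truncated at M turns into convergence of moments. The resulting bound depends on neither M
    nor m, and M can tend to infinity afterwards. *)
Lemma john_nirenberg_trunc r k x (M : R) : 0 <= M ->
  avg k (fun y => Num.min `|b y - avg k b y| M ^+ r.+1) x <= jn_const r.+1.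
Proof.
move=> M0; apply/ler_addgt0Pr => e e0.
have C0 : 0 < r.+1%:R * M ^+ r + 1 by rewrite ltr_wpDl ?mulr_ge0 ?exprn_ge0.
have [m hm] := dense k x (divr_gt0 e0 C0).
have lab j : locint (avg j b).
  apply: (locint_le (measurable_avgb j) (g := fun y => `|avg 0 b y| + j%:R * (B / delta))).
    apply: locintD; last exact: locint_cst.
    apply: locint_norm; apply: locint0; first exact: measurable_avgb.
    move=> z; apply: (eq_integrable _ (fun=> (avg 0 b z)%:E)) => //; last first.
      exact: (locint_cst G (avg 0 b z)).2.
    by move=> y; rewrite inE => zy /=; rewrite (avg_cellwise b zy).
  move=> y; have := avg_steps 0 j y; rewrite add0n => h.
  have bd0 : 0 <= B / delta by rewrite divr_ge0 ?ltW//; case/andP: delta01.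
  have n0 : 0 <= j%:R * (B / delta) by rewrite mulr_ge0.
  rewrite [leRHS]ger0_norm ?addr_ge0//.
  rewrite -[X in `|X|](subrK (avg 0 b y)) addrC (le_trans (ler_normD _ _))//.
  by rewrite lerD2l.
have ld j : locint (fun y => `|b y - avg j b y|) by apply/locint_norm/locintB.
have mmin : measurable_fun [set: T] (fun y => Num.min `|b y - avg k b y| M ^+ r.+1).
  apply: measurable_funX; apply: measurable_minr => //.
  by case: (ld k).
apply: (@le_trans _ _ (avg k (fun y => `|avg (k + m) b y - avg k b y| ^+ r.+1 +
   (r.+1%:R * M ^+ r) * `|b y - avg (k + m) b y|) x)).
  apply: avg_le.
  - apply: (@locint_bounded _ (M ^+ r.+1)) => // y.
    have m0 : 0 <= Num.min `|b y - avg k b y| M by rewrite le_min M0 normr_ge0.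
    by rewrite ger0_norm ?exprn_ge0// lerXn2r ?nnegrE// ge_min lexx orbT.
  - by apply: locintD; [exact: locint_avg_diff|exact: locintZ].
  - move=> y _; apply: le_trans (minXr_le r (normr_ge0 _) (normr_ge0 (avg (k + m) b y - avg k b y)) M0) _.
    rewrite lerD2l ler_wpM2l ?mulr_ge0 ?exprn_ge0//.
    apply: (le_trans (ler_dist_dist _ _)).
    by rewrite (_ : _ - _ - _ = b y - avg (k + m) b y)//; ring.
rewrite avgD; [|exact: locint_avg_diff|exact: locintZ].
rewrite avgZ//; apply: lerD; first exact: john_nirenberg_avg.
apply: (@le_trans _ _ ((r.+1%:R * M ^+ r) * (e / (r.+1%:R * M ^+ r + 1)))).
  by rewrite ler_wpM2l ?mulr_ge0 ?exprn_ge0.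
rewrite mulrA ler_pdivrMr// mulrC ler_wpM2l ?(ltW e0)// lerDl//.
Qed.

Lemma john_nirenberg r k x :
  (\int[mu]_(y in cell k x) (`|b y - avg k b y| ^+ r.+1)%:E <=
   (jn_const r.+1 * vol k)%:E)%E.
Proof.
pose g (M : nat) y : \bar R := (Num.min `|b y - avg k b y| M%:R ^+ r.+1)%:E.
have mb : measurable_fun [set: T] (fun y => `|b y - avg k b y|).
  by apply: measurableT_comp => //; apply: measurable_funB; [case: lb|exact: measurable_avgb].
have mg M : measurable_fun [set: T] (fun y => Num.min `|b y - avg k b y| M%:R ^+ r.+1).
  by apply: measurable_funX; apply: measurable_minr.
have m0 (M : nat) y : 0 <= Num.min `|b y - avg k b y| M%:R by rewrite le_min normr_ge0/=.
have nd y : nondecreasing_seq (g ^~ y).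
  move=> M1 M2 M12; rewrite lee_fin lerXn2r ?nnegrE// le_min ge_min lexx/=.
  by rewrite ge_min ler_nat M12 orbT.
have lim y : limn (g ^~ y) = (`|b y - avg k b y| ^+ r.+1)%:E.
  apply/cvg_lim => //; apply: cvg_near_cst; near=> M.
  rewrite /g (min_idPl _)//; near: M.
  exact: nbhs_infty_ger.
rewrite -(eq_integral _ _ (fun y _ => lim y)).
rewrite monotone_convergence//; last 2 first.
- by move=> M; apply/measurable_EFinP/measurable_funTS.
- by move=> M y _; rewrite lee_fin exprn_ge0.
apply: lime_le.
  apply: ereal_nondecreasing_is_cvgn => M1 M2 M12; apply: ge0_le_integral => //.
  - by move=> y _; rewrite lee_fin exprn_ge0.
  - by apply/measurable_EFinP/measurable_funTS.
  - by apply/measurable_EFinP/measurable_funTS.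
  - by move=> y _; exact: nd.
near=> M; rewrite EFin_avg; last first.
  apply: (@locint_bounded _ (M%:R ^+ r.+1)) => // y.
  by rewrite ger0_norm ?exprn_ge0// lerXn2r ?nnegrE// ge_min lexx orbT.
by rewrite lee_fin ler_wpM2r ?(ltW (vol_gt0 _ _))// john_nirenberg_trunc.
Unshelve. all: by end_near. Qed.

End john_nirenberg.

(** * Sums over the generations of one grid *)

Section real_lemmas.
Context {R : realType}.
Implicit Types x y : R.

(** The optimal parameter is the square root of K / A; if A = 0, t is taken as large as desired. It
    recovers Cauchy-Schwarz from a family of weighted Young inequalities. *)
Lemma le_sqrt_of_le_young x A K : 0 <= A -> 0 < K ->
  (forall t, 0 < t -> x <= t * A + K / t) -> x <= 2 * (K * A) `^ 2^-1.
Proof.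
move=> A0 K0 h; have [A_0|An] := eqVneq A 0.
  rewrite {}A_0 in h *; rewrite mulr0 powR0// mulr0; apply/ler_addgt0Pr => e e0; rewrite add0r.
  have := h (K / e) (divr_gt0 K0 e0).
  by rewrite mulr0 add0r invf_div mulrCA divff ?gt_eqF// mulr1.
have Ap : 0 < A by rewrite lt0r An.
have t0 : 0 < (K / A) `^ 2^-1 by rewrite powR_gt0// divr_gt0.
apply: (le_trans (h _ t0)); rewrite !powR12_sqrt ?(ltW (mulr_gt0 K0 Ap)) ?(ltW (divr_gt0 K0 Ap))//.
rewrite sqrtrM ?(ltW K0)// sqrtrV ?(ltW Ap)// sqrtrM ?(ltW K0)//.
set k := Num.sqrt K; set r := Num.sqrt A.
have kE : K = k ^+ 2 by rewrite sqr_sqrtr ?ltW.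
have rE : A = r ^+ 2 by rewrite sqr_sqrtr ?ltW.
have k0 : 0 < k by rewrite sqrtr_gt0.
have r0 : 0 < r by rewrite sqrtr_gt0.
rewrite kE rE le_eqVlt; apply/orP; left; apply/eqP.
by field; rewrite !gt_eqF.
Qed.

Lemma powR_le_1D x (s p : R) : 0 <= x -> 0 <= s -> s <= p -> x `^ s <= 1 + x `^ p.
Proof.
move=> x0 s0 sp; have [x1|/ltW x1] := leP x 1.
  apply: (@le_trans _ _ 1); last by rewrite lerDl powR_ge0.
  have : x `^ s <= 1 `^ s by apply: ge0_ler_powR; rewrite ?nnegrE.
  by rewrite powR1.
by apply: le_trans (ler_powR x1 sp) _; rewrite lerDr.
Qed.

End real_lemmas.

Section locint_powR.
Context d (T : measurableType d) (R : realType).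
Context (mu : {sigma_finite_measure set T -> \bar R}) (delta : R).
Context (G : grid mu delta).
Implicit Types f : T -> R.

Lemma integrable_locint f : measurable_fun [set: T] f ->
  (\int[mu]_x `|f x|%:E < +oo)%E -> locint G f.
Proof.
move=> mf foo; split=> // k x.
apply: (@integrableS _ _ _ mu setT) => //; first exact: measurable_cell.
by apply/integrableP; split => //; exact/measurable_EFinP.
Qed.

Lemma locint_powR f (s p : R) : measurable_fun [set: T] f -> (forall x, 0 <= f x) ->
  0 <= s -> s <= p -> (\int[mu]_x (f x `^ p)%:E < +oo)%E ->
  locint G (fun x => f x `^ s).
Proof.
move=> mf f0 s0 sp fp.
have mq q : measurable_fun [set: T] (fun x => f x `^ q).
  by apply/measurable_EFinP/measurable_EFin_powR.
apply: (@locint_le _ _ _ _ _ _ _ (fun x => 1 + f x `^ p)) => //.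
  apply: locintD; first exact: locint_cst.
  apply: integrable_locint => //.
  by under eq_integral do rewrite ger0_norm ?powR_ge0//.
move=> x; rewrite !ger0_norm ?powR_ge0 ?addr_ge0 ?powR_ge0//.
exact: powR_le_1D.
Qed.

End locint_powR.

Section dyadic_sums.
Context d (T : measurableType d) (R : realType).
Context (mu : {sigma_finite_measure set T -> \bar R}) (delta : R).
Implicit Types (f u : T -> R).

(** The gap 1 < s < p is what makes the maximal function of these means bounded on L^p: Doob's
    inequality is applied to f^s with exponent p / s > 1. *)
Definition pavg (G : grid mu delta) s f k x : R :=
  avg G k (fun y => f y `^ s) x `^ s^-1.

Section pavg.
Context (G : grid mu delta).
Let delta01 : 0 < delta < 1 := grid_delta G.
Context (s p : R) (s1 : 1 < s) (sp : s < p).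
Context (f : T -> R) (mf : measurable_fun [set: T] f) (f0 : forall x, 0 <= f x).
Context (f1 : (\int[mu]_x (f x `^ p)%:E <= 1)%E).

Let s0 : 0 < s. Proof. exact: lt_trans ltr01 s1. Qed.
Let p0 : 0 < p. Proof. exact: lt_trans s0 sp. Qed.
Let fs0 x : 0 <= f x `^ s. Proof. exact: powR_ge0. Qed.

Lemma locint_fs : locint G (fun y => f y `^ s).
Proof.
apply: (locint_powR _ mf f0 (ltW s0) (ltW sp)).
exact: le_lt_trans f1 (ltry _).
Qed.

Lemma measurable_pavg k : measurable_fun [set: T] (pavg G s f k).
Proof.
apply: (measurableT_comp (measurable_powR _)); apply: measurable_avg.
by case: locint_fs.
Qed.

Lemma pavg_cellwise k : cellwise G k (pavg G s f k).
Proof. by move=> x y xy; rewrite /pavg (avg_cellwise _ xy). Qed.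

Lemma pavg_le_max k N x : (k <= N)%N ->
  pavg G s f k x <= maxavg G (fun y => f y `^ s) N x `^ s^-1.
Proof.
move=> kN; apply: ge0_ler_powR; rewrite ?nnegrE ?invr_ge0 ?(ltW s0)//.
- exact: avg_ge0.
- exact: maxavg_ge0.
- exact: avg_le_maxavg.
Qed.

(** Jensen's inequality with exponent p / s, followed by the normalisation of f in L^p. *)
Lemma pavg_le_vol k x : pavg G s f k x <= vol G k `^ (- p^-1).
Proof.
have mfp q : measurable_fun [set: T] (fun x => f x `^ q).
  by apply/measurable_EFinP/measurable_EFin_powR.
have lfp : locint G (fun y => (f y `^ s) `^ (p / s)).
  under [X in locint _ X]eq_fun do rewrite -powRrM mulrCA divff ?gt_eqF// mulr1.
  apply: integrable_locint => //.
  under eq_integral do rewrite ger0_norm ?powR_ge0//.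
  exact: le_lt_trans f1 (ltry _).
have ps1 : 1 <= p / s by rewrite ler_pdivlMr// mul1r ltW.
have := avg_powR_le k x ps1 locint_fs lfp fs0.
set A := avg G k _ x; set V := avg G k _ x => AV.
have A0 : 0 <= A by exact: avg_ge0.
have Vle : V <= (vol G k)^-1.
  rewrite -[leRHS]mul1r ler_pdivlMr ?vol_gt0// -lee_fin -(EFin_avg k x lfp).
  apply: le_trans f1; under eq_integral do rewrite -powRrM mulrCA divff ?gt_eqF// mulr1.
  apply: ge0_subset_integral => //; first exact: measurable_cell.
    exact/measurable_EFinP.
  by move=> y _; rewrite lee_fin powR_ge0.
rewrite /pavg -/A.
have -> : vol G k `^ (- p^-1) = (vol G k)^-1 `^ p^-1.
  by rewrite -(powR_inv1 (ltW (vol_gt0 G k))) -powRrM mulN1r.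
have -> : A `^ s^-1 = (A `^ (p / s)) `^ p^-1.
  by rewrite -powRrM mulrAC divff ?gt_eqF// mul1r.
apply: ge0_ler_powR; rewrite ?nnegrE ?invr_ge0 ?powR_ge0 ?(ltW p0) ?(ltW (vol_gt0 _ _))//.
exact: le_trans AV Vle.
Qed.

Lemma int_max_powR N :
  (\int[mu]_x ((maxavg G (fun y => f y `^ s) N x `^ s^-1) `^ p)%:E <=
   (2 `^ (p / s) / (p / s - 1))%:E)%E.
Proof.
have ps1 : 1 < p / s by rewrite ltr_pdivlMr// mul1r.
under eq_integral do rewrite -powRrM (mulrC s^-1).
apply: (le_trans (doob locint_fs fs0 N ps1)).
rewrite -[leRHS]mule1; apply: lee_wpmul2l.
  by rewrite lee_fin divr_ge0 ?powR_ge0//; lra.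
by under eq_integral do rewrite -powRrM mulrCA divff ?gt_eqF// mulr1.
Qed.

End pavg.
End dyadic_sums.

Section real_lemmas2.
Context {R : realType}.

(** Removes the q-th power of the sum and keeps three quarters of the exponent on each [D k]. If q
    <= 1, subadditivity applies and D_k^(q/4) is bounded by W; if q > 1, Jensen's inequality is
    applied with the weights D_k^e. *)
Lemma sum_mul_powR_le (q : R) : 0 < q -> exists2 theta, 0 < theta &
  forall N (D U : nat -> R) W, (forall k, 0 <= D k) -> (forall k, 0 <= U k) ->
  \sum_(k < N) D k `^ theta <= W ->
  (\sum_(k < N) D k * U k) `^ q <=
  W `^ (q / 4 / theta) * \sum_(k < N) D k `^ (3 * q / 4) * U k `^ q.
Proof.
move=> q0; have [q1|q1] := leP q 1.
  exists (q / 4) => [|N D U W D0 U0 DW]; first by rewrite divr_gt0.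
  have W0 : 0 <= W by apply: le_trans DW; rewrite sumr_ge0// => k _; rewrite powR_ge0.
  rewrite divff ?gt_eqF ?divr_gt0// powRr1//.
  apply: le_trans (powR_sum_le1 _ _ _) _; first by rewrite q0.
    by move=> k; rewrite mulr_ge0.
  rewrite mulr_sumr; apply: ler_sum => k _.
  rewrite powRM// mulrA ler_wpM2r ?powR_ge0//.
  have -> : D k `^ q = D k `^ (q / 4) * D k `^ (3 * q / 4).
    have [->|Dn] := eqVneq (D k) 0; first by rewrite !powR0 ?mulr0 ?gt_eqF ?divr_gt0 ?mulr_gt0.
    by rewrite -powRD ?Dn ?implybT//; congr (_ `^ _); field.
  rewrite ler_wpM2r ?powR_ge0//; apply: le_trans DW.
  by rewrite (bigD1 k)//= lerDl sumr_ge0// => j _; rewrite powR_ge0.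
have q10 : 0 < q - 1 by lra.
(* The solution of q / (4 e) = q - 1, or equivalently of e + q (1 - e) = 3 q / 4. *)
pose e := q / (4 * (q - 1)).
have e0 : 0 < e by rewrite divr_gt0// mulr_gt0.
exists e => // N D U W D0 U0 DW.
have W0 : 0 <= W by apply: le_trans DW; rewrite sumr_ge0// => k _; rewrite powR_ge0.
have -> : q / 4 / e = q - 1 by rewrite /e; field; rewrite !gt_eqF.
have E1 k : D k * U k = D k `^ e * (D k `^ (1 - e) * U k).
  have [->|Dn] := eqVneq (D k) 0.
    by rewrite mul0r (powR0 (lt0r_neq0 e0)) mul0r.
  rewrite mulrA -powRD; last by rewrite Dn implybT.
  by rewrite subrKC powRr1.
have E2 k : D k `^ e * (D k `^ (1 - e) * U k) `^ q = D k `^ (3 * q / 4) * U k `^ q.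
  have [->|Dn] := eqVneq (D k) 0.
    have q34 : 3 * q / 4 != 0 by rewrite gt_eqF// divr_gt0// mulr_gt0.
    by rewrite (powR0 (lt0r_neq0 e0)) (powR0 q34) !mul0r.
  rewrite powRM ?powR_ge0// mulrA -powRrM -powRD; last by rewrite Dn implybT.
  by congr (_ `^ _ * _); rewrite /e; field; rewrite gt_eqF.
under eq_bigr do rewrite E1.
apply: (le_trans (powR_sum_ge1 _ (ltW q1) _ _)).
- by move=> k; rewrite powR_ge0.
- by move=> k; rewrite mulr_ge0 ?powR_ge0.
under [X in _ * X <= _]eq_bigr do rewrite E2.
rewrite ler_wpM2r ?sumr_ge0// => [k _|]; first by rewrite mulr_ge0 ?powR_ge0.
apply: ge0_ler_powR; rewrite ?nnegrE ?sumr_ge0 ?(ltW q10)// => k _.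
by rewrite powR_ge0.
Qed.

Lemma expr3M_le (x y : R) : 0 <= x -> 0 <= y -> x ^+ 3 * y <= x ^+ 4 + y ^+ 4.
Proof.
move=> x0 y0; have [xy|/ltW yx] := leP x y.
  apply: (@le_trans _ _ (y ^+ 4)); last by rewrite lerDr exprn_ge0.
  by rewrite (exprSr y 3) ler_wpM2r// lerXn2r ?nnegrE.
apply: (@le_trans _ _ (x ^+ 4)); last by rewrite lerDl exprn_ge0.
by rewrite (exprSr x 3) ler_wpM2l// exprn_ge0.
Qed.

Lemma mulr_young_le (x y t : R) : 0 < t -> 0 <= x -> 0 <= y ->
  x * y <= t * x ^+ 2 + y ^+ 2 / t.
Proof.
move=> t0 x0 y0; rewrite -(@ler_pM2l _ t)// mulrDr (mulrC t (_ / _)) divfK ?gt_eqF//.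
have -> : t * (t * x ^+ 2) = (t * x) ^+ 2 by ring.
by rewrite mulrA; set z := t * x; nra.
Qed.

Lemma powRM_le_add (x y r : R) : 0 <= x -> 0 <= y -> 0 <= r ->
  (x * y) `^ r <= x `^ (2 * r) + y `^ (2 * r).
Proof.
move=> x0 y0 r0; rewrite powRM// !(mulrC 2) !powRrM !powR_mulrn ?powR_ge0//.
set u := x `^ r; set v := y `^ r.
have u0 : 0 <= u by exact: powR_ge0.
have v0 : 0 <= v by exact: powR_ge0.
by nra.
Qed.

End real_lemmas2.

Section dyadic_bound.
Context d (T : measurableType d) (R : realType).
Context (mu : {sigma_finite_measure set T -> \bar R}) (delta : R).

Lemma int_sum (N : nat) (F : nat -> T -> R) :
  (forall k, measurable_fun [set: T] (F k)) -> (forall k x, 0 <= F k x) ->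
  (\int[mu]_x (\sum_(k < N) F k x)%:E = \sum_(k < N) \int[mu]_x (F k x)%:E)%E.
Proof.
move=> mF F0; under eq_integral do rewrite -sumEFin.
rewrite ge0_integral_sum// => k; first exact/measurable_EFinP.
by move=> x _; rewrite lee_fin.
Qed.

Lemma int_powRM_le (g1 g2 : T -> R) (p1 p2 p C1 C2 : R) :
  0 < p1 -> 0 < p2 -> 0 < p -> p^-1 = p1^-1 + p2^-1 ->
  measurable_fun [set: T] g1 -> measurable_fun [set: T] g2 ->
  (forall x, 0 <= g1 x) -> (forall x, 0 <= g2 x) ->
  (\int[mu]_x (g1 x `^ p1)%:E <= C1%:E)%E ->
  (\int[mu]_x (g2 x `^ p2)%:E <= C2%:E)%E ->
  (\int[mu]_x ((g1 x * g2 x) `^ p)%:E <= (C1 + C2)%:E)%E.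
Proof.
move=> p1_gt0 p2_gt0 p_gt0 pE mg1 mg2 g1_ge0 g2_ge0 h1 h2.
rewrite EFinD; apply: (le_trans _ (leeD h1 h2)).
rewrite -ge0_integralD//; last 4 first.
- by move=> x _; rewrite lee_fin powR_ge0.
- exact: (measurable_EFin_powR p1 mg1).
- by move=> x _; rewrite lee_fin powR_ge0.
- exact: (measurable_EFin_powR p2 mg2).
apply: ge0_le_integral => //.
- by move=> x _; rewrite lee_fin powR_ge0.
- exact: (measurable_EFin_powR p (measurable_funM mg1 mg2)).
- by apply: emeasurable_funD;
    [exact: (measurable_EFin_powR p1 mg1)|exact: (measurable_EFin_powR p2 mg2)].
move=> x _; rewrite -EFinD lee_fin powRM//.
have pp1 : 0 < p1 / p by rewrite divr_gt0.
have pp2 : 0 < p2 / p by rewrite divr_gt0.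
have pp : (p1 / p)^-1 + (p2 / p)^-1 = 1.
  by rewrite !invf_div -mulrDr -pE divff// gt_eqF.
have := conjugate_powR (powR_ge0 (g1 x) p) (powR_ge0 (g2 x) p) pp1 pp2 pp.
move=> /le_trans; apply; rewrite -!powRrM !(mulrCA p) divff ?gt_eqF// !mulr1.
have i1 : 0 < (p1 / p)^-1 by rewrite invr_gt0.
have i2 : 0 < (p2 / p)^-1 by rewrite invr_gt0.
apply: lerD; rewrite ler_piMr ?powR_ge0//.
  by rewrite -pp lerDl ltW.
by rewrite -pp lerDr ltW.
Qed.

Context (p a q : R) (p_gt0 : 0 < p) (a_gt0 : 0 < a) (q_gt0 : 0 < q)
  (qE : q^-1 = p^-1 - a).

Section one_grid.
Context (G : grid mu delta) (D V : nat -> T -> R) (g : T -> R) (N : nat).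
Context (C1 K : R) (K_gt0 : 0 < K).
Context (mg : measurable_fun [set: T] g) (g_ge0 : forall x, 0 <= g x)
  (int_gp : (\int[mu]_x (g x `^ p)%:E <= C1%:E)%E).
Context (mD : forall k, measurable_fun [set: T] (D k)) (D_ge0 : forall k x, 0 <= D k x)
  (D_cellwise : forall k, cellwise G k (D k)).
Context (mV : forall k, measurable_fun [set: T] (V k)) (V_ge0 : forall k x, 0 <= V k x)
  (int_V2 : forall k x,
    (\int[mu]_(y in cell G k x) (V k y ^+ 2)%:E <= (K * vol G k)%:E)%E).
Let delta01 : 0 < delta < 1 := grid_delta G.

(** A quarter of g^p: h^4 is integrable, so Doob's inequality with exponent 2 applies to h^2, and
    the function [N0] built from its maximal average has an integrable fourth power too. *)
Let h x := g x `^ (p / 4).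
Let h_ge0 x : 0 <= h x. Proof. exact: powR_ge0. Qed.

Let mgr r : measurable_fun [set: T] (fun x => g x `^ r).
Proof. exact: (measurableT_comp (measurable_powR _)). Qed.

Let mh : measurable_fun [set: T] h. Proof. exact: mgr. Qed.

Let lh2 : locint G (fun x => h x ^+ 2).
Proof.
under [X in locint _ X]eq_fun do rewrite -powR_mulrn// /h -powRrM.
apply: (locint_powR G (p := p) mg g_ge0).
- by rewrite mulr_ge0// divr_ge0// ltW.
- by have := p_gt0; lra.
- exact: le_lt_trans int_gp (ltry _).
Qed.

Let N0 x := maxavg G (fun x => h x ^+ 2) N x `^ 2^-1.
Let N0_ge0 x : 0 <= N0 x. Proof. exact: powR_ge0. Qed.

Let mN0 : measurable_fun [set: T] N0.
Proof.
by apply: (measurableT_comp (measurable_powR _)); apply: measurable_maxavg; case: lh2.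
Qed.

(* The cross term is only integrable on the cells of generation k, hence the
   integrals over one cell. *)
Lemma cell_hV_le k x : (k <= N)%N ->
  (\int[mu]_(y in cell G k x) (h y * V k y)%:E <=
   (2 * K `^ 2^-1 * N0 x * vol G k)%:E)%E.
Proof.
move=> kN; set A := avg G k (fun x => h x ^+ 2) x.
have v0 := vol_gt0 G k.
have A0 : 0 <= A by apply: avg_ge0 => y; rewrite exprn_ge0.
have hx t : 0 < t -> (\int[mu]_(y in cell G k x) (h y * V k y)%:E <=
    ((t * A + K / t) * vol G k)%:E)%E.
  move=> t0; have mc := measurable_cell G k x.
  have mt : measurable_fun (cell G k x) (fun y => (t * h y ^+ 2)%:E).
    by apply/measurable_EFinP/measurable_funM => //; apply/measurable_funTS/measurable_funX.
  have mVt : measurable_fun (cell G k x) (fun y => (t^-1 * V k y ^+ 2)%:E).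
    by apply/measurable_EFinP/measurable_funM => //; apply/measurable_funTS/measurable_funX.
  have ti0 : 0 <= t^-1 by rewrite invr_ge0 ltW.
  apply: (@le_trans _ _ (\int[mu]_(y in cell G k x)
      ((t * h y ^+ 2)%:E + (t^-1 * V k y ^+ 2)%:E))%E).
    apply: ge0_le_integral => //.
    - by move=> y _; rewrite lee_fin mulr_ge0.
    - by apply/measurable_EFinP/measurable_funTS/measurable_funM.
    - exact: emeasurable_funD.
    - by move=> y _; rewrite -EFinD lee_fin (mulrC t^-1) mulr_young_le.
  rewrite ge0_integralD//; last 2 first.
  - by move=> y _; rewrite lee_fin mulr_ge0 ?exprn_ge0// ltW.
  - by move=> y _; rewrite lee_fin mulr_ge0 ?exprn_ge0.
  rewrite mulrDl EFinD; apply: leeD.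
    under eq_integral do rewrite EFinM.
    rewrite ge0_integralZl_EFin//; last 3 first.
    - by move=> y _; rewrite lee_fin exprn_ge0.
    - by apply/measurable_EFinP/measurable_funTS/measurable_funX.
    - exact: ltW.
    by rewrite EFin_avg// -EFinM mulrA.
  under eq_integral do rewrite EFinM.
  rewrite ge0_integralZl_EFin//; last 2 first.
  - by move=> y _; rewrite lee_fin exprn_ge0.
  - by apply/measurable_EFinP/measurable_funTS/measurable_funX.
  apply: (le_trans (lee_wpmul2l _ (int_V2 k x))); first by rewrite lee_fin.
  by rewrite -EFinM lee_fin mulrA (mulrC t^-1).
set I := (\int[mu]_(y in cell G k x) (h y * V k y)%:E)%E in hx *.
have I0 : (0 <= I)%E by apply: integral_ge0 => y _; rewrite lee_fin mulr_ge0.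
have If : I \is a fin_num.
  by rewrite ge0_fin_numE//; exact: le_lt_trans (hx 1 ltr01) (ltry _).
rewrite -(fineK If) lee_fin -ler_pdivrMr//.
apply: (@le_trans _ _ (2 * (K * A) `^ 2^-1)).
  apply: le_sqrt_of_le_young => // t t0.
  by rewrite ler_pdivrMr// -lee_fin (fineK If) hx.
rewrite powRM ?(ltW K_gt0)// mulrA ler_wpM2l ?mulr_ge0 ?powR_ge0//.
apply: ge0_ler_powR; rewrite ?nnegrE ?invr_ge0//.
  by apply: maxavg_ge0 => y; rewrite exprn_ge0.
exact: avg_le_maxavg.
Qed.

(** [D k] is constant on cells, so [h * V k] can be replaced by its averages over cells, which
    [cell_hV_le] bounds by [N0]. The factor [V k], controlled only on cells of generation k, is
    thereby eliminated. *)
Lemma int_DhV_le k r : (k <= N)%N -> 0 < r ->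
  (\int[mu]_x (D k x `^ r * (h x * V k x))%:E <=
   (2 * K `^ 2^-1)%:E * \int[mu]_x (D k x `^ r * N0 x)%:E)%E.
Proof.
move=> kN r0; have v0 := vol_gt0 G k.
have mDr : measurable_fun [set: T] (fun x => D k x `^ r).
  exact: (measurableT_comp (measurable_powR _)).
have K0 : 0 <= 2 * K `^ 2^-1 by rewrite mulr_ge0 ?powR_ge0.
have mhV : measurable_fun [set: T] (fun x => h x * V k x) by exact: measurable_funM.
have key : (\int[mu]_x ((D k x `^ r)%:E * (h x * V k x)%:E * (vol G k)%:E) <=
    \int[mu]_x (((2 * K `^ 2^-1)%:E * (D k x `^ r * N0 x)%:E) * (vol G k)%:E))%E.
  have m1 : measurable_fun [set: T] (EFin \o (fun x => D k x `^ r)) by exact/measurable_EFinP.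
  have m2 : measurable_fun [set: T] (EFin \o (fun x => h x * V k x)) by exact/measurable_EFinP.
  have p1 x : (0 <= (D k x `^ r)%:E)%E by rewrite lee_fin powR_ge0.
  have p2 x : (0 <= (h x * V k x)%:E)%E by rewrite lee_fin mulr_ge0.
  have c1 : cellwise G k (EFin \o (fun x => D k x `^ r)).
    by move=> x y xy; rewrite /= (D_cellwise xy).
  rewrite -(tonelli_cell m1 m2 p1 p2 c1).
  apply: ge0_le_integral => //.
  - by move=> x _; apply: mule_ge0; [exact: p1|apply: integral_ge0 => y _; exact: p2].
  - by apply: emeasurable_funM => //; exact: measurable_int_cell.
  - apply: emeasurable_funM => //; apply: emeasurable_funM => //.
    by apply/measurable_EFinP/measurable_funM.
  - move=> x _; rewrite -!EFinM /=.
    apply: (le_trans (lee_wpmul2l _ (cell_hV_le x kN))); first by rewrite lee_fin powR_ge0.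
    rewrite -EFinM lee_fin le_eqVlt; apply/orP; left; apply/eqP; ring.
move: key; rewrite ge0_integralZr//; last 3 first.
- by apply: emeasurable_funM; exact/measurable_EFinP.
- by move=> x _; rewrite -EFinM lee_fin !mulr_ge0 ?powR_ge0.
- by rewrite lee_fin ltW.
rewrite ge0_integralZr//; last 3 first.
- by apply: emeasurable_funM => //; apply/measurable_EFinP/measurable_funM.
- by move=> x _; rewrite -EFinM lee_fin mulr_ge0// mulr_ge0 ?powR_ge0.
- by rewrite lee_fin ltW.
rewrite lee_pmul2r// ?lte_fin// => /le_trans; apply.
rewrite ge0_integralZl_EFin//; last 2 first.
- by move=> x _; rewrite lee_fin mulr_ge0 ?powR_ge0.
- by apply/measurable_EFinP/measurable_funM.
Qed.

Lemma int_h4 : (\int[mu]_x (h x ^+ 4)%:E <= C1%:E)%E.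
Proof.
apply: le_trans int_gp; under eq_integral do rewrite -powR_mulrn// /h -powRrM.
by rewrite (_ : p / 4 * 4%:R = p)//; field.
Qed.

Lemma int_N04 : (\int[mu]_x (N0 x ^+ 4)%:E <= (4 * C1)%:E)%E.
Proof.
have h20 x : 0 <= h x ^+ 2 by rewrite exprn_ge0.
have lt12 : 1 < 2 :> R by rewrite ltr1n.
have := doob lh2 h20 N lt12.
rewrite (_ : 2 `^ 2 / (2 - 1) = 4 :> R); last first.
  by rewrite powR_mulrn// (_ : 2 - 1 = 1 :> R) ?divr1 -?natrX//; ring.
have E x : maxavg G (fun x => h x ^+ 2) N x `^ 2 = N0 x ^+ 4.
  by rewrite /N0 -powR_mulrn ?powR_ge0// -powRrM; congr (_ `^ _); field.
under eq_integral do rewrite E.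
under [X in (_ <= _ * X -> _)%E]eq_integral do rewrite powR_mulrn// -exprM.
move=> /le_trans; apply; rewrite [leRHS]EFinM; apply: lee_wpmul2l => //.
exact: int_h4.
Qed.

Lemma int_h3N0 : (\int[mu]_x (h x ^+ 3 * N0 x)%:E <= (5 * C1)%:E)%E.
Proof.
have m4 (f : T -> R) : measurable_fun [set: T] f ->
    measurable_fun [set: T] (EFin \o (fun x : T => f x ^+ 4)).
  by move=> mf; apply/measurable_EFinP/measurable_funX.
rewrite (_ : 5 * C1 = C1 + 4 * C1); last by ring.
rewrite EFinD; apply: (le_trans _ (leeD int_h4 int_N04)).
rewrite -ge0_integralD//; last 4 first.
- by move=> x _; rewrite lee_fin exprn_ge0.
- exact: m4.
- by move=> x _; rewrite lee_fin exprn_ge0.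
- exact: m4.
apply: ge0_le_integral => //.
- by move=> x _; rewrite lee_fin mulr_ge0 ?exprn_ge0.
- by apply/measurable_EFinP/measurable_funM => //; exact: measurable_funX.
- by apply: emeasurable_funD; exact: m4.
- by move=> x _; rewrite -EFinD lee_fin expr3M_le.
Qed.

End one_grid.

(** After [sum_mul_powR_le], Hedberg's bound turns the quarter of the exponent into h = g^(p/4).
    [int_DhV_le] then trades h U_k^q for [N0], and a second use of Hedberg's bound, with exponent 3
    q / 4, sums the powers of [D k] to h^3. What is left is the integral of h^3 N0, at most that of
    h^4 + N0^4. The bound by g is asked only below N because g will be a maximal function up to
    generation N. *)
Lemma dyadic_sum_bound (C1 K : R) : 0 < delta < 1 -> 0 < C1 -> 0 < K ->
  exists2 C, 0 < C & forall (G : grid mu delta) (D U : nat -> T -> R) (g : T -> R) N,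
  measurable_fun [set: T] g -> (forall x, 0 <= g x) ->
  (\int[mu]_x (g x `^ p)%:E <= C1%:E)%E ->
  (forall k, measurable_fun [set: T] (D k)) -> (forall k x, 0 <= D k x) ->
  (forall k, cellwise G k (D k)) ->
  (forall k x, (k < N)%N -> D k x <= vol G k `^ a * g x) ->
  (forall k x, D k x <= vol G k `^ (- q^-1)) ->
  (forall k, measurable_fun [set: T] (U k)) -> (forall k x, 0 <= U k x) ->
  (forall k x, (\int[mu]_(y in cell G k x) (U k y `^ (2 * q))%:E <=
     (K * vol G k)%:E)%E) ->
  (\int[mu]_x ((\sum_(k < N) D k x * U k x) `^ q)%:E <= C%:E)%E.
Proof.
move=> d01 C10 K0; have qi0 : 0 < q^-1 by rewrite invr_gt0.
have r0 : 0 < 3 * q / 4 by rewrite divr_gt0// mulr_gt0.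
have [th th0 Hth] := sum_mul_powR_le q_gt0.
have [Ct Ct0 HCt] := sum_hedberg d01 a_gt0 qi0 th0.
have [Cr Cr0 HCr] := sum_hedberg d01 a_gt0 qi0 r0.
(* The exponent c / (a + c) of Hedberg's bound for c = 1/q, since a + 1/q = 1/p. *)
have pqE : q^-1 / (a + q^-1) = p / q.
  have -> : a + q^-1 = p^-1 by rewrite qE; ring.
  by rewrite invrK mulrC.
pose C2 := Ct `^ (q / 4 / th).
have C20 : 0 < C2 by rewrite powR_gt0.
have K20 : 0 < 2 * K `^ 2^-1 by rewrite mulr_gt0// powR_gt0.
exists (C2 * ((2 * K `^ 2^-1) * (Cr * (5 * C1)))).
  apply: mulr_gt0 => //; apply: mulr_gt0 => //; apply: mulr_gt0 => //.
  exact: mulr_gt0.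
move=> G D U g N mg g0 gp mD D0 cD Dg Dv mU U0 UK.
pose h x := g x `^ (p / 4); pose V k x := U k x `^ q.
have h0 x : 0 <= h x by exact: powR_ge0.
have V0 k x : 0 <= V k x by exact: powR_ge0.
have mh : measurable_fun [set: T] h by exact: (measurableT_comp (measurable_powR _)).
have mV k : measurable_fun [set: T] (V k).
  exact: (measurableT_comp (measurable_powR _)).
have mDr k r : measurable_fun [set: T] (fun x => D k x `^ r).
  exact: (measurableT_comp (measurable_powR _)).
have V2 k x : (\int[mu]_(y in cell G k x) (V k y ^+ 2)%:E <= (K * vol G k)%:E)%E.
  apply: le_trans (UK k x); rewrite le_eqVlt; apply/orP; left; apply/eqP.
  by apply: eq_integral => y _; rewrite -powR_mulrn// /V -powRrM mulrC.
pose N0 x := maxavg G (fun x => h x ^+ 2) N x `^ 2^-1.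
have N00 x : 0 <= N0 x by exact: powR_ge0.
have mN0 : measurable_fun [set: T] N0.
  apply: (measurableT_comp (measurable_powR _)); apply: measurable_maxavg.
  exact: measurable_funX.
have mS (F : nat -> T -> R) : (forall k, measurable_fun [set: T] (F k)) ->
    measurable_fun [set: T] (fun x => \sum_(k < N) F k x).
  by move=> mF; apply: measurable_sum.
pose r := 3 * q / 4.
have pt x : (\sum_(k < N) D k x * U k x) `^ q <=
    C2 * \sum_(k < N) D k x `^ r * (h x * V k x).
  apply: (le_trans (Hth N (D ^~ x) (U ^~ x) _ (D0 ^~ x) (U0 ^~ x)
    (HCt _ (g x) N (D ^~ x) (vol0_gt0 G) (g0 x) (D0 ^~ x) _ _))).
  - by move=> k kN; exact: Dg.
  - by move=> k _; exact: Dv.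
  rewrite powRM ?powR_ge0 ?(ltW Ct0)// -/C2 -mulrA ler_pM2l// pqE -!powRrM.
  rewrite (_ : p / q * (th * (q / 4 / th)) = p / 4); last by field; rewrite !gt_eqF.
  by rewrite -/(h x) mulr_sumr; apply: ler_sum => k _; rewrite mulrCA.
have mDhV k : measurable_fun [set: T] (fun x => D k x `^ r * (h x * V k x)).
  by do 2 apply: measurable_funM => //.
have mDN k : measurable_fun [set: T] (fun x => D k x `^ r * N0 x).
  exact: measurable_funM.
apply: (@le_trans _ _ (\int[mu]_x (C2 * \sum_(k < N) D k x `^ r * (h x * V k x))%:E)%E).
  apply: ge0_le_integral => //.
  - by move=> x _; rewrite lee_fin powR_ge0.
  - apply/measurable_EFinP/(measurableT_comp (measurable_powR _)).
    by apply: (mS (fun k x => D k x * U k x)) => k; exact: measurable_funM.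
  - by apply/measurable_EFinP/measurable_funM => //; exact: (mS (fun k x => D k x `^ r * (h x * V k x))).
  - by move=> x _; rewrite lee_fin pt.
under eq_integral do rewrite EFinM.
rewrite ge0_integralZl_EFin//; last 3 first.
- by move=> x _; rewrite lee_fin sumr_ge0// => k _; rewrite !mulr_ge0 ?powR_ge0.
- by apply/measurable_EFinP; exact: (mS (fun k x => D k x `^ r * (h x * V k x))).
- exact: ltW.
rewrite [leRHS]EFinM; apply: lee_wpmul2l; first by rewrite lee_fin ltW.
rewrite (@int_sum N (fun k x => D k x `^ r * (h x * V k x)))//; last first.
  by move=> k x; rewrite !mulr_ge0 ?powR_ge0.
apply: (@le_trans _ _ (\sum_(k < N) (2 * K `^ 2^-1)%:E * \int[mu]_x (D k x `^ r * N0 x)%:E)%E).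
  apply: lee_sum => k _.
  exact: (int_DhV_le K0 mg g0 gp mD cD mV V0 V2 (ltnW (ltn_ord k)) r0).
rewrite -ge0_sume_distrr; last first.
  by move=> k _; apply: integral_ge0 => x _; rewrite lee_fin mulr_ge0 ?powR_ge0.
rewrite [leRHS]EFinM; apply: lee_wpmul2l; first by rewrite lee_fin ltW.
rewrite -(@int_sum N (fun k x => D k x `^ r * N0 x))//; last first.
  by move=> k x; rewrite mulr_ge0 ?powR_ge0.
apply: (@le_trans _ _ (\int[mu]_x (Cr%:E * (h x ^+ 3 * N0 x)%:E))%E).
  apply: ge0_le_integral => //.
  - by move=> x _; rewrite lee_fin sumr_ge0// => k _; rewrite mulr_ge0 ?powR_ge0.
  - by apply/measurable_EFinP; exact: (mS (fun k x => D k x `^ r * N0 x)).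
  - apply: emeasurable_funM => //; apply/measurable_EFinP/measurable_funM => //.
    exact: measurable_funX.
  move=> x _; rewrite -EFinM lee_fin -mulr_suml mulrA ler_wpM2r//.
  have := HCr _ (g x) N (D ^~ x) (vol0_gt0 G) (g0 x) (D0 ^~ x) _ _.
  move=> /(_ (fun k kN => Dg k x kN) (fun k _ => Dv k x)); rewrite pqE -powRrM.
  rewrite (_ : p / q * (3 * q / 4) = p / 4 * 3%:R); last by field; rewrite gt_eqF.
  by rewrite (powRrM (g x)) powR_mulrn ?powR_ge0.
rewrite ge0_integralZl_EFin//; last 3 first.
- by move=> x _; rewrite lee_fin mulr_ge0 ?exprn_ge0.
- by apply/measurable_EFinP/measurable_funM => //; exact: measurable_funX.
- exact: ltW.
rewrite [leRHS]EFinM; apply: lee_wpmul2l; first by rewrite lee_fin ltW.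
exact: (int_h3N0 G N mg g0 gp).
Qed.

End dyadic_bound.

Lemma int_powRD_le d (T : measurableType d) (R : realType)
    (mu : {measure set T -> \bar R}) (D : set T) (X s : R) (Y : T -> R) :
  measurable D -> measurable_fun [set: T] Y -> 0 <= X -> (forall y, 0 <= Y y) ->
  0 <= s ->
  (\int[mu]_(y in D) ((X + Y y) `^ s)%:E <=
   (2 `^ s)%:E * ((X `^ s)%:E * mu D + \int[mu]_(y in D) (Y y `^ s)%:E))%E.
Proof.
move=> mD mY X0 Y0 s0.
have mYs : measurable_fun D (EFin \o (fun y => Y y `^ s)).
  exact: measurable_funTS (measurable_EFin_powR s mY).
have mX : measurable_fun D (fun=> (X `^ s)%:E) by exact: measurable_cst.
have pX y : D y -> (0 <= (X `^ s)%:E)%E by rewrite lee_fin powR_ge0.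
have pY y : D y -> (0 <= (Y y `^ s)%:E)%E by rewrite lee_fin powR_ge0.
have pXY y : D y -> (0 <= (X `^ s)%:E + (Y y `^ s)%:E)%E.
  by move=> Dy; apply: adde_ge0; [exact: pX Dy|exact: pY].
have mXY := emeasurable_funD mX mYs.
rewrite -[X in (_ <= _ * (X + _))%E](integral_cst mu mD (X `^ s)%:E).
rewrite -(ge0_integralD mu mD pX mX pY mYs).
rewrite -(ge0_integralZl_EFin mu mD pXY mXY (powR_ge0 _ _)).
apply: ge0_le_integral; first exact: mD.
- by move=> y _; rewrite lee_fin powR_ge0.
- apply: measurable_funTS; apply: measurable_EFin_powR.
  by apply: measurable_funD => //; exact: measurable_cst.
- by apply: emeasurable_funM; [exact: measurable_cst|exact: mXY].
- by move=> y _; rewrite -EFinD -EFinM lee_fin powR_add_le.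
Qed.

(** * Oscillation against a function on one grid *)

Section grid_commutator.
Context d (T : measurableType d) (R : realType).
Context (mu : {sigma_finite_measure set T -> \bar R}) (delta : R).

(** The last clause, convergence of the averages in mean, is a condition on b and the grid together:
    an abstract partition need not separate points. For cubes it is supplied by [grid_dense]. *)
Definition grid_bmo (G : grid mu delta) (B : R) (b : T -> R) :=
  [/\ locint G b, (forall k x, avg G k (fun y => `|b y - avg G k b x|) x <= B) &
    forall k x e, 0 < e ->
      exists m, avg G k (fun y => `|b y - avg G (k + m) b y|) x <= e].

(** A real exponent is reduced to an integer one by t^sigma <= 1 + t^(r+1), where r is
    [Num.bound sigma]. *)
Definition jn_powR_const (B sigma : R) : R :=
  1 + jn_const delta B (Num.bound sigma).+1.

Lemma jn_powR_const_gt0 (G : grid mu delta) B sigma : 0 < B ->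
  0 < jn_powR_const B sigma.
Proof. by move=> B0; apply: ltr_pwDl => //; exact: (jn_const_ge0 G B0). Qed.

Lemma john_nirenberg_powR G B b sigma k x : 0 < B -> 0 <= sigma -> grid_bmo G B b ->
  (\int[mu]_(y in cell G k x) (`|b y - avg G k b y| `^ sigma)%:E <=
   (jn_powR_const B sigma * vol G k)%:E)%E.
Proof.
move=> B0 sg0 [lb osc dense]; have v0 := vol_gt0 G k.
set r := Num.bound sigma.
have mb : measurable_fun [set: T] (fun y => `|b y - avg G k b y|).
  by apply: measurableT_comp => //; apply: measurable_funB; [case: lb|apply: measurable_avg; case: lb].
have mc := measurable_cell G k x.
have mbr : measurable_fun (cell G k x) (EFin \o (fun y => `|b y - avg G k b y| ^+ r.+1)).
  by apply/measurable_EFinP/measurable_funTS/measurable_funX.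
apply: (@le_trans _ _ (\int[mu]_(y in cell G k x) (1%:E + (`|b y - avg G k b y| ^+ r.+1)%:E))%E).
  apply: ge0_le_integral => //.
  - exact: measurable_funTS (measurable_EFin_powR sigma mb).
  - exact: emeasurable_funD.
  - move=> y _; rewrite -EFinD lee_fin -powR_mulrn//; apply: powR_le_1D => //.
    rewrite (le_trans (ltW (archi_boundP sg0)))// ler_nat//.
rewrite ge0_integralD//.
rewrite /jn_powR_const mulrDl mul1r EFinD; apply: leeD.
  rewrite integral_cst// mul1e [leLHS](_ : _ = (vol G k)%:E)//.
  exact: measure_cell.
exact: (john_nirenberg lb B0 osc dense).
Qed.

Section cell_integral.
Context (G : grid mu delta) (B s p : R) (B_gt0 : 0 < B) (s_gt1 : 1 < s) (sp : s < p).
Context (b f : T -> R) (bb : grid_bmo G B b).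
Context (mf : measurable_fun [set: T] f) (f_ge0 : forall x, 0 <= f x)
  (f_le1 : (\int[mu]_x (f x `^ p)%:E <= 1)%E).

Definition conj_exp : R := (1 - s^-1)^-1.
Definition osc_const : R := jn_powR_const B conj_exp `^ conj_exp^-1.
Definition osc_bound k x : R := 4 * (`|b x - avg G k b x| + osc_const).

Lemma conj_exp_gt1 : 1 < conj_exp.
Proof.
have s0 : 0 < s by exact: lt_trans ltr01 s_gt1.
have h : 0 < 1 - s^-1 by rewrite subr_gt0 invf_lt1.
by rewrite /conj_exp invf_gt1// gtrBl invr_gt0.
Qed.

Lemma osc_const_gt0 : 0 < osc_const.
Proof. by rewrite powR_gt0// (jn_powR_const_gt0 G). Qed.

Lemma osc_bound_gt0 k x : 0 < osc_bound k x.
Proof. by rewrite mulr_gt0// ltr_wpDl// osc_const_gt0. Qed.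

Lemma measurable_osc_bound k : measurable_fun [set: T] (osc_bound k).
Proof.
have [[mb _] _ _] := bb; apply: measurable_funM => //; apply: measurable_funD => //.
by apply: measurableT_comp => //; apply: measurable_funB => //; exact: measurable_avg.
Qed.

(** Hoelder's inequality with exponents s' and s; |b x - b y| is split at the average over the cell,
    whose oscillation of order s' is bounded by John-Nirenberg. Of the factor 4 in [osc_bound], one
    2 comes from [powR_add_le], the other from merging two s'-th powers into one. *)
Lemma cell_osc_le k x :
  (\int[mu]_(y in cell G k x) (`|b x - b y| * f y)%:E <=
   (osc_bound k x * pavg G s f k x * vol G k)%:E)%E.
Proof.
have [[mb _] _ _] := bb; have mc := measurable_cell G k x.
have v0 := vol_gt0 G k.
set X := `|b x - avg G k b x|; set ka := osc_const; set s' := conj_exp.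
have s'1 : 1 < s' by exact: conj_exp_gt1.
have s'0 : 0 < s' by exact: lt_trans s'1.
have s0 : 0 < s by exact: lt_trans s_gt1.
have ss' : s'^-1 + s^-1 = 1 by rewrite /s' /conj_exp invrK subrK.
have ka0 : 0 < ka by exact: osc_const_gt0.
have u0 := osc_bound_gt0 k x.
have lfs := locint_fs G s_gt1 sp mf f_ge0 f_le1.
set m := pavg G s f k x; have m0 : 0 <= m by exact: powR_ge0.
pose w y := `|b x - b y|.
have w0 y : 0 <= w y by exact: normr_ge0.
have mw : measurable_fun [set: T] w.
  by apply: measurableT_comp => //; apply: measurable_funB.
set I := (\int[mu]_(y in cell G k x) _)%E.
have I0 : (0 <= I)%E by apply: integral_ge0 => y _; rewrite lee_fin mulr_ge0.
have wA : (\int[mu]_(y in cell G k x) (w y `^ s')%:E <=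
    ((osc_bound k x * vol G k `^ s'^-1) `^ s')%:E)%E.
  rewrite powRM ?(ltW u0) ?powR_ge0// -(powRrM (vol G k)) mulVf ?gt_eqF// powRr1 ?(ltW v0)//.
  pose Y y := `|b y - avg G k b y|.
  have mY : measurable_fun [set: T] Y.
    by apply: measurableT_comp => //; apply: measurable_funB => //; exact: measurable_avg.
  have Y0 y : 0 <= Y y by exact: normr_ge0.
  have X0 : 0 <= X by exact: normr_ge0.
  apply: (@le_trans _ _ (\int[mu]_(y in cell G k x) ((X + Y y) `^ s')%:E)%E).
    apply: ge0_le_integral; first exact: mc.
    - by move=> y _; rewrite lee_fin powR_ge0.
    - exact: measurable_funTS (measurable_EFin_powR s' mw).
    - apply: measurable_funTS; apply: measurable_EFin_powR.
      by apply: measurable_funD => //; exact: measurable_cst.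
    - move=> y xy; rewrite lee_fin.
      apply: ge0_ler_powR; rewrite ?nnegrE ?(ltW s'0) ?w0 ?(addr_ge0 X0 (Y0 y))//.
      rewrite /w /X /Y -(avg_cellwise b xy).
      rewrite (_ : b x - b y = (b x - avg G k b x) - (b y - avg G k b x)); last by ring.
      exact: ler_normB.
  apply: (le_trans (@int_powRD_le _ _ _ mu _ _ _ _ mc mY X0 Y0 (ltW s'0))).
  apply: (@le_trans _ _ ((2 `^ s')%:E * ((X `^ s' * vol G k)%:E +
      (ka `^ s' * vol G k)%:E))%E).
    apply: lee_wpmul2l; first by rewrite lee_fin powR_ge0.
    apply: leeD.
      rewrite EFinM; apply: lee_wpmul2l; first by rewrite lee_fin powR_ge0.
      by rewrite le_eqVlt; apply/orP; left; apply/eqP; exact: measure_cell.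
    apply: (le_trans (john_nirenberg_powR k x B_gt0 (ltW s'0) bb)).
    rewrite lee_fin ler_pM2r// /ka /osc_const -/s' -powRrM mulVf ?gt_eqF// powRr1//.
    by rewrite ltW// (jn_powR_const_gt0 G).
  rewrite -EFinD -EFinM lee_fin -mulrDl mulrA ler_pM2r//.
  have XK t : 0 <= t -> t <= X + ka -> t `^ s' <= (X + ka) `^ s'.
    move=> t0 tx; apply: ge0_ler_powR; rewrite ?nnegrE ?(ltW s'0)//.
    by rewrite addr_ge0// ltW.
  rewrite /osc_bound -/X -/ka powRM ?addr_ge0 ?(ltW ka0)//.
  have -> : 4 `^ s' = 2 `^ s' * 2 `^ s' by rewrite -powRM// -natrM.
  rewrite -mulrA ler_pM2l ?powR_gt0//.
  apply: (@le_trans _ _ (2 * (X + ka) `^ s')).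
    rewrite mulrDl mul1r.
    by apply: lerD; apply: XK; rewrite ?normr_ge0 ?(ltW ka0)// ?lerDl ?lerDr// ltW.
  by rewrite ler_wpM2r ?powR_ge0// le1r_powR ?ler1n// ltW.
have If : (I <= (osc_bound k x * m * vol G k)%:E)%E.
  (* [hoelder_le] asks for positive bounds, whereas the mean [m] of f may vanish; hence [m + e],
     with e tending to 0. *)
  have step e : 0 < e -> (I <= (osc_bound k x * (m + e) * vol G k)%:E)%E.
    move=> e0; have me0 : 0 < m + e by rewrite ltr_wpDl.
    have fB : (\int[mu]_(y in cell G k x) (f y `^ s)%:E <=
        (((m + e) * vol G k `^ s^-1) `^ s)%:E)%E.
      rewrite (EFin_avg k x lfs) (powRM _ (ltW me0) (powR_ge0 _ _)).
      rewrite -(powRrM (vol G k)) mulVf ?gt_eqF//.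
      rewrite powRr1 ?(ltW v0)// lee_fin ler_pM2r//.
      have -> : avg G k (fun y => f y `^ s) x = m `^ s.
        rewrite /m /pavg -powRrM mulVf ?gt_eqF// powRr1//.
        by apply: avg_ge0 => y; rewrite powR_ge0.
      by apply: ge0_ler_powR; rewrite ?nnegrE ?(ltW s0) ?(ltW me0)// lerDl ltW.
    have := @hoelder_le _ _ _ mu (cell G k x) w f s' s _ _ mc (measurable_funTS mw)
      (measurable_funTS mf) (fun y _ => normr_ge0 _) (fun y _ => f_ge0 y) s'0 s0 ss'
      _ _ wA fB.
    move=> /(_ _ _)/wrap[].
    - by rewrite mulr_gt0// powR_gt0.
    - by rewrite mulr_gt0// powR_gt0.
    move=> /le_trans; apply; rewrite lee_fin mulrACA -powRD; last first.
      by rewrite (gt_eqF v0) implybT.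
    by rewrite ss' powRr1// ltW.
  have Ifin : I \is a fin_num.
    by rewrite ge0_fin_numE//; exact: le_lt_trans (step 1 ltr01) (ltry _).
  rewrite -(fineK Ifin) lee_fin; apply/ler_addgt0Pr => e e0.
  have c0 : 0 < osc_bound k x * vol G k by rewrite mulr_gt0.
  have := step _ (divr_gt0 e0 c0); rewrite -(fineK Ifin) lee_fin.
  move=> /le_trans; apply; rewrite le_eqVlt; apply/orP; left; apply/eqP.
  by field; rewrite !gt_eqF.
exact: If.
Qed.

Lemma int_osc_bound_le sigma k x : 0 < sigma ->
  (\int[mu]_(y in cell G k x) (osc_bound k y `^ sigma)%:E <=
   (8 `^ sigma * (jn_powR_const B sigma + osc_const `^ sigma) * vol G k)%:E)%E.
Proof.
move=> sg0; have [[mb _] _ _] := bb; have mc := measurable_cell G k x.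
pose Y y := `|b y - avg G k b y|; set ka := osc_const.
have ka0 : 0 < ka by exact: osc_const_gt0.
have mY : measurable_fun [set: T] Y.
  by apply: measurableT_comp => //; apply: measurable_funB => //; exact: measurable_avg.
have Y0 y : 0 <= Y y by exact: normr_ge0.
have s4 : 0 <= 4 `^ sigma by exact: powR_ge0.
have mkY : measurable_fun [set: T] (fun y => ka + Y y).
  by apply: measurable_funD => //; exact: measurable_cst.
have p4 y : cell G k x y -> (0 <= ((ka + Y y) `^ sigma)%:E)%E.
  by rewrite lee_fin powR_ge0.
have mkYs : measurable_fun (cell G k x) (EFin \o (fun y => (ka + Y y) `^ sigma)).
  exact: measurable_funTS (measurable_EFin_powR sigma mkY).
have -> : (\int[mu]_(y in cell G k x) (osc_bound k y `^ sigma)%:E =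
    (4 `^ sigma)%:E * \int[mu]_(y in cell G k x) ((ka + Y y) `^ sigma)%:E)%E.
  rewrite -(ge0_integralZl_EFin mu mc p4 mkYs s4); apply: eq_integral => y _.
  by rewrite -EFinM -powRM ?(addr_ge0 (ltW ka0) (Y0 y))// addrC.
rewrite (_ : 8 `^ sigma = 4 `^ sigma * 2 `^ sigma); last by rewrite -powRM// -natrM.
rewrite -!mulrA [leRHS]EFinM; apply: lee_wpmul2l; first by rewrite lee_fin.
apply: (le_trans (@int_powRD_le _ _ _ mu _ _ _ _ mc mY (ltW ka0) Y0 (ltW sg0))).
rewrite [leRHS]EFinM; apply: lee_wpmul2l; first by rewrite lee_fin powR_ge0.
rewrite (addrC (jn_powR_const B sigma)) mulrDl EFinD; apply: leeD; last first.
  exact: (john_nirenberg_powR k x B_gt0 (ltW sg0) bb).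
rewrite EFinM; apply: lee_wpmul2l; first by rewrite lee_fin powR_ge0.
by rewrite le_eqVlt; apply/orP; left; apply/eqP; exact: measure_cell.
Qed.

End cell_integral.
End grid_commutator.

Section grid_commutator_bound.
Context d (T : measurableType d) (R : realType).
Context (mu : {sigma_finite_measure set T -> \bar R}) (delta : R).

(* On every cell, the oscillation of b against f is at most an oscillation
   factor u, whose moments are bounded, times a power mean m of f. *)
Record osc_factors (G : grid mu delta) (p sigma K c : R) (b f : T -> R)
    (u m g : nat -> T -> R) : Prop := OscFactors {
  meas_u : forall k, measurable_fun [set: T] (u k);
  meas_m : forall k, measurable_fun [set: T] (m k);
  meas_g : forall k, measurable_fun [set: T] (g k);
  u_ge0 : forall k x, 0 <= u k x;
  m_ge0 : forall k x, 0 <= m k x;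
  g_ge0 : forall k x, 0 <= g k x;
  m_cellwise : forall k, cellwise G k (m k);
  m_le_g : forall k N x, (k <= N)%N -> m k x <= g N x;
  m_le_vol : forall k x, m k x <= vol G k `^ (- p^-1);
  int_g : forall N, (\int[mu]_x (g N x `^ p)%:E <= c%:E)%E;
  int_u : forall k x, (\int[mu]_(y in cell G k x) (u k y `^ sigma)%:E <=
    (K * vol G k)%:E)%E;
  osc_le : forall k x, (\int[mu]_(y in cell G k x) (`|b x - b y| * f y)%:E <=
    (u k x * m k x * vol G k)%:E)%E
}.

(** The positivity of K is asserted grid by grid because it is deduced from [0 < delta < 1], a fact
    carried by the grid. *)
Lemma osc_factorization (p sigma B : R) : 1 < p -> 0 < sigma -> 0 < B ->
  exists K c, 0 < c /\ forall (G : grid mu delta) (b f : T -> R),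
  0 < K /\ (grid_bmo G B b ->
  measurable_fun [set: T] f -> (forall x, 0 <= f x) ->
  (\int[mu]_x (f x `^ p)%:E <= 1)%E ->
  exists u m g, osc_factors G p sigma K c b f u m g).
Proof.
move=> p1 sg0 B0; pose s := (1 + p) / 2.
have s1 : 1 < s by rewrite /s; lra.
have sp : s < p by rewrite /s; lra.
exists (8 `^ sigma * (jn_powR_const delta B sigma + osc_const delta B s `^ sigma)).
exists (2 `^ (p / s) / (p / s - 1)); split.
  by rewrite divr_gt0 ?powR_gt0// subr_gt0 ltr_pdivlMr ?mul1r//; lra.
move=> G b f; split.
  by rewrite mulr_gt0 ?powR_gt0// ltr_wpDr ?powR_ge0// (jn_powR_const_gt0 G).
move=> bb mf f0 f1.
exists (osc_bound G B s b), (pavg G s f), (fun N x => maxavg G (fun y => f y `^ s) N x `^ s^-1).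
split.
- by move=> k; exact: measurable_osc_bound.
- by move=> k; exact: (measurable_pavg G s1 sp mf f0 f1).
- move=> k; apply: (measurableT_comp (measurable_powR _)); apply: measurable_maxavg.
  by case: (locint_fs G s1 sp mf f0 f1).
- by move=> k x; exact/ltW/osc_bound_gt0.
- by move=> k x; exact: powR_ge0.
- by move=> k x; exact: powR_ge0.
- by move=> k; exact: pavg_cellwise.
- by move=> k N x kN; exact: (pavg_le_max G s1 f x kN).
- by move=> k x; exact: (pavg_le_vol G s1 sp mf f0 f1 k x).
- by move=> N; exact: (int_max_powR G s1 sp mf f0 f1 N).
- by move=> k x; exact: (int_osc_bound_le s B0 bb k x sg0).
- by move=> k x; exact: (cell_osc_le B0 s1 sp bb mf f0 f1 k x).
Qed.

(** The exponent [a - 2] becomes a once the two volumes of [osc_le] are included. The product of the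
    means then gives the cellwise factor of [dyadic_sum_bound], of size at most vol^(-1/q) since a -
    1/p1 - 1/p2 = -1/q, and the product of the oscillations gives the other factor. The constant is
    fixed before the grid. *)
Lemma grid_commutator_bound (p1 p2 p a q B : R) : 0 < delta < 1 ->
  1 < p1 -> 1 < p2 -> 0 < p -> 0 < a -> 0 < q -> 0 < B ->
  p^-1 = p1^-1 + p2^-1 -> q^-1 = p^-1 - a ->
  exists2 C, 0 < C & forall (G : grid mu delta) (b1 b2 f1 f2 : T -> R),
  grid_bmo G B b1 -> grid_bmo G B b2 ->
  measurable_fun [set: T] f1 -> measurable_fun [set: T] f2 ->
  (forall x, 0 <= f1 x) -> (forall x, 0 <= f2 x) ->
  (\int[mu]_x (f1 x `^ p1)%:E <= 1)%E -> (\int[mu]_x (f2 x `^ p2)%:E <= 1)%E ->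
  exists Z : nat -> T -> R, [/\ forall k, measurable_fun [set: T] (Z k),
    forall k x, 0 <= Z k x,
    forall k x, ((vol G k `^ (a - 2))%:E *
       (\int[mu]_(y in cell G k x) (`|b1 x - b1 y| * f1 y)%:E *
        \int[mu]_(y in cell G k x) (`|b2 x - b2 y| * f2 y)%:E) <= (Z k x)%:E)%E &
    forall N, (\int[mu]_x ((\sum_(k < N) Z k x) `^ q)%:E <= C%:E)%E].
Proof.
move=> d01 p11 p21 p0 a0 q0 B0 pE qE.
have p10 : 0 < p1 by lra.
have p20 : 0 < p2 by lra.
(* The moment of order 2 q of a product of two oscillations is split into moments of order 4 q of
   each. *)
have q40 : 0 < 2 * (2 * q) by rewrite !mulr_gt0.
have [K1 [c1 [c10 H1]]] := osc_factorization p11 q40 B0.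
have [K2 [c2 [c20 H2]]] := osc_factorization p21 q40 B0.
(* The positivity of K1 and K2 is obtained from a grid. If their sum is not positive there is no
   grid at all, and any constant serves. *)
have [K0|nK0] := pselect (0 < K1 + K2); last first.
  exists 1 => // G b1 b2 f1 f2; exfalso; apply: nK0.
  by rewrite addr_gt0// ?(H1 G b1 f1).1 ?(H2 G b2 f2).1.
have [C C0 HC] := dyadic_sum_bound mu p0 a0 q0 qE d01 (addr_gt0 c10 c20) K0.
exists C => // G b1 b2 f1 f2 bb1 bb2 mf1 mf2 f10 f20 f11 f21.
have [u1 [m1 [g1 [mu1 mm1 mg1 u10 m10 g10 cm1 mg1N mv1 ig1 iu1 ol1]]]] :=
  (H1 G b1 f1).2 bb1 mf1 f10 f11.
have [u2 [m2 [g2 [mu2 mm2 mg2 u20 m20 g20 cm2 mg2N mv2 ig2 iu2 ol2]]]] :=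
  (H2 G b2 f2).2 bb2 mf2 f20 f21.
pose D k x := vol G k `^ a * (m1 k x * m2 k x); pose U k x := u1 k x * u2 k x.
have D0 k x : 0 <= D k x by rewrite /D mulr_ge0 ?powR_ge0// mulr_ge0.
have U0 k x : 0 <= U k x by rewrite /U mulr_ge0.
have mD k : measurable_fun [set: T] (D k).
  apply: measurable_funM; first exact: measurable_cst.
  exact: measurable_funM (mm1 k) (mm2 k).
have mU k : measurable_fun [set: T] (U k) by exact: measurable_funM (mu1 k) (mu2 k).
exists (fun k x => D k x * U k x); split.
- by move=> k; exact: measurable_funM (mD k) (mU k).
- by move=> k x; rewrite mulr_ge0.
- move=> k x; have v0 := vol_gt0 G k.
  have i1 : (0 <= \int[mu]_(y in cell G k x) (`|b1 x - b1 y| * f1 y)%:E)%E.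
    by apply: integral_ge0 => y _; rewrite lee_fin mulr_ge0.
  have i2 : (0 <= \int[mu]_(y in cell G k x) (`|b2 x - b2 y| * f2 y)%:E)%E.
    by apply: integral_ge0 => y _; rewrite lee_fin mulr_ge0.
  apply: (le_trans (lee_wpmul2l _ (lee_pmul i1 i2 (ol1 k x) (ol2 k x)))).
    by rewrite lee_fin powR_ge0.
  rewrite -!EFinM lee_fin /D /U.
  have -> : vol G k `^ a = vol G k `^ (a - 2) * (vol G k * vol G k).
    rewrite -expr2 -powR_mulrn ?(ltW v0)// -powRD ?(gt_eqF v0) ?implybT//.
    by congr (_ `^ _); ring.
  rewrite le_eqVlt; apply/orP; left; apply/eqP.
  move: (vol G k `^ (a - 2)) (vol G k) (m1 k x) (m2 k x) (u1 k x) (u2 k x) => *.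
  by ring.
- move=> N.
  apply: (HC G D U (fun x => g1 N x * g2 N x) N) => //.
  - exact: measurable_funM (mg1 N) (mg2 N).
  - by move=> x; rewrite mulr_ge0.
  - exact: (int_powRM_le p10 p20 p0 pE (mg1 N) (mg2 N) (g10 N) (g20 N)).
  - by move=> k x y xy; rewrite /D (cm1 k x y xy) (cm2 k x y xy).
  - move=> k x kN; rewrite /D ler_wpM2l ?powR_ge0// ler_pM//.
      exact: mg1N (ltnW kN).
    exact: mg2N (ltnW kN).
  - move=> k x; have v0 := vol_gt0 G k.
    apply: (@le_trans _ _ (vol G k `^ a * (vol G k `^ (- p1^-1) * vol G k `^ (- p2^-1)))).
      by rewrite /D ler_wpM2l ?powR_ge0// ler_pM.
    rewrite -!powRD ?(gt_eqF v0) ?implybT//.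
    by rewrite qE pE (_ : a + _ = - (p1^-1 + p2^-1 - a))//; ring.
  - move=> k x; have mc := measurable_cell G k x.
    have me1 := measurable_funTS (D := cell G k x) (measurable_EFin_powR (2 * (2 * q)) (mu1 k)).
    have me2 := measurable_funTS (D := cell G k x) (measurable_EFin_powR (2 * (2 * q)) (mu2 k)).
    have pe1 y : cell G k x y -> (0 <= (u1 k y `^ (2 * (2 * q)))%:E)%E by rewrite lee_fin powR_ge0.
    have pe2 y : cell G k x y -> (0 <= (u2 k y `^ (2 * (2 * q)))%:E)%E by rewrite lee_fin powR_ge0.
    rewrite (mulrDl K1 K2) EFinD; apply: (le_trans _ (leeD (iu1 k x) (iu2 k x))).
    rewrite -(ge0_integralD mu mc pe1 me1 pe2 me2).
    apply: ge0_le_integral; first exact: mc.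
    - by move=> y _; rewrite lee_fin powR_ge0.
    - exact: measurable_funTS (measurable_EFin_powR _ (mU k)).
    - exact: emeasurable_funD me1 me2.
    - by move=> y _; rewrite -EFinD lee_fin powRM_le_add// mulr_ge0// ltW.
Qed.

End grid_commutator_bound.

(** * Density of cellwise functions in mean *)

Section density.
Context d (T : measurableType d) (R : realType).
Context (mu : {sigma_finite_measure set T -> \bar R}) (delta : R).
Context (G : grid mu delta).

Definition saturated N (S : set T) := forall x y, same G N x y -> S x -> S y.

Definition symdiff (A S : set T) := (A `\` S) `|` (S `\` A).

(** These sets form a sigma-algebra, which reduces the density of cellwise functions to the case of
    half-spaces. *)
Definition approximable (P A : set T) := measurable A /\
  forall e, 0 < e -> exists N S, [/\ measurable S, saturated N S &
    (mu (P `&` symdiff A S) <= e%:E)%E].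

Lemma saturated_le M N S : (M <= N)%N -> saturated M S -> saturated N S.
Proof. by move=> MN sS x y xy; apply: sS; exact: same_le MN xy. Qed.

Lemma measurable_symdiff A S : measurable A -> measurable S ->
  measurable (symdiff A S).
Proof. by move=> mA mS; apply: measurableU; exact: measurableD. Qed.

Context (P : set T) (mP : measurable P) (Poo : (mu P < +oo)%E).

Lemma approximable_saturated N S : measurable S -> saturated N S -> approximable P S.
Proof.
move=> mS sS; split=> // e e0; exists N, S; split=> //.
by rewrite /symdiff setDv setU0 setI0 measure0 lee_fin ltW.
Qed.

Lemma approximable_of_approx A : measurable A ->
  (forall e, 0 < e -> exists2 A', approximable P A' &
    (mu (P `&` symdiff A A') <= e%:E)%E) -> approximable P A.
Proof.
move=> mA h; split=> // e e0; have e20 : 0 < e / 2 by rewrite divr_gt0.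
have [A' [mA' aA'] AA'] := h _ e20.
have [N [S [mS sS A'S]]] := aA' _ e20; exists N, S; split=> //.
apply: (@le_trans _ _ (mu ((P `&` symdiff A A') `|` (P `&` symdiff A' S)))).
  apply: le_measure; rewrite ?inE.
  - by apply: measurableI => //; exact: measurable_symdiff.
  - by apply: measurableU; apply: measurableI => //; exact: measurable_symdiff.
  - move=> x [Px]; have [A'x|A'x] := pselect (A' x); move=> [[Ax Sx]|[Sx Ax]].
    + by right; split=> //; left.
    + by left; split=> //; right.
    + by left; split=> //; left.
    + by right; split=> //; right.
apply: (le_trans (measureU2 _ _ _));
  try by apply: measurableI => //; exact: measurable_symdiff.
by rewrite (splitr e) EFinD; apply: leeD.
Qed.

Lemma approximableC A : approximable P A -> approximable P (~` A).
Proof.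
move=> [mA aA]; split=> [|e e0]; first exact: measurableC.
have [N [S [mS sS AS]]] := aA _ e0; exists N, (~` S); split.
- exact: measurableC.
- by move=> x y xy nSx Sy; apply: nSx; apply: sS Sy; rewrite same_sym.
- apply: le_trans AS; rewrite le_eqVlt; apply/orP; left; apply/eqP; congr (mu (_ `&` _)).
  by rewrite /symdiff !setDE !setCK setUC setIC [X in _ `|` X]setIC.
Qed.

Lemma approximableU A B : approximable P A -> approximable P B ->
  approximable P (A `|` B).
Proof.
move=> [mA aA] [mB aB]; split=> [|e e0]; first exact: measurableU.
have e20 : 0 < e / 2 by rewrite divr_gt0.
have [N [S [mS sS AS]]] := aA _ e20; have [M [U [mU sU BU]]] := aB _ e20.
exists (maxn N M), (S `|` U); split.
- exact: measurableU.
- move=> x y xy [Sx|Ux]; [left; apply: saturated_le sS _ _ xy Sx|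
    right; apply: saturated_le sU _ _ xy Ux]; [exact: leq_maxl|exact: leq_maxr].
- apply: (@le_trans _ _ (mu ((P `&` symdiff A S) `|` (P `&` symdiff B U)))).
    apply: le_measure; rewrite ?inE.
    + by apply: measurableI => //; apply: measurable_symdiff; exact: measurableU.
    + by apply: measurableU; apply: measurableI => //; exact: measurable_symdiff.
    + move=> x [Px] [[[Ax|Bx] /not_orP[nS nU]]|[[Sx|Ux] /not_orP[nA nB]]].
      * by left; split=> //; left.
      * by right; split=> //; left.
      * by left; split=> //; right.
      * by right; split=> //; right.
  apply: (le_trans (measureU2 _ _ _));
    try by apply: measurableI => //; exact: measurable_symdiff.
  by rewrite (splitr e) EFinD; apply: leeD.
Qed.

Lemma approximable0 : approximable P set0.
Proof. by apply: (@approximable_saturated 0). Qed.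

(** Continuity from below, inside P of finite measure, reduces the countable union to a finite
    one. *)
Lemma approximable_bigcup (A : (set T)^nat) : (forall j, approximable P (A j)) ->
  approximable P (\bigcup_j A j).
Proof.
move=> aA; have mA j : measurable (A j) by case: (aA j).
apply: approximable_of_approx => [|e e0]; first exact: bigcup_measurable.
pose U M := \big[setU/set0]_(j < M.+1) A j.
have aU M : approximable P (U M).
  rewrite /U; elim: M.+1 => {M} [|M IH]; first by rewrite big_ord0; exact: approximable0.
  by rewrite big_ord_recr/=; exact: approximableU.
have mU M : measurable (U M) by case: (aU M).
have cup : \bigcup_M (P `&` U M) = P `&` \bigcup_j A j.
  by rewrite -setI_bigcupr /U bigcup_bigsetU_bigcup.
have mPA : measurable (P `&` \bigcup_j A j).
  by apply: measurableI => //; exact: bigcup_measurable.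
have nd : nondecreasing_seq (fun M => P `&` U M).
  move=> M N MN; apply/subsetPset => x [Px]; rewrite /U -bigcup_mkord => -[j jM Ajx].
  by split=> //; rewrite -bigcup_mkord; exists j => //; exact: leq_trans jM _.
have cv := @nondecreasing_cvg_mu _ _ _ mu (fun M => P `&` U M) _ _ nd.
have {cv} : mu (P `&` U M) @[M --> \oo] --> mu (P `&` \bigcup_j A j).
  rewrite -cup; apply: cv; first by move=> M; exact: measurableI.
  by rewrite cup.
have le_P B : measurable B -> (mu (P `&` B) < +oo)%E.
  move=> mB; apply: le_lt_trans Poo; apply: le_measure; rewrite ?inE//.
  exact: measurableI.
have fPA : mu (P `&` \bigcup_j A j) \is a fin_num.
  by rewrite ge0_fin_numE// le_P//; exact: bigcup_measurable.
rewrite -(fineK fPA) => /fine_cvgP[_ /cvgrPdist_le/(_ _ e0)[M _ hM]].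
exists (U M) => //; have {}hM := hM M (leqnn M).
have UA : U M `<=` \bigcup_j A j by rewrite /U -bigcup_mkord => x [j _ Ajx]; exists j.
have -> : P `&` symdiff (\bigcup_j A j) (U M) = (P `&` \bigcup_j A j) `\` (P `&` U M).
  apply/seteqP; split=> x.
    by move=> [Px [[Ax nUx]|[Ux nAx]]]; [by split; [split|move=> [_ /nUx]]|by have := UA _ Ux].
  by move=> [[Px Ax] nPU]; split=> //; left; split=> // Ux; apply: nPU; split.
rewrite measureD//; last 2 first.
- exact: measurableI.
- by rewrite -ge0_fin_numE.
have fPU : mu (P `&` U M) \is a fin_num by rewrite ge0_fin_numE// le_P.
rewrite [X in (_ - mu X)%E](_ : _ = P `&` U M); last first.
  apply/seteqP; split=> x; first by move=> [].
  by move=> [Px Ux]; split; [split=> //; exact: UA|split].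
apply: (@le_trans _ _ (fine (mu (P `&` \bigcup_j A j)) - fine (mu (P `&` U M)))%:E).
  by rewrite EFinB (fineK fPA) (fineK fPU).
by rewrite lee_fin; apply: le_trans hM; rewrite ler_norm.
Qed.

Lemma sigma_algebra_approximable : sigma_algebra [set: T] (approximable P).
Proof.
split; first exact: approximable0.
- by move=> A aA; rewrite setTD; exact: approximableC.
- exact: approximable_bigcup.
Qed.

End density.

Section function_density.
Context d (T : measurableType d) (R : realType).
Context (mu : {sigma_finite_measure set T -> \bar R}) (delta : R).
Context (G : grid mu delta).
Context (P : set T) (mP : measurable P).
Implicit Types (f g h : T -> R) (e : R).

Definition fapproximable g := measurable_fun [set: T] g /\
  forall e : R, 0 < e -> exists N (phi : T -> R), [/\ measurable_fun [set: T] phi, cellwise G N phi &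
    (\int[mu]_(x in P) (`|g x - phi x|)%:E <= e%:E)%E].

Lemma measurable_normB f g : measurable_fun [set: T] f -> measurable_fun [set: T] g ->
  measurable_fun P (EFin \o (fun x => `|f x - g x|)).
Proof.
move=> mf mg; apply/measurable_EFinP/measurable_funTS.
by apply: measurableT_comp => //; exact: measurable_funB.
Qed.

Lemma int_normB_le f g h e1 e2 : measurable_fun [set: T] f ->
  measurable_fun [set: T] g -> measurable_fun [set: T] h ->
  (\int[mu]_(x in P) (`|f x - g x|)%:E <= e1%:E)%E ->
  (\int[mu]_(x in P) (`|g x - h x|)%:E <= e2%:E)%E ->
  (\int[mu]_(x in P) (`|f x - h x|)%:E <= (e1 + e2)%:E)%E.
Proof.
move=> mf mg mh h1 h2; rewrite EFinD; apply: (le_trans _ (leeD h1 h2)).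
have m1 := measurable_normB mf mg; have m2 := measurable_normB mg mh.
have pos (u v : T -> R) x : P x -> (0 <= (`|u x - v x|)%:E)%E by rewrite lee_fin.
rewrite -(ge0_integralD mu mP (pos f g) m1 (pos g h) m2).
apply: ge0_le_integral => //; first exact: measurable_normB.
  exact: emeasurable_funD m1 m2.
move=> x _; rewrite -EFinD lee_fin.
by rewrite (_ : f x - h x = (f x - g x) + (g x - h x)) ?ler_normD//; ring.
Qed.

Lemma fapproximable_limit g : measurable_fun [set: T] g ->
  (forall e, 0 < e -> exists2 g', fapproximable g' &
    (\int[mu]_(x in P) (`|g x - g' x|)%:E <= e%:E)%E) -> fapproximable g.
Proof.
move=> mg h; split=> // e e0; have e20 : 0 < e / 2 by rewrite divr_gt0.
have [g' [mg' ag'] gg'] := h _ e20.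
have [N [phi [mphi cphi gphi]]] := ag' _ e20; exists N, phi; split=> //.
by rewrite (splitr e); exact: int_normB_le gphi.
Qed.

Lemma fapproximable_indic A : approximable G P A -> fapproximable \1_A.
Proof.
move=> [mA aA]; split=> [|e e0]; first exact: measurable_indic.
have [N [S [mS sS AS]]] := aA _ e0; exists N, \1_S; split.
- exact: measurable_indic.
- move=> x y xy; rewrite !indicE; congr (nat_of_bool _)%:R.
  by apply/idP/idP; rewrite !inE; apply: sS; rewrite // same_sym.
- apply: le_trans AS; rewrite setIC -integral_indic//; last exact: measurable_symdiff.
  rewrite le_eqVlt; apply/orP; left; apply/eqP; apply: eq_integral => x _.
  congr EFin; rewrite !indicE.
  have [Ax|Ax] := pselect (A x); have [Sx|Sx] := pselect (S x);
    rewrite ?(mem_set Ax) ?(memNset Ax) ?(mem_set Sx) ?(memNset Sx).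
  + by rewrite subrr normr0 memNset// => -[[_ /(_ Sx)]|[_ /(_ Ax)]].
  + by rewrite subr0 normr1 mem_set//; left.
  + by rewrite sub0r normrN1 mem_set//; right.
  + by rewrite subrr normr0 memNset// => -[[/Ax]|[/Sx]].
Qed.

Lemma fapproximableD f g : fapproximable f -> fapproximable g ->
  fapproximable (fun x => f x + g x).
Proof.
move=> [mf af] [mg ag]; split=> [|e e0]; first exact: measurable_funD.
have e20 : 0 < e / 2 by rewrite divr_gt0.
have [N [phi [mphi cphi fphi]]] := af _ e20.
have [M [psi [mpsi cpsi gpsi]]] := ag _ e20.
exists (maxn N M), (fun x => phi x + psi x); split.
- exact: measurable_funD.
- move=> x y xy; rewrite (cellwise_le (leq_maxl N M) cphi xy).
  by rewrite (cellwise_le (leq_maxr N M) cpsi xy).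
- have m1 := measurable_normB mf mphi; have m2 := measurable_normB mg mpsi.
  rewrite (splitr e) EFinD; apply: (le_trans _ (leeD fphi gpsi)).
  have pos (u v : T -> R) x : P x -> (0 <= (`|u x - v x|)%:E)%E by rewrite lee_fin.
  rewrite -(ge0_integralD mu mP (pos f phi) m1 (pos g psi) m2).
  apply: ge0_le_integral => //.
  + by apply: measurable_normB; exact: measurable_funD.
  + exact: emeasurable_funD m1 m2.
  move=> x _; rewrite -EFinD lee_fin.
  by rewrite (_ : _ - _ = (f x - phi x) + (g x - psi x)) ?ler_normD//; ring.
Qed.

Lemma fapproximableZ c f : fapproximable f -> fapproximable (fun x => c * f x).
Proof.
move=> [mf af]; split=> [|e e0]; first exact: measurable_funM.
have c0 : 0 < `|c| + 1 by rewrite ltr_wpDl.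
have [N [phi [mphi cphi fphi]]] := af _ (divr_gt0 e0 c0).
exists N, (fun x => c * phi x); split.
- exact: measurable_funM.
- by move=> x y xy; rewrite (cphi _ _ xy).
- under eq_integral do rewrite -mulrBr normrM EFinM.
  rewrite ge0_integralZl_EFin//; last exact: measurable_normB.
  apply: (le_trans (lee_wpmul2l _ fphi)); first by rewrite lee_fin.
  rewrite -EFinM lee_fin mulrA ler_pdivrMr// mulrC ler_wpM2l ?(ltW e0)//.
  by rewrite lerDl.
Qed.

Lemma fapproximable_sum (s : seq R) (F : R -> T -> R) :
  (forall y, fapproximable (F y)) -> fapproximable (fun x => \sum_(y <- s) F y x).
Proof.
move=> aF; elim: s => [|y s IH].
  under eq_fun do rewrite big_nil; split=> // e e0.
  exists 0%N, (fun=> 0); split=> //.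
  under eq_integral do rewrite subrr normr0.
  by rewrite integral0 lee_fin ltW.
under eq_fun do rewrite big_cons.
exact: fapproximableD.
Qed.

Context (aP : forall A, measurable A -> approximable G P A).

Import HBSimple.

Lemma fapproximable_sfun (g : {sfun T >-> R}) : fapproximable g.
Proof.
have -> : (g : T -> R) = fun x => \sum_(y <- finmap.enum_fset (fset_set (range g))) y * \1_(g @^-1` [set y]) x.
  by apply/funext => x; rewrite [LHS]fimfunE fsbig_finite.
apply: (@fapproximable_sum _ (fun y x => y * \1_(g @^-1` [set y]) x)) => y.
apply: fapproximableZ; apply: fapproximable_indic; apply: aP.
by rewrite -[X in measurable X]setTI; apply: measurable_funPT.
Qed.

Lemma fapproximable_integrable g : measurable_fun [set: T] g ->
  mu.-integrable P (EFin \o g) -> fapproximable g.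
Proof.
move=> mg ig; apply: fapproximable_limit => // e e0.
have [h [_ _ hg]] := approximation_sfun_integrable mP ig.
move/fine_cvgP : hg => [fin /cvgrPdist_lt/(_ _ e0) lt_e].
have [n [finn ltn]] := @filter_ex _ _ _ _ (filterI fin lt_e).
exists (h n); first exact: fapproximable_sfun.
rewrite -(fineK finn) lee_fin; apply/ltW; move: ltn.
by rewrite sub0r normrN; apply: le_lt_trans; rewrite ler_norm.
Qed.

End function_density.

Section grid_dense.
Context d (T : measurableType d) (R : realType).
Context (mu : {sigma_finite_measure set T -> \bar R}) (delta : R).
Context (G : grid mu delta).

(** Averaging fixes the cellwise function [phi] and contracts L^1 on a union of cells. *)
Lemma int_avg_dist_le N (b phi : T -> R) (P : set T) : measurable P -> saturated G N P ->
  locint G b -> measurable_fun [set: T] phi -> cellwise G N phi ->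
  (\int[mu]_(x in P) (`|phi x - avg G N b x|)%:E <=
   \int[mu]_(x in P) (`|b x - phi x|)%:E)%E.
Proof.
move=> mP sP lb mphi cphi; have mb := lb.1; have v0 := vol_gt0 G N.
have mh : measurable_fun [set: T] (EFin \o (fun x => `|b x - phi x|)).
  by apply/measurable_EFinP/measurableT_comp => //; exact: measurable_funB.
have h0 x : (0 <= (`|b x - phi x|)%:E)%E by rewrite lee_fin.
have mg : measurable_fun [set: T] (EFin \o (\1_P : T -> R)).
  by apply/measurable_EFinP; exact: measurable_indic.
have g0 x : (0 <= (\1_P x : R)%:E)%E by rewrite lee_fin indicE.
have cg : cellwise G N (EFin \o (\1_P : T -> R)).
  move=> x y xy; rewrite /= !indicE; congr (EFin (nat_of_bool _)%:R).
  by apply/idP/idP; rewrite !inE; apply: sP; rewrite // same_sym.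
have ma : measurable_fun P (EFin \o (fun x => `|phi x - avg G N b x|)).
  apply/measurable_EFinP/measurable_funTS/measurableT_comp => //.
  by apply: measurable_funB => //; exact: measurable_avg.
rewrite -(@lee_pmul2r _ (vol G N)%:E) ?lte_fin// -ge0_integralZr//; last first.
  by rewrite lee_fin ltW.
apply: (@le_trans _ _ (\int[mu]_x ((\1_P x)%:E * \int[mu]_(y in cell G N x) (`|b y - phi y|)%:E)%E)%E).
  rewrite integral_mkcond; apply: ge0_le_integral => //.
  - move=> x _; rewrite patchE; case: ifP => // _.
    by rewrite -EFinM lee_fin mulr_ge0// ltW.
  - by apply/(measurable_restrictT _ mP); apply: emeasurable_funM => //.
  - by apply: emeasurable_funM => //; exact: measurable_int_cell.
  - move=> x _; rewrite patchE indicE; case: ifPn => xP; last by rewrite mul0e.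
    rewrite mul1e -EFinM.
    have lc : locint G (fun=> phi x) by exact: locint_cst.
    rewrite -[X in `|X - _|](avg_cst G N (phi x) x) -avgB//.
    apply: (@le_trans _ _ ((avg G N (fun y => `|phi x - b y|) x * vol G N)%:E)).
      rewrite lee_fin ler_pM2r//; apply: avg_norm; exact: locintB.
    rewrite -EFin_avg; last by apply: locint_norm; exact: locintB.
    rewrite le_eqVlt; apply/orP; left; apply/eqP; apply: eq_integral => y.
    by rewrite inE => xy; rewrite distrC (cphi x y xy).
rewrite (tonelli_cell mg mh g0 h0 cg).
rewrite -ge0_integralZr//; last 2 first.
- exact: measurable_funTS.
- by rewrite lee_fin ltW.
rewrite [leRHS]integral_mkcond le_eqVlt; apply/orP; left; apply/eqP.
apply: eq_integral => x _; rewrite patchE /= indicE.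
by case: ifPn => _; rewrite ?mul1e// !mul0e.
Qed.

(** A cellwise [phi] close to b in mean is also close to the average of b, by [int_avg_dist_le];
    each of the two distances takes half of [e * vol G k]. *)
Lemma grid_dense k (b : T -> R) x e : locint G b ->
  (forall A, measurable A -> approximable G (cell G k x) A) -> 0 < e ->
  exists m, avg G k (fun y => `|b y - avg G (k + m) b y|) x <= e.
Proof.
move=> lb aP e0; have v0 := vol_gt0 G k; have mb := lb.1.
have mP := measurable_cell G k x.
have ev0 : 0 < e * vol G k / 2 by rewrite divr_gt0// mulr_gt0.
have [_ ab] := fapproximable_integrable mP aP mb (lb.2 k x).
have [N0 [phi [mphi cphi bphi]]] := ab _ ev0.
pose N := (k + N0)%N.
have cphiN : cellwise G N phi by exact: cellwise_le (leq_addl k N0) cphi.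
have sP : saturated G N (cell G k x).
  by move=> y z yz xy; exact: same_trans xy (same_le (leq_addr N0 k) yz).
have h := int_avg_dist_le mP sP lb mphi cphiN.
have maN : measurable_fun [set: T] (avg G N b) by exact: measurable_avg.
have bN := int_normB_le mP mb mphi maN bphi (le_trans h bphi).
exists N0; rewrite /avg_def mulrC ler_pdivrMr//.
rewrite -/N /Rintegral; move: bN; rewrite -splitr.
set I := (\int[mu]_(y in _) _)%E => bN.
have I0 : (0 <= I)%E by apply: integral_ge0 => y _; rewrite lee_fin.
have If : I \is a fin_num by rewrite ge0_fin_numE//; exact: le_lt_trans bN (ltry _).
by rewrite -lee_fin (fineK If).
Qed.

End grid_dense.

(** * Dyadic cubes *)

Section boxes.
Context (R : realType) (n : nat).

Definition cobox (a b : 'I_n -> R) : set (Rn R n) :=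
  [set x | forall i, a i <= rcoord x i < b i].

Lemma measurable_borel (A : set (n.-tuple (measurableTypeR R))) :
  measurable A -> measurable (A : set (Rn R n)).
Proof. by move=> mA; apply: sub_caratheodory; exact: sub_sigma_algebra. Qed.

Lemma lebesgue_borel (A : set (n.-tuple (measurableTypeR R))) :
  measurable A -> lebesgue (A : set (Rn R n)) = borel_lebesgue R n A.
Proof. by move=> mA; rewrite /lebesgue /completed_measure_extension measurable_mu_extE. Qed.

Lemma measurable_rcoord i : measurable_fun [set: Rn R n] (fun x => rcoord x i).
Proof.
move=> _ Y mY; rewrite setTI; apply: measurable_borel.
have := @measurable_tnth _ (measurableTypeR R) n i measurableT Y mY.
by rewrite setTI.
Qed.

Lemma measurable_cube (a : Rn R n) r : measurable (cube a r).
Proof. exact: (measurable_borel (measurable_box (rcoord a) (fun i => rcoord a i + r))). Qed.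

End boxes.

Lemma measurable_cotuple (R : realType) n (a b : 'I_n -> R) :
  measurable [set x : n.-tuple (measurableTypeR R) |
    forall i, a i <= tnth x i < b i].
Proof.
have -> : [set x : n.-tuple (measurableTypeR R) |
    forall i, a i <= tnth x i < b i] =
    \bigcap_(i in [set: 'I_n]) ((fun x : n.-tuple (measurableTypeR R) =>
      tnth x i) @^-1` `[a i, b i[%classic).
  by apply/seteqP; split => x /= h i; [move=> _|]; have := h i;
    rewrite /= in_itv //=; exact.
apply: fin_bigcap_measurable => // i _; rewrite -[X in measurable X]setTI.
by apply: measurable_tnth => //; exact: measurable_itv.
Qed.

Lemma borel_lebesgue_cotuple (R : realType) n (a b : 'I_n -> R)
    (hab : forall i, a i <= b i) :
  borel_lebesgue R n [set x | forall i, a i <= tnth x i < b i] =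
  (\prod_(i < n) (b i - a i))%:E.
Proof.
elim: n a b hab => [|n IH] a b hab.
  by rewrite big_ord0 /= diracE mem_set// => -[].
rewrite big_ord_recl /= /cons_measure /pushforward.
rewrite (_ : _ @^-1` _ = `[a ord0, b ord0[ `*`
  [set x : n.-tuple _ |
    forall i, a (lift ord0 i) <= tnth x i < b (lift ord0 i)]); last first.
  apply/seteqP; split => -[x t] /=; rewrite in_itv /=.
    move=> h; split; first exact: (h ord0).
    by move=> i; have := h (lift ord0 i); rewrite tnthS.
  by move=> [h0 h] i; case: (unliftP ord0 i) => [j ->|->]; rewrite ?tnthS.
rewrite product_measure1E//; last exact: measurable_cotuple.
rewrite IH// EFinM /= lebesgue_measure_itv /= lte_fin.
have := hab ord0; rewrite le_eqVlt => /orP[/eqP ->|->]; last by rewrite EFinB.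
by rewrite ltxx subrr.
Qed.

Section cobox_measure.
Context (R : realType) (n : nat).

Lemma measurable_cobox (a b : 'I_n -> R) : measurable (cobox a b).
Proof. exact: (measurable_borel (measurable_cotuple a b)). Qed.

Lemma lebesgue_cobox (a b : 'I_n -> R) : (forall i, a i <= b i) ->
  lebesgue (cobox a b) = (\prod_(i < n) (b i - a i))%:E.
Proof.
by move=> ab; rewrite -borel_lebesgue_cotuple// -lebesgue_borel//; exact: measurable_cotuple.
Qed.

End cobox_measure.

Section cube_grid.
Context (R : realType) (n : nat) (o : 'I_n -> R) (rho : R).
Context (n_gt0 : (0 < n)%N) (rho_gt0 : 0 < rho).
Local Notation Rn := (Rn R n).

Definition side k : R := rho / 2 ^+ k.
Definition index k (x : Rn) i : int := Num.floor ((rcoord x i - o i) / side k).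
Definition same_cube k (x y : Rn) : bool := [forall i, index k x i == index k y i].

Lemma side_gt0 k : 0 < side k. Proof. by rewrite divr_gt0// exprn_gt0. Qed.

Lemma same_cubeP k x y : reflect (forall i, index k x i = index k y i) (same_cube k x y).
Proof. by apply: (iffP forallP) => h i; apply/eqP; exact: h. Qed.

Lemma same_cube_refl k x : same_cube k x x. Proof. exact/same_cubeP. Qed.

Lemma same_cube_sym k x y : same_cube k x y = same_cube k y x.
Proof. by apply: eq_forallb => i; rewrite eq_sym. Qed.

Lemma same_cube_trans k x y z : same_cube k x y -> same_cube k y z -> same_cube k x z.
Proof. by move=> /same_cubeP xy /same_cubeP yz; apply/same_cubeP => i; rewrite xy yz. Qed.

(** Nestedness of the dyadic intervals in one coordinate: the integer part of 2 u determines that of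
    u. *)
Lemma floor2_inj (u w : R) : Num.floor (2 * u) = Num.floor (2 * w) ->
  Num.floor u = Num.floor w.
Proof.
wlog uw : u w / Num.floor u <= Num.floor w => [h e|].
  by have [uw|/ltW wu] := leP (Num.floor u) (Num.floor w); [exact: h|exact/esym/h].
move=> e; apply/eqP; rewrite eq_le uw /= leNgt; apply/negP => lt.
have h1 : u < (Num.floor w)%:~R by rewrite -floor_lt_int.
have h2 := floor_le w.
have : Num.floor (2 * u) < 2 * Num.floor w.
  by rewrite floor_lt_int intrM; lra.
rewrite e floor_lt_int intrM; lra.
Qed.

Lemma same_cubeS k x y : same_cube k.+1 x y -> same_cube k x y.
Proof.
move=> /same_cubeP h; apply/same_cubeP => i; apply: floor2_inj.
have := h i; rewrite /index /side.
have E z : 2 * ((rcoord z i - o i) / (rho / 2 ^+ k)) = (rcoord z i - o i) / (rho / 2 ^+ k.+1).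
  rewrite exprS; field; rewrite expf_neq0//= gt_eqF//.
by rewrite !E.
Qed.

Lemma measurable_floor : measurable_fun [set: R] (fun x : R => (Num.floor x)%:~R : R).
Proof.
apply: nondecreasing_measurable => // x y xy.
by rewrite ler_int; exact: le_floor.
Qed.

Lemma measurable_same_cube k : measurable [set z : Rn * Rn | same_cube k z.1 z.2].
Proof.
rewrite (_ : [set z | _] = \bigcap_(i in [set: 'I_n])
    [set z : Rn * Rn | (index k z.1 i)%:~R == (index k z.2 i)%:~R :> R]).
  apply: fin_bigcap_measurable => // i _.
  have mi : measurable_fun [set: Rn] (fun x => (index k x i)%:~R : R).
    apply: (measurableT_comp measurable_floor).
    exact: (measurable_funM (measurable_funB (@measurable_rcoord R n i)
      (measurable_cst (o i))) (measurable_cst (side k)^-1)).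
  have : measurable_fun [set: Rn * Rn]
      (fun z => (index k z.1 i)%:~R == (index k z.2 i)%:~R :> R).
    exact: (measurable_fun_eqr (measurableT_comp mi measurable_fst)
      (measurableT_comp mi measurable_snd)).
  by move=> /(_ measurableT [set true] I); rewrite setTI.
apply/seteqP; split => z.
  by move=> /same_cubeP h i _ /=; rewrite h.
by move=> h; apply/same_cubeP => i; have := h i I; rewrite /= eqr_int => /eqP.
Qed.

Definition corner k (x : Rn) i : R := o i + (index k x i)%:~R * side k.

Lemma same_cubeE k x :
  [set y | same_cube k x y] = cobox (corner k x) (fun i => corner k x i + side k).
Proof.
have s0 := side_gt0 k.
have E y i : (index k x i = index k y i) <-> corner k x i <= rcoord y i < corner k x i + side k.
  rewrite /corner; set m := index k x i; rewrite /index.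
  split => [->|].
    have /andP[h1 h2] := floor_itv ((rcoord y i - o i) / side k).
    rewrite ler_pdivlMr// in h1; rewrite ltr_pdivrMr// intrD mulrDl mul1r in h2.
    by apply/andP; split; lra.
  move=> /andP[h1 h2]; apply/esym/floor_def.
  by rewrite ler_pdivlMr// ltr_pdivrMr// intrD mulrDl mul1r; apply/andP; split; lra.
by apply/seteqP; split => y /=; [move=> /same_cubeP h i; exact/E|
  move=> h; apply/same_cubeP => i; exact/E].
Qed.

Lemma measure_same_cube k x :
  lebesgue [set y | same_cube k x y] = (rho ^+ n * (2 ^- n) ^+ k)%:E.
Proof.
rewrite same_cubeE lebesgue_cobox; last by move=> i; rewrite lerDl ltW// side_gt0.
under eq_bigr do rewrite addrAC subrr add0r.
rewrite prodr_const card_ord /side expr_div_n; congr (_ * _)%:E.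
by rewrite exprVn -!exprM mulnC.
Qed.

Lemma pow2n_lt1 : 0 < (2 ^- n : R) < 1.
Proof.
have h : (0 : R) < 2 ^+ n by rewrite exprn_gt0.
by rewrite invr_gt0 h/= invf_lt1// exprn_egt1 ?ltr1n// lt0n_neq0.
Qed.

Definition cube_grid : grid (@lebesgue R n) (2 ^- n) :=
  Grid pow2n_lt1 same_cube_refl same_cube_sym same_cube_trans same_cubeS
    measurable_same_cube (exprn_gt0 n rho_gt0) measure_same_cube.

End cube_grid.

Section cube_grid_density.
Context (R : realType) (n : nat) (o : 'I_n -> R) (rho : R).
Context (n_gt0 : (0 < n)%N) (rho_gt0 : 0 < rho).
Local Notation G := (cube_grid o n_gt0 rho_gt0).
Context (k : nat) (x : Rn R n).
Local Notation P := (cell G k x).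
Local Notation approx := (approximable G P).
Local Notation mu := (@lebesgue R n).

Let mP : measurable P. Proof. exact: measurable_cell. Qed.
Let Poo : (mu P < +oo)%E. Proof. by rewrite [X in (X < _)%E](measure_cell G k x) ltry. Qed.

Lemma approximableI A B : approx A -> approx B -> approx (A `&` B).
Proof.
move=> aA aB; rewrite -[A `&` B]setCK setCI.
by apply: approximableC; apply: approximableU; try exact: mP; exact: approximableC.
Qed.

Lemma side_small (e : R) : 0 < e -> exists N, side rho N <= e.
Proof.
move=> e0; exists (Num.bound (rho / e)).
have re0 : 0 <= rho / e by rewrite divr_ge0 ?ltW.
rewrite /side ler_pdivrMr ?exprn_gt0// mulrC -ler_pdivrMr//.
apply: (le_trans (ltW (archi_boundP re0))); rewrite -natrX ler_nat.
exact/ltnW/ltn_expl.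
Qed.

(** Cells of generation N reproduce the half-space up to a slab one cell thick. Inside P the slab
    has measure at most [side rho N] times the product [c0] of the other sides of P. *)
Lemma approximable_halfspace i (c : R) : approx [set y | rcoord y i <= c].
Proof.
have mr N : measurable [set y : Rn R n | index o rho N y i <= Num.floor ((c - o i) / side rho N)].
  have mi : measurable_fun [set: Rn R n] (fun y => (index o rho N y i)%:~R : R).
    apply: (measurableT_comp (@measurable_floor R)).
    exact: (measurable_funM (measurable_funB (@measurable_rcoord R n i)
      (measurable_cst (o i))) (measurable_cst (side rho N)^-1)).
  have := measurable_fun_ler mi (measurable_cst ((Num.floor ((c - o i) / side rho N))%:~R : R)).
  move=> /(_ measurableT [set true] I); rewrite setTI; congr (measurable _).
  by apply/seteqP; split => y /=; rewrite ler_int.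
have mA : measurable [set y : Rn R n | rcoord y i <= c].
  have := measurable_fun_ler (@measurable_rcoord R n i) (measurable_cst c).
  by move=> /(_ measurableT [set true] I); rewrite setTI.
split=> // e e0.
pose c0 : R := \prod_(j < n | j != i) side rho k.
have c00 : 0 < c0 by apply: prodr_gt0 => j _; exact: side_gt0.
have [N hN] := side_small (divr_gt0 e0 c00).
have sN := side_gt0 rho_gt0 N; have sk := side_gt0 rho_gt0 k.
exists N, [set y | index o rho N y i <= Num.floor ((c - o i) / side rho N)]; split=> //.
  by move=> y z /same_cubeP /(_ i) yz /=; rewrite yz.
pose m := Num.floor ((c - o i) / side rho N).
pose a j := if j == i then o i + m%:~R * side rho N else corner o rho k x j.
pose b j := a j + (if j == i then side rho N else side rho k).
have ab j : a j <= b j by rewrite lerDl; case: ifP => _; exact: ltW.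
apply: (@le_trans _ _ (mu (cobox a b))).
  apply: le_measure; rewrite ?inE.
  - by apply: measurableI => //; exact: measurable_symdiff.
  - exact: measurable_cobox.
  - move=> y [Py AS].
    have Py' : cobox (corner o rho k x) (fun i => corner o rho k x i + side rho k) y.
      by rewrite -(same_cubeE o rho_gt0).
    have ym : index o rho N y i = m.
      case: AS => [[/= yc /negP]|[/= ym /negP]].
        rewrite -ltNge => my; exfalso; move: my; apply/negP; rewrite -leNgt.
        by apply: le_floor; rewrite ler_pM2r ?invr_gt0// lerB.
      rewrite -ltNge => cy; apply/eqP; rewrite eq_le ym/=.
      by apply: le_floor; rewrite ler_pM2r ?invr_gt0// lerB// ltW.
    move=> j; rewrite /b /a; have [->|ji] := eqVneq j i; last exact: Py'.
    have /andP[h1 h2] := floor_itv ((rcoord y i - o i) / side rho N).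
    rewrite -/(index o rho N y i) ym in h1 h2.
    rewrite ler_pdivlMr// in h1; rewrite ltr_pdivrMr// intrD mulrDl mul1r in h2.
    by apply/andP; split; lra.
rewrite lebesgue_cobox// (bigD1 i)//= /b eqxx addrAC subrr add0r.
rewrite (eq_bigr (fun=> side rho k)); last first.
  by move=> j /negPf ->; rewrite addrAC subrr add0r.
by rewrite lee_fin -/c0 -ler_pdivlMr.
Qed.

Lemma approximable_rcoord i (Y : set (measurableTypeR R)) : measurable Y ->
  approx ((fun y => rcoord y i) @^-1` Y).
Proof.
move: Y; apply: smallest_sub => [|Y /= [[a b] _ <-]].
  split => /=.
  - by rewrite preimage_set0; exact: approximable0.
  - by move=> A aA; rewrite setTD preimage_setC; exact: approximableC.
  - by move=> A aA; rewrite preimage_bigcup; apply: approximable_bigcup.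
rewrite (_ : _ @^-1` _ = [set y | rcoord y i <= b] `&` ~` [set y | rcoord y i <= a]).
  apply: approximableI; last apply: approximableC; exact: approximable_halfspace.
apply/seteqP; split => y /=; rewrite in_itv/=.
  by move=> /andP[ay yb]; split=> //; apply/negP; rewrite -ltNge.
by move=> [yb /negP]; rewrite -ltNge => ->.
Qed.

Lemma approximable_borel (A : set (n.-tuple (measurableTypeR R))) :
  measurable A -> approx A.
Proof.
move: A; apply: smallest_sub; first exact: sigma_algebra_approximable.
move=> A; rewrite -bigcup_seq/= => -[j _ [Y mY <-]].
rewrite setTI; exact: (approximable_rcoord _ mY).
Qed.

(* A Lebesgue set meets a cell in a set that a Borel set exceeds by an
   arbitrarily small amount, by definition of the outer measure. *)
Lemma approximable_measurable A : measurable A -> approx A.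
Proof.
move=> mA; apply: approximable_of_approx; [exact: mP|exact: mA|] => e e0.
pose mu' := ((@borel_lebesgue R n : set _ -> \bar R)^*)%mu.
have mPA : measurable (A `&` P) by exact: measurableI.
have fPA : mu' (A `&` P) \is a fin_num.
  rewrite -[mu' _]/(mu _) ge0_fin_numE//; apply: le_lt_trans Poo.
  by apply: le_measure; rewrite ?inE.
have [_ [F [mF AF] <-] lt_e] := lb_ereal_inf_adherent e0 fPA.
have mF' j : measurable (F j : set (Rn R n)) by exact: measurable_borel.
pose B : set (Rn R n) := \bigcup_j F j.
have mB : measurable B by exact: bigcup_measurable.
exists B.
  rewrite /B; apply: approximable_bigcup; [exact: mP|exact: Poo|move=> j; exact: approximable_borel].
have muB : (mu B <= mu (A `&` P) + e%:E)%E.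
  apply: le_trans (ltW lt_e); apply: le_trans (measure_sigma_subadditive mu mF' mB _) _ => //.
  rewrite le_eqVlt; apply/orP; left; apply/eqP; apply: eq_eseriesr => j _.
  exact: lebesgue_borel.
have mBA : measurable (B `\` (A `&` P)) by exact: (measurableD mB mPA).
apply: (@le_trans _ _ (mu (B `\` (A `&` P)))).
  apply: le_measure; rewrite ?inE//.
    by apply: measurableI => //; exact: measurable_symdiff.
  move=> y [Py [[Ay nBy]|[By nAy]]]; last by split=> // -[].
  by exfalso; apply: nBy; exact: AF.
have fmu : mu (A `&` P) \is a fin_num by exact: fPA.
have BAP : B `&` (A `&` P) = A `&` P.
  by apply/seteqP; split=> y; [case|move=> APy; split=> //; exact: AF].
move: muB; rewrite (measureDI mu mB mPA) BAP addeC leeD2lE//.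
Qed.

End cube_grid_density.

(** * Mean oscillation on cubes and on their grids *)

Section mean_oscillation.
Context d (T : measurableType d) (R : realType) (mu : {measure set T -> \bar R}).
Context (D : set T) (m : R).
Hypotheses (mD : measurable D) (m_gt0 : 0 < m) (muD : mu D = m%:E).
Implicit Types b : T -> R.
Local Notation mean b := (m^-1 * \int[mu]_(x in D) b x).

Lemma integrable_cst_on c : mu.-integrable D (EFin \o cst c).
Proof.
apply/integrableP; split; first by apply/measurable_EFinP; exact: measurable_cst.
by rewrite /= integral_cst// muD -EFinM ltry.
Qed.

Lemma integrable_subc b c : mu.-integrable D (EFin \o b) ->
  mu.-integrable D (EFin \o (fun y => b y - c)).
Proof.
move=> ib; rewrite (_ : EFin \o _ = (EFin \o b) \- (EFin \o cst c))%E.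
  exact: (integrableB mD ib (integrable_cst_on c)).
by apply/funext => y.
Qed.

Lemma mean_sub_le b c A : mu.-integrable D (EFin \o b) ->
  (\int[mu]_(y in D) (`|b y - c|)%:E <= A%:E)%E -> `|mean b - c| * m <= A.
Proof.
move=> ib; have ibc := integrable_subc c ib => h.
rewrite -[X in _ * X](gtr0_norm m_gt0) -normrM mulrBl mulrAC mulVf ?gt_eqF// mul1r.
have -> : c * m = \int[mu]_(y in D) c by rewrite Rintegral_cst// muD.
rewrite -(RintegralB mD ib (integrable_cst_on c)) -lee_fin; apply: le_trans h.
by rewrite EFin_normr_Rintegral//; apply: (le_abse_integral mu mD); case/integrableP: ibc.
Qed.

(** The mean is within A / m of any such constant c, so taking it in place of c at most doubles the
    bound. *)
Lemma mean_osc_le b c A : mu.-integrable D (EFin \o b) ->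
  (\int[mu]_(y in D) (`|b y - c|)%:E <= A%:E)%E ->
  (\int[mu]_(y in D) (`|b y - mean b|)%:E <= (2 * A)%:E)%E.
Proof.
move=> ib h; have := mean_sub_le ib h; set k := mean b => hk.
have mb : measurable_fun D b by case/integrableP : ib => /measurable_EFinP.
have mN e : measurable_fun D (fun y => (`|b y - e|)%:E).
  apply/measurable_EFinP; apply: measurableT_comp => //.
  exact: (measurable_funB mb (measurable_cst e)).
apply: (@le_trans _ _ (\int[mu]_(y in D) ((`|b y - c|)%:E + (`|k - c|)%:E))%E).
  apply: ge0_le_integral => //.
  - apply: emeasurable_funD; [exact: mN|exact: measurable_cst].
  - move=> y _; rewrite -EFinD lee_fin [`|k - c|]distrC.
    by rewrite (_ : b y - k = (b y - c) + (c - k)) ?ler_normD//; ring.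
rewrite ge0_integralD//.
rewrite integral_cst// muD -EFinM (_ : 2 * A = A + A) ?EFinD; last by ring.
by rewrite leeD// lee_fin.
Qed.

End mean_oscillation.

Section bmo.
Context (R : realType) (n : nat).
Local Notation mu := (@lebesgue R n).
Implicit Types b : Rn R n -> R.

Definition vec (f : 'I_n -> R) : Rn R n := [tuple f i | i < n].

Lemma rcoord_vec f i : rcoord (vec f) i = f i.
Proof. by rewrite /rcoord tnth_mktuple. Qed.

Lemma int_cube_loc_integrable b a r : loc_integrable b ->
  (\int[mu]_(x in cube a r) (`|b x|)%:E < +oo)%E.
Proof.
move=> [_]; apply.
rewrite (_ : [set _ | x in _] = [set v : 'rV[R]_n |
    forall i, `[rcoord a i, rcoord a i + r]%classic (v ord0 i)]).
  apply: (@rV_compact R n (fun i => `[rcoord a i, rcoord a i + r]%classic)) => i; exact: segment_compact.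
apply/seteqP; split => v.
  by move=> [x xa <-] i; rewrite mxE /= in_itv/=; exact: xa.
move=> va; exists (vec (v ord0)).
  by move=> i; rewrite rcoord_vec; have := va i; rewrite /= in_itv.
by apply/rowP => i; rewrite mxE rcoord_vec.
Qed.

Lemma integrable_cube b a r : loc_integrable b ->
  mu.-integrable (cube a r) (EFin \o b).
Proof.
move=> lb; apply/integrableP; split; last exact: int_cube_loc_integrable.
by apply/measurable_EFinP; apply: measurable_funTS; case: lb.
Qed.

Lemma averageE b a r : 0 < r ->
  average b (cube a r) = (r ^+ n)^-1 * \int[mu]_(x in cube a r) b x.
Proof. by move=> r0; rewrite /average lebesgue_cube. Qed.

Lemma bmo_bound b : BMO b -> exists2 B, 0 < B & forall a r, 0 < r ->
  (\int[mu]_(x in cube a r) (`|b x - average b (cube a r)|)%:E <= (B * r ^+ n)%:E)%E.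
Proof.
move=> [lb boo]; exists (`|fine (bmo_norm b)| + 1); first by rewrite ltr_wpDl.
move=> a r r0; have rn0 : 0 < r ^+ n by rewrite exprn_gt0.
set I := (\int[mu]_(x in _) _)%E.
have : ((r ^+ n)^-1%:E * I <= bmo_norm b)%E.
  apply: ereal_sup_ubound; exists (cube a r); first by exists a, r.
  by rewrite lebesgue_cube// inver gt_eqF.
move=> h; rewrite mulrC EFinM -lee_pdivrMl//; apply: (le_trans h).
case: (bmo_norm b) boo => [c _|//|_]; last by rewrite leNye.
by rewrite lee_fin/= ler_wpDr// ler_norm.
Qed.

End bmo.

Lemma measurable_abs_sub d (T : measurableType d) (R : realType) (b : T -> R) c :
  measurable_fun [set: T] b -> measurable_fun [set: T] (fun y => `|b y - c|).
Proof.
move=> mb; exact: (measurableT_comp (@normr_measurable R setT)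
  (measurable_funB mb (measurable_cst c))).
Qed.

Lemma le_of_eq d (T : porderType d) (x y : T) : x = y -> (x <= y)%O.
Proof. by move=> ->. Qed.

Section bmo_cubes.
Context (R : realType) (n : nat) (n_gt0 : (0 < n)%N).
Local Notation mu := (@lebesgue R n).
Context (b : Rn R n -> R) (B : R).
Hypotheses (lb : loc_integrable b) (B_gt0 : 0 < B).
Hypothesis osc_b : forall a r, 0 < r ->
  (\int[mu]_(x in cube a r) (`|b x - average b (cube a r)|)%:E <= (B * r ^+ n)%:E)%E.

Section grid.
Context (o : 'I_n -> R) (rho : R) (rho_gt0 : 0 < rho).
Local Notation G := (cube_grid o n_gt0 rho_gt0).

Lemma vol_cube_grid k : vol G k = side rho k ^+ n.
Proof. by rewrite /vol /= /side expr_div_n exprVn -!exprM mulnC. Qed.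

Lemma sub_cell_cube k x : cell G k x `<=` cube (vec (corner o rho k x)) (side rho k).
Proof.
rewrite [cell G k x](same_cubeE o rho_gt0) => y h i; rewrite rcoord_vec.
by have /andP[h1 /ltW h2] := h i; rewrite h1.
Qed.

Lemma locint_cube_grid : locint G b.
Proof.
split; first by case: lb.
move=> k x; apply: (integrableS _ _ (@sub_cell_cube k x)); first exact: measurable_cube.
  exact: measurable_cell.
exact: integrable_cube.
Qed.

(** A half-open cell lies in a closed cube of the same side; passing from the average over the cube
    to the average over the cell costs the factor 2 of [mean_osc_le]. *)
Lemma grid_bmo_cube_grid : grid_bmo G (2 * B) b.
Proof.
have lG := locint_cube_grid.
split => //.
  move=> k x; have v0 := vol_gt0 G k.
  rewrite -(ler_pM2r v0) -lee_fin -EFin_avg; last first.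
    by apply: locint_norm; apply: locintB => //; exact: locint_cst.
  rewrite -mulrA vol_cube_grid.
  have s0 := side_gt0 rho_gt0 k.
  apply: (@mean_osc_le _ _ _ mu (cell G k x) (vol G k) (measurable_cell G k x) v0
    (measure_cell G k x) b (average b (cube (vec (corner o rho k x)) (side rho k)))).
    exact: lG.2.
  apply: le_trans (osc_b (vec (corner o rho k x)) s0).
  apply: ge0_subset_integral; [exact: measurable_cell|exact: measurable_cube| |by []|exact: sub_cell_cube].
  apply/measurable_EFinP/measurable_funTS.
  by apply: measurable_abs_sub; exact: lb.1.
move=> k x e e0; apply: grid_dense => //.
by move=> A mA; exact: approximable_measurable.
Qed.

End grid.

Lemma measurable_osc (D : set (Rn R n)) c sigma :
  measurable_fun D (fun y => (`|b y - c| `^ sigma)%:E).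
Proof.
apply: measurable_EFin_powR; apply: measurable_funTS.
by apply: measurable_abs_sub; exact: lb.1.
Qed.

(** A closed cube is not a cell. It is contained in a cell with the same lower corner and twice the
    side, in a grid built for that cube; this costs the ratio 2^n of the volumes, and the averages
    over the cube and over the cell differ by a bounded amount. *)
Lemma john_nirenberg_cube sigma : 0 <= sigma -> exists2 C, 0 < C & forall a r, 0 < r ->
  (\int[mu]_(y in cube a r) (`|b y - average b (cube a r)| `^ sigma)%:E <= (C * r ^+ n)%:E)%E.
Proof.
move=> s0.
set K := jn_powR_const (2 ^- n : R) (2 * B) sigma.
have K0 : 0 < K by apply: (jn_powR_const_gt0 (cube_grid (fun=> 0 : R) n_gt0 ltr01)); rewrite ?mulr_gt0.
set L : R := (jn_powR_const (2 ^- n : R) (2 * B) 1 * 2 ^+ n) `^ sigma.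
pose C : R := 2 `^ sigma * (L + K * 2 ^+ n).
have L0 : 0 <= L by exact: powR_ge0.
have KL0 : 0 < L + K * 2 ^+ n by rewrite ltr_wpDl// mulr_gt0// exprn_gt0.
exists C; first by rewrite mulr_gt0// powR_gt0.
move=> a r r0; have r20 : 0 < 2 * r by rewrite mulr_gt0.
have rn0 : 0 < r ^+ n by rewrite exprn_gt0.
pose G := cube_grid (rcoord a) n_gt0 r20.
have bG : grid_bmo G (2 * B) b by exact: grid_bmo_cube_grid.
have sub : cube a r `<=` cell G 0 a.
  rewrite [cell G 0 a](same_cubeE _ r20) => y h i.
  have -> : corner (rcoord a) (2 * r) 0 a i = rcoord a i.
    by rewrite /corner /index subrr mul0r floor0 mul0r addr0.
  by rewrite /side expr0 divr1; have := h i; lra.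
have v : vol G 0 = 2 ^+ n * r ^+ n by rewrite vol_cube_grid /side expr0 divr1 exprMn.
set c := average b (cube a r); set c' := avg G 0 b a.
have mc := measurable_cube a r; have mcell := measurable_cell G 0 a.
have mb : measurable_fun [set: Rn R n] b by exact: lb.1.
have B20 : 0 < 2 * B by rewrite mulr_gt0.
have mY := measurable_abs_sub c' mb.
have Y0 y : 0 <= `|b y - c'| by exact: normr_ge0.
have J t : 0 <= t -> (\int[mu]_(y in cube a r) (`|b y - c'| `^ t)%:E <=
    (jn_powR_const (2 ^- n : R) (2 * B) t * (2 ^+ n * r ^+ n))%:E)%E.
  move=> t0; rewrite -v; apply: le_trans (john_nirenberg_powR 0 a B20 t0 bG).
  apply: (@le_trans _ _ (\int[mu]_(y in cell G 0 a) (`|b y - c'| `^ t)%:E)%E).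
    apply: (ge0_subset_integral mu mc mcell _ _ sub).
    - exact: measurable_funTS (measurable_EFin_powR t mY).
    - by move=> y _; rewrite lee_fin powR_ge0.
  apply: le_of_eq; apply: eq_integral => y.
  by rewrite in_cell => ay; rewrite /c' (avg_cellwise b ay).
have cc' : `|c - c'| <= jn_powR_const (2 ^- n : R) (2 * B) 1 * 2 ^+ n.
  rewrite -(ler_pM2r rn0) -mulrA /c averageE//.
  apply: (@mean_sub_le _ _ _ mu (cube a r) _ mc rn0 (lebesgue_cube a r0) b).
    exact: integrable_cube.
  apply: le_trans (J 1 ler01).
  apply: le_of_eq; apply: eq_integral => y _.
  by rewrite powRr1.
clearbody c c'; have X0 : 0 <= `|c - c'| by exact: normr_ge0.
apply: (@le_trans _ _ (\int[mu]_(y in cube a r) ((`|c - c'| + `|b y - c'|) `^ sigma)%:E)%E).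
  apply: (ge0_le_integral mu mc).
  - by move=> y _; rewrite lee_fin powR_ge0.
  - exact: measurable_osc.
  - apply: measurable_EFin_powR; apply: measurable_funTS.
    exact: (measurable_funD (measurable_cst _) mY).
  - move=> y _; rewrite lee_fin ge0_ler_powR ?nnegrE ?addr_ge0//.
    by rewrite (_ : b y - c = (b y - c') - (c - c')) ?(le_trans (ler_normB _ _)) 1?addrC//; ring.
apply: (le_trans (@int_powRD_le _ _ _ mu _ _ _ _ mc mY X0 Y0 s0)).
rewrite [X in (_ * (_ * X + _))%E](lebesgue_cube a r0) /C -mulrA EFinM; apply: lee_wpmul2l.
  by rewrite lee_fin powR_ge0.
rewrite mulrDl EFinD -EFinM; apply: leeD.
  by rewrite lee_fin ler_pM2r// ge0_ler_powR// nnegrE (le_trans X0).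
by rewrite -mulrA; exact: J.
Qed.

End bmo_cubes.

(** * Sufficiency of BMO *)

Section product.
Context d1 d2 (T1 : measurableType d1) (T2 : measurableType d2) (R : realType).
Context (m1 : {sigma_finite_measure set T1 -> \bar R}).
Context (m2 : {sigma_finite_measure set T2 -> \bar R}).

Lemma integral_prod_mul (g : T1 -> R) (h : T2 -> R) :
  measurable_fun [set: T1] g -> measurable_fun [set: T2] h ->
  (forall x, 0 <= g x) -> (forall y, 0 <= h y) ->
  (\int[m1 \x m2]_z (g z.1 * h z.2)%:E =
   (\int[m1]_x (g x)%:E) * (\int[m2]_y (h y)%:E))%E.
Proof.
move=> mg mh g0 h0.
have mgh : measurable_fun [set: T1 * T2] (fun z => (g z.1 * h z.2)%:E).
  apply/measurable_EFinP; exact: (measurable_funM (measurableT_comp mg measurable_fst)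
    (measurableT_comp mh measurable_snd)).
have gh0 (z : T1 * T2) : (0 <= (g z.1 * h z.2)%:E)%E by rewrite lee_fin mulr_ge0.
rewrite (fubini_tonelli1 _ mgh gh0).
have I0 : (0 <= \int[m2]_y (h y)%:E)%E by apply: integral_ge0 => y _; rewrite lee_fin.
rewrite -(@ge0_integralZr _ _ _ m1 setT measurableT (EFin \o g)) //; last 2 first.
- exact/measurable_EFinP.
- by move=> x _; rewrite /= lee_fin.
apply: eq_integral => x _; rewrite /fubini_F /=.
rewrite -(@ge0_integralZl _ _ _ m2 setT measurableT (EFin \o h)) //.
- exact/measurable_EFinP.
- by move=> y _; rewrite /= lee_fin.
- by rewrite lee_fin.
Qed.

End product.

Section series.
Context d (T : measurableType d) (R : realType) (mu : {measure set T -> \bar R}).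

(** The index may vary with the point without any measurable choice, because the sum of all the
    [phi k] dominates f everywhere. *)
Lemma le_integral_nneseries (f : T -> \bar R) (phi : nat -> T -> \bar R) :
  measurable_fun [set: T] f -> (forall k, measurable_fun [set: T] (phi k)) ->
  (forall x, 0 <= f x)%E -> (forall k x, 0 <= phi k x)%E ->
  (forall x, exists k, (f x <= phi k x)%E) ->
  (\int[mu]_x f x <= \sum_(k <oo) \int[mu]_x phi k x)%E.
Proof.
move=> mf mphi f0 phi0 h.
rewrite -integral_nneseries//; apply: ge0_le_integral => //.
- by apply: ge0_emeasurable_sum.
- move=> x _; have [k hk] := h x; apply: (le_trans hk).
  apply: le_trans (@nneseries_lim_ge R (fun k => phi k x) xpredT 0%N k.+1 _) => //.
  by rewrite big_nat_recr//= leeDr// sume_ge0.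
Qed.

Context (D : set T) (Z : nat -> T -> R) (q C : R).
Hypotheses (mD : measurable D) (q_gt0 : 0 < q).
Hypothesis mZ : forall k, measurable_fun [set: T] (Z k).
Hypothesis Z_ge0 : forall k x, 0 <= Z k x.
Hypothesis Zle : forall N, (\int[mu]_(x in D) ((\sum_(k < N) Z k x) `^ q)%:E <= C%:E)%E.

Let g N x := ((\sum_(k < N) Z k x) `^ q)%:E.
Let s_ge0 N x : 0 <= \sum_(k < N) Z k x. Proof. exact: sumr_ge0. Qed.

Let nd_g x : {homo g ^~ x : a b / (a <= b)%N >-> (a <= b)%E}.
Proof.
move=> a b ab; rewrite /g lee_fin; apply: ge0_ler_powR; rewrite ?nnegrE ?(ltW q_gt0)//.
by rewrite -(subnKC ab) big_split_ord/= lerDl sumr_ge0.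
Qed.

Let cvg_g x : cvgn (g ^~ x).
Proof. by apply: ereal_nondecreasing_is_cvgn => a b; exact: nd_g. Qed.

Let mg N : measurable_fun [set: T] (g N).
Proof. by apply: measurable_EFin_powR; apply: measurable_sum. Qed.

Let mlim : measurable_fun [set: T] (fun x => limn (g ^~ x)).
Proof. by apply: emeasurable_fun_cvg => [N|x _]; [exact: mg|exact: cvg_g]. Qed.

Let int_lim : (\int[mu]_(x in D) limn (g ^~ x) <= C%:E)%E.
Proof.
rewrite monotone_convergence//.
- apply: lime_le; last by apply: nearW => N; exact: Zle.
  apply: ereal_nondecreasing_is_cvgn => a b ab; apply: (ge0_le_integral mu mD).
  + by move=> x _; rewrite lee_fin powR_ge0.
  + exact: measurable_funTS.
  + exact: measurable_funTS.
  + by move=> x _; exact: nd_g.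
- by move=> N; exact: measurable_funTS.
- by move=> N x _; rewrite lee_fin powR_ge0.
Qed.

Let le_lim N x : (g N x <= limn (g ^~ x))%E.
Proof.
have /cvg_lim -> // : g ^~ x @ \oo --> ereal_sup (range (g ^~ x)).
  by apply: ereal_nondecreasing_cvgn => a b; exact: nd_g.
by apply: ereal_sup_ubound; exists N.
Qed.

Let series_le x c : limn (g ^~ x) = c%:E -> (\sum_(k <oo) (Z k x)%:E <= (c `^ q^-1)%:E)%E.
Proof.
move=> e; apply: lime_le; first by apply: is_cvg_nneseries => k _ _; rewrite lee_fin.
apply: nearW => N; rewrite big_mkord sumEFin lee_fin.
have := le_lim N x; rewrite e lee_fin => h.
have q0 : q != 0 by rewrite gt_eqF.
rewrite -[leLHS]powRr1// -(mulfV q0) powRrM.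
apply: ge0_ler_powR; rewrite ?nnegrE ?powR_ge0 ?invr_ge0 ?(ltW q_gt0)//.
exact: le_trans (powR_ge0 _ _) h.
Qed.

(** Monotone convergence for the q-th powers of the partial sums. Where their limit is infinite
    there is nothing to prove; elsewhere the series is at most its q-th root. *)
Lemma int_powR_le_series (u : T -> R) : measurable_fun [set: T] u ->
  (forall x, 0 <= u x) ->
  (forall x, D x -> ((u x)%:E <= \sum_(k <oo) (Z k x)%:E)%E) ->
  (\int[mu]_(x in D) (u x `^ q)%:E <= C%:E)%E.
Proof.
move=> mu_ u0 h; apply: le_trans int_lim; apply: (ge0_le_integral mu mD).
- by move=> x _; rewrite lee_fin powR_ge0.
- exact/measurable_funTS/measurable_EFin_powR.
- by apply: measurable_funTS.
move=> x Dx; case e : (limn (g ^~ x)) => [c| |]; last 2 first.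
- exact: leey.
- by have := le_lim 0 x; rewrite e leeNy_eq.
have := le_trans (h x Dx) (series_le e); rewrite lee_fin => ux.
have c0 : 0 <= c by rewrite -lee_fin -e (le_trans _ (le_lim 0 x))// lee_fin powR_ge0.
have q0 : q != 0 by rewrite gt_eqF.
rewrite lee_fin -[leRHS]powRr1// -(mulVf q0) powRrM.
by apply: ge0_ler_powR; rewrite ?nnegrE ?powR_ge0 ?(ltW q_gt0).
Qed.

Lemma ae_series_lty : {ae mu, forall x, D x -> (\sum_(k <oo) (Z k x)%:E < +oo)%E}.
Proof.
have ml : measurable_fun D (fun x => limn (g ^~ x)) by apply: measurable_funTS.
have l0 x : (0 <= limn (g ^~ x))%E.
  by rewrite (le_trans _ (le_lim 0 x))// lee_fin powR_ge0.
have il : mu.-integrable D (fun x => limn (g ^~ x)).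
  apply/integrableP; split => //.
  under eq_integral do rewrite gee0_abs//.
  exact: le_lt_trans int_lim (ltry _).
have := integrable_ae mD il; apply: filterS => x /= h Dx.
have := h Dx; case e : (limn (g ^~ x)) => [c| |]// _.
exact: le_lt_trans (series_le e) (ltry _).
Qed.

End series.

(** * Shifted grids and the kernel *)

Section shifts.
Context (R : realType).
Implicit Types x y z : R.

Lemma near_int_of_floor x y : `|x - y| < 6^-1 -> Num.floor x != Num.floor y ->
  exists g : int, `|x - g%:~R| < 6^-1.
Proof.
rewrite ltr_norml => /andP[h1 h2].
have /andP[x1 x2] := floor_itv x; have /andP[y1 y2] := floor_itv y.
rewrite neq_lt => /orP[] h; [exists (Num.floor y)|exists (Num.floor x)].
  have : (Num.floor x)%:~R + 1 <= (Num.floor y)%:~R :> R by rewrite -[1]/(1%:~R) -intrD ler_int; lia.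
  by move: x2; rewrite intrD => x2 h3; rewrite ltr_norml; apply/andP; split; lra.
have : (Num.floor y)%:~R + 1 <= (Num.floor x)%:~R :> R by rewrite -[1]/(1%:~R) -intrD ler_int; lia.
by move: y2; rewrite intrD => y2 h3; rewrite ltr_norml; apply/andP; split; lra.
Qed.

Lemma pow2_mod3 k : exists h : nat,
  (2 ^+ k = 3 * h%:R + 1 :> R) \/ (2 ^+ k = 3 * h%:R + 2 :> R).
Proof.
elim: k => [|k [h [IH|IH]]]; first by exists 0%N; left; rewrite expr0; ring.
  by exists (2 * h)%N; right; rewrite exprS IH natrM; ring.
by exists (2 * h + 1)%N; left; rewrite exprS IH natrD natrM; ring.
Qed.

(* A third of a power of two stays away from the integers, so the two subdivisions
   cannot both have an endpoint near [x]. *)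
Lemma floor_shift k x y z : `|x - y| < 6^-1 -> `|x - z| < 6^-1 ->
  (Num.floor x = Num.floor y /\ Num.floor x = Num.floor z) \/
  (Num.floor (x - 2 ^+ k / 3) = Num.floor (y - 2 ^+ k / 3) /\
   Num.floor (x - 2 ^+ k / 3) = Num.floor (z - 2 ^+ k / 3)).
Proof.
move=> xy xz.
have [|] := boolP ((Num.floor x == Num.floor y) && (Num.floor x == Num.floor z)).
  by move=> /andP[/eqP ? /eqP ?]; left.
rewrite negb_and => h; right.
have [g] : exists g : int, `|x - g%:~R| < 6^-1.
  by case/orP: h => h; [exact: near_int_of_floor xy h|exact: near_int_of_floor xz h].
rewrite ltr_norml => /andP[g1 g2].
have [m hm] := pow2_mod3 k.
(* Each of the three points lies within 1/3 of g, and the fractional part of [2 ^+ k / 3] is 1/3 or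
   2/3, so after the shift all of them have the same integer part. *)
have E u : `|x - u| < 6^-1 -> Num.floor (u - 2 ^+ k / 3) = g - m%:Z - 1.
  rewrite ltr_norml => /andP[h1 h2]; apply: floor_def.
  rewrite !intrD !intrN -[(Posz m)%:~R]/(m%:R) -[1%:~R]/1.
  by case: hm => ->; apply/andP; split; lra.
by rewrite !E// subrr normr0.
Qed.

End shifts.

Section kernel.
Context (R : realType) (n : nat) (n_gt0 : (0 < n)%N).
Implicit Types x y z : Rn R n.

(** In units of [side rho k] the translation by [rho / 3] is [2 ^+ k / 3]: one translation realises
    the shift of [floor_shift] at every generation. *)
Definition shift (a : Rn R n) (rho : R) (t : {ffun 'I_n -> bool}) i : R :=
  rcoord a i + (if t i then rho / 3 else 0).

(** The coordinates are treated independently, which is why 2^n grids are used. The shift t depends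
    on the points and on k, so all the shifts are summed later. *)
Lemma shifted_same (a : Rn R n) (rho : R) k x y z : 0 < rho ->
  (forall i, `|rcoord x i - rcoord y i| < side rho k / 6) ->
  (forall i, `|rcoord x i - rcoord z i| < side rho k / 6) ->
  exists t, same_cube (shift a rho t) rho k x y && same_cube (shift a rho t) rho k x z.
Proof.
move=> rho0 xy xz; have s0 := side_gt0 rho0 k.
pose N (y : Rn R n) i := (rcoord y i - rcoord a i) / side rho k.
pose t := [ffun i => ~~ ((Num.floor (N x i) == Num.floor (N y i)) &&
  (Num.floor (N x i) == Num.floor (N z i)))].
have NB u i : `|rcoord x i - rcoord u i| < side rho k / 6 -> `|N x i - N u i| < 6^-1.
  move=> h; rewrite /N -mulrBl (_ : _ - _ - _ = rcoord x i - rcoord u i); last by ring.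
  by rewrite normrM normfV (gtr0_norm s0) ltr_pdivrMr// mulrC.
have I u i : index (shift a rho t) rho k u i =
    Num.floor (N u i - (if t i then 2 ^+ k / 3 else 0)).
  rewrite /index /shift; congr Num.floor; rewrite /N /side.
  by case: (t i); field; rewrite ?expf_neq0 ?gt_eqF//.
exists t; apply/andP; split; apply/same_cubeP => i; rewrite !I.
  have [h|h] := floor_shift k (NB _ _ (xy i)) (NB _ _ (xz i)); last first.
    by case: ifP => [_|]; [exact: h.1|rewrite ffunE => /negbFE/andP[/eqP e _]; rewrite !subr0].
  by rewrite ffunE -h.1 -h.2 !eqxx/= !subr0; exact: h.1.
have [h|h] := floor_shift k (NB _ _ (xy i)) (NB _ _ (xz i)); last first.
  by case: ifP => [_|]; [exact: h.2|rewrite ffunE => /negbFE/andP[_ /eqP e]; rewrite !subr0].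
by rewrite ffunE -h.1 -h.2 !eqxx/= !subr0; exact: h.2.
Qed.

Lemma powR_le_neg (u v e : R) : 0 < u -> u <= v -> e <= 0 -> v `^ e <= u `^ e.
Proof.
move=> u0 uv e0; have v0 := lt_le_trans u0 uv.
rewrite -[e]opprK !(powRN _ (- e)) lef_pV2 ?posrE ?powR_gt0//.
by rewrite ge0_ler_powR ?nnegrE ?oppr_ge0// ltW.
Qed.

Lemma sqdist_ge0 x y : 0 <= sqdist x y.
Proof. by rewrite /sqdist sumr_ge0// => i _; rewrite sqr_ge0. Qed.

Lemma sqdist_ge x y i : (rcoord x i - rcoord y i) ^+ 2 <= sqdist x y.
Proof. by rewrite /sqdist (bigD1 i)//= lerDl sumr_ge0// => j _; rewrite sqr_ge0. Qed.

Context (alpha : R) (alpha_lt : 0 < alpha < 2 * n%:R).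

(** At x = y = z the value is 0, since a positive power of 0 is 0 and so is the inverse of 0. Upper
    bounds survive there; lower bounds need a separate argument. *)
Definition kernel x y z : R := ((sqdist x y + sqdist x z) `^ (n%:R - alpha / 2))^-1.

Lemma kernel_ge0 x y z : 0 <= kernel x y z.
Proof. by rewrite invr_ge0 powR_ge0. Qed.

Lemma kernel_le x y z i m : 0 < m ->
  m <= `|rcoord x i - rcoord y i| \/ m <= `|rcoord x i - rcoord z i| ->
  kernel x y z <= m `^ (alpha - 2 * n%:R).
Proof.
move=> m0 h; have al := alpha_lt.
have e0 : 0 < n%:R - alpha / 2 by lra.
have m2 : m ^+ 2 <= sqdist x y + sqdist x z.
  have sq u : m <= `|rcoord x i - rcoord u i| -> m ^+ 2 <= sqdist x u.
    move=> hu; apply: le_trans (sqdist_ge x u i).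
    by rewrite -(real_normK (num_real (_ - _))) ler_pXn2r// nnegrE ltW.
  case: h => /sq h; apply: (le_trans h); first by rewrite lerDl sqdist_ge0.
  by rewrite lerDr sqdist_ge0.
have -> : m `^ (alpha - 2 * n%:R) = ((m ^+ 2) `^ (n%:R - alpha / 2))^-1.
  rewrite -powR_mulrn ?(ltW m0)// -powRrM -powRN; congr (_ `^ _); by field.
rewrite /kernel lef_pV2 ?posrE ?powR_gt0 ?exprn_gt0//; last first.
  by rewrite (lt_le_trans _ m2)// exprn_gt0.
rewrite ge0_ler_powR ?nnegrE ?(ltW e0)//; first by rewrite exprn_ge0// ltW.
by rewrite addr_ge0 ?sqdist_ge0.
Qed.

(** The least k with [side rho k / 12 <= m]: as sides halve, its minimality gives the other
    inequality, and for k = 0 the hypothesis on m does. *)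
Lemma scale_exists (rho m : R) : 0 < rho -> 0 < m < rho / 6 ->
  exists k, side rho k / 12 <= m < side rho k / 6.
Proof.
move=> rho0 /andP[m0 mrho].
have ex : exists k, side rho k / 12 <= m.
  have [|N hN] := @side_small R rho rho0 (12 * m); first by rewrite mulr_gt0.
  by exists N; lra.
exists (ex_minn ex); case: ex_minnP => k hk hmin; rewrite hk /=.
case: k hk hmin => [|k] hk hmin; first by rewrite /side expr0 divr1.
rewrite ltNge; apply/negP => h.
have : (k.+1 <= k)%N.
  apply: hmin; move: h; rewrite /side exprS invfM.
  set u := rho * _; set v := rho / _.
  have -> : u = v / 2 by rewrite /u /v; field; rewrite expf_neq0.
  lra.
by rewrite ltnn.
Qed.

(** The largest coordinate distance from x fixes the generation. It is below a sixth of the side, so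
    some shifted grid has the three points in one cell; it is at least a twelfth, whence the
    constant. The bound is written as a power of the volume of the cell, in the form of
    [grid_commutator_bound] with a = alpha / n. *)
Lemma local_kernel_le (a : Rn R n) rho x y z : 0 < rho ->
  (forall i, `|rcoord x i - rcoord y i| < rho / 6) ->
  (forall i, `|rcoord x i - rcoord z i| < rho / 6) ->
  (x = y /\ x = z) \/
  exists k t, [/\ same_cube (shift a rho t) rho k x y,
    same_cube (shift a rho t) rho k x z &
    kernel x y z <= 12 `^ (2 * n%:R - alpha) * (side rho k ^+ n) `^ (alpha / n%:R - 2)].
Proof.
move=> rho0 xy xz; pose i0 : 'I_n := Ordinal n_gt0.
pose F i := Num.max `|rcoord x i - rcoord y i| `|rcoord x i - rcoord z i|.
have [im _ hmax] := @Order.TotalTheory.arg_maxP _ _ _ i0 xpredT F isT.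
have my i : `|rcoord x i - rcoord y i| <= F im.
  by apply: le_trans (hmax i isT); rewrite /F le_max lexx.
have mz i : `|rcoord x i - rcoord z i| <= F im.
  by apply: le_trans (hmax i isT); rewrite /F le_max lexx orbT.
have : 0 <= F im by rewrite (le_trans _ (my im)).
rewrite le_eqVlt => /orP[/eqP m0|m0].
  left; split; apply: eq_from_tnth => i; apply/eqP; rewrite -subr_eq0 -normr_le0.
    by rewrite m0; exact: my.
  by rewrite m0; exact: mz.
right; have [k /andP[k1 k2]] : exists k, side rho k / 12 <= F im < side rho k / 6.
  by apply: scale_exists => //; rewrite m0/= /F gt_max xy xz.
have [t /andP[ty tz]] := @shifted_same a rho k x y z rho0
  (fun i => le_lt_trans (my i) k2) (fun i => le_lt_trans (mz i) k2).
exists k, t; split => //.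
have al := alpha_lt; have s0 := side_gt0 rho0 k.
have n0 : n%:R != 0 :> R by rewrite pnatr_eq0 -lt0n.
have /kernel_le h : F im <= `|rcoord x im - rcoord y im| \/ F im <= `|rcoord x im - rcoord z im|.
  by rewrite /F maxEle; case: ifP => _; [right|left].
apply: (le_trans (h m0)).
have s12 : 0 < side rho k / 12 by rewrite divr_gt0.
apply: (le_trans (powR_le_neg s12 k1 _)); first by lra.
rewrite powRM ?invr_ge0 ?(ltW s0)// mulrC; apply: ler_pM; rewrite ?powR_ge0//.
  by rewrite -powR_inv1// -powRrM mulN1r opprB.
rewrite -powR_mulrn ?(ltW s0)// -powRrM (_ : _ * _ = alpha - 2 * n%:R)//.
by field.
Qed.

End kernel.

(** * Oscillation on the dilates of a cube *)

Section osc_hoelder.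
Context d (T : measurableType d) (R : realType) (mu : {measure set T -> \bar R}).
Context (D : set T) (m : R) (b f : T -> R) (c s s' A F : R).
Hypotheses (mD : measurable D) (m_gt0 : 0 < m) (muD : mu D = m%:E).
Hypotheses (mb : measurable_fun [set: T] b) (mf : measurable_fun [set: T] f).
Hypotheses (f_ge0 : forall x, 0 <= f x) (s_gt0 : 0 < s) (s'_gt1 : 1 < s').
Hypotheses (ss' : s'^-1 + s^-1 = 1) (F_gt0 : 0 < F) (A_gt0 : 0 < A).
Hypothesis bA : (\int[mu]_(y in D) (`|b y - c| `^ s')%:E <= (A * m)%:E)%E.
Hypothesis fF : (\int[mu]_(y in D) (f y `^ s)%:E <= (F `^ s * m)%:E)%E.

(** Counterpart of [cell_osc_le] for the dilates of a cube. Here F is a positive bound from the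
    start, so Hoelder's inequality applies without a limit. *)
Lemma osc_hoelder x : (\int[mu]_(y in D) (`|b x - b y| * f y)%:E <=
  (4 * (`|b x - c| + A `^ s'^-1) * F * m)%:E)%E.
Proof.
have s'0 : 0 < s' by exact: lt_trans s'_gt1.
set X := `|b x - c|; set ka := A `^ s'^-1.
have ka0 : 0 < ka by exact: powR_gt0.
have X0 : 0 <= X by exact: normr_ge0.
have W0 : 0 < 4 * (X + ka) by rewrite mulr_gt0// ltr_wpDl.
have mw : measurable_fun [set: T] (fun y => `|b x - b y|).
  rewrite (_ : (fun y => _) = (fun y => `|b y - b x|)); last by apply/funext => y; rewrite distrC.
  exact: measurable_abs_sub.
have mY := measurable_abs_sub c mb.
have Y0 y : 0 <= `|b y - c| by exact: normr_ge0.
have wA : (\int[mu]_(y in D) (`|b x - b y| `^ s')%:E <=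
    ((4 * (X + ka) * m `^ s'^-1) `^ s')%:E)%E.
  rewrite powRM ?(ltW W0) ?powR_ge0// -(powRrM m) mulVf ?gt_eqF// powRr1 ?(ltW m_gt0)//.
  apply: (@le_trans _ _ (\int[mu]_(y in D) ((X + `|b y - c|) `^ s')%:E)%E).
    apply: (ge0_le_integral mu mD).
    - by move=> y _; rewrite lee_fin powR_ge0.
    - exact: measurable_funTS (measurable_EFin_powR s' mw).
    - apply: measurable_funTS; apply: measurable_EFin_powR.
      exact: (measurable_funD (measurable_cst _) mY).
    - move=> y xy; rewrite lee_fin.
      apply: ge0_ler_powR; rewrite ?nnegrE ?(ltW s'0) ?normr_ge0 ?addr_ge0//.
      rewrite (_ : b x - b y = (b x - c) - (b y - c)); last by ring.
      exact: ler_normB.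
  apply: (le_trans (@int_powRD_le _ _ _ mu _ _ _ _ mD mY X0 Y0 (ltW s'0))).
  apply: (@le_trans _ _ ((2 `^ s')%:E * ((X `^ s' * m)%:E + (ka `^ s' * m)%:E))%E).
    apply: lee_wpmul2l; first by rewrite lee_fin powR_ge0.
    apply: leeD; first by rewrite EFinM muD.
    by rewrite /ka -powRrM mulVf ?gt_eqF// powRr1// ltW.
  rewrite -EFinD -EFinM lee_fin -mulrDl mulrA ler_pM2r//.
  have XK t : 0 <= t -> t <= X + ka -> t `^ s' <= (X + ka) `^ s'.
    move=> t0 tx; apply: ge0_ler_powR; rewrite ?nnegrE ?(ltW s'0)//.
    by rewrite addr_ge0// ltW.
  rewrite powRM ?addr_ge0 ?(ltW ka0)//.
  have -> : 4 `^ s' = 2 `^ s' * 2 `^ s' by rewrite -powRM// -natrM.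
  rewrite -mulrA ler_pM2l ?powR_gt0//.
  apply: (@le_trans _ _ (2 * (X + ka) `^ s')).
    rewrite mulrDl mul1r.
    by apply: lerD; apply: XK; rewrite ?normr_ge0 ?(ltW ka0)// ?lerDl ?lerDr// ltW.
  by rewrite ler_wpM2r ?powR_ge0// le1r_powR ?ler1n// ltW.
have fB : (\int[mu]_(y in D) (f y `^ s)%:E <= ((F * m `^ s^-1) `^ s)%:E)%E.
  rewrite (powRM _ (ltW F_gt0) (powR_ge0 _ _)) -(powRrM m) mulVf ?gt_eqF//.
  by rewrite powRr1 ?(ltW m_gt0).
have := @hoelder_le _ _ _ mu D (fun y => `|b x - b y|) f s' s _ _ mD (measurable_funTS mw)
  (measurable_funTS mf) (fun y _ => normr_ge0 _) (fun y _ => f_ge0 y) s'0 s_gt0 ss'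
  (mulr_gt0 W0 (powR_gt0 _ m_gt0)) (mulr_gt0 F_gt0 (powR_gt0 _ m_gt0)) wA fB.
move=> /le_trans; apply; rewrite lee_fin mulrACA -powRD; last first.
  by rewrite (gt_eqF m_gt0) implybT.
by rewrite ss' powRr1// ltW.
Qed.

End osc_hoelder.

Section tails.
Context (R : realType) (n : nat) (n_gt0 : (0 < n)%N).
Local Notation mu := (@lebesgue R n).

(** Centred at the corner [a] of [cube a r], with half-side [2 ^+ j.+1 * r]. It contains that cube,
    and a point outside it is at least [2 ^+ j * r] away, in some coordinate, from every point of
    the cube. *)
Definition dcube (a : Rn R n) (r : R) j : set (Rn R n) :=
  cube (vec (fun i => rcoord a i - 2 ^+ j.+1 * r)) (2 ^+ j.+2 * r).

Lemma in_dcube a r j y :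
  dcube a r j y <-> forall i, `|rcoord y i - rcoord a i| <= 2 ^+ j.+1 * r.
Proof.
split=> h i; have := h i; rewrite rcoord_vec (exprS _ j.+1) ler_norml;
  move: (2 ^+ j.+1) => t /andP[h1 h2]; apply/andP; split; lra.
Qed.

Lemma dcube_side_gt0 (r : R) j : 0 < r -> 0 < 2 ^+ j.+2 * r.
Proof. by move=> r0; rewrite mulr_gt0// exprn_gt0. Qed.

Lemma dcubeS a r j : 0 < r -> dcube a r j `<=` dcube a r j.+1.
Proof.
move=> r0 y /in_dcube h; apply/in_dcube => i; apply: (le_trans (h i)).
rewrite [2 ^+ j.+2]exprS; have : 0 < 2 ^+ j.+1 * r by rewrite mulr_gt0// exprn_gt0.
by rewrite -mulrA; lra.
Qed.

Lemma sub_dcube a r : 0 < r -> cube a r `<=` dcube a r 0.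
Proof.
move=> r0 y h; apply/in_dcube => i; have := h i; rewrite ler_norml expr1 => /andP[h1 h2].
by apply/andP; split; lra.
Qed.

Context (b : Rn R n -> R) (B : R).
Hypotheses (lb : loc_integrable b) (B_gt0 : 0 < B).
Hypothesis osc_b : forall a r, 0 < r ->
  (\int[mu]_(x in cube a r) (`|b x - average b (cube a r)|)%:E <= (B * r ^+ n)%:E)%E.

Lemma average_dcube a r j : 0 < r ->
  `|average b (dcube a r j) - average b (dcube a r 0)| <= 2 ^+ n * B * j%:R.
Proof.
move=> r0; elim: j => [|j IH]; first by rewrite subrr normr0 mulr0.
rewrite -[j.+1%:R]natr1 mulrDr mulr1.
have r1 := dcube_side_gt0 j r0; have r2 := dcube_side_gt0 j.+1 r0.
have : `|average b (dcube a r j) - average b (dcube a r j.+1)| <= 2 ^+ n * B.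
  rewrite -(ler_pM2r (exprn_gt0 n r1)) {1}/dcube averageE//.
  apply: (@mean_sub_le _ _ _ mu _ _ (measurable_cube _ _) (exprn_gt0 n r1)
    (lebesgue_cube _ r1) b).
    exact: integrable_cube.
  have <- : B * (2 ^+ j.+3 * r) ^+ n = 2 ^+ n * B * (2 ^+ j.+2 * r) ^+ n.
    by rewrite [2 ^+ j.+3]exprS -[2 * _ * r]mulrA exprMn; ring.
  apply: le_trans (osc_b _ r2); apply: (ge0_subset_integral mu).
  - exact: measurable_cube.
  - exact: measurable_cube.
  - apply/measurable_EFinP/measurable_funTS; apply: measurable_abs_sub.
    exact: lb.1.
  - by move=> y _; rewrite lee_fin.
  - exact: dcubeS.
move: (average b (dcube a r j.+1)) (average b (dcube a r j)) (average b (dcube a r 0)) IH.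
move=> u v w IH h; rewrite (_ : u - w = (v - w) - (v - u)); last by ring.
by rewrite (le_trans (ler_normB _ _))// lerD.
Qed.

(** The averages over the dilates drift at most linearly in j, and Bernoulli's inequality absorbs
    this into [sigma ^+ j] for any sigma > 1. The freedom in [sigma] keeps the series over the
    dilates convergent. *)
Lemma dcube_osc_le (s sigma : R) : 1 < s -> 1 < sigma ->
  exists2 K, 0 < K & forall (a : Rn R n) (r : R) (f : Rn R n -> R) (F : R) j (x : Rn R n), 0 < r -> 0 < F ->
  measurable_fun [set: Rn R n] f -> (forall y, 0 <= f y) ->
  (\int[mu]_(y in dcube a r j) (f y `^ s)%:E <= (F `^ s * (2 ^+ j.+2 * r) ^+ n)%:E)%E ->
  (\int[mu]_(y in dcube a r j) (`|b x - b y| * f y)%:E <=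
    (K * sigma ^+ j * (`|b x - average b (dcube a r 0)| + 1) * F * (2 ^+ j.+2 * r) ^+ n)%:E)%E.
Proof.
move=> s1 sig1; have s0 : 0 < s by lra.
pose s' := (1 - s^-1)^-1.
have i1 : s^-1 < 1 by rewrite invf_lt1.
have i0 : 0 < s^-1 by rewrite invr_gt0.
have s'1 : 1 < s' by rewrite /s' invf_gt1; lra.
have ss' : s'^-1 + s^-1 = 1 by rewrite /s' invrK subrK.
have [A A0 HA] := john_nirenberg_cube n_gt0 lb B_gt0 osc_b (ltW (lt_trans ltr01 s'1)).
set ka := A `^ s'^-1; have ka0 : 0 < ka by exact: powR_gt0.
pose L := 2 ^+ n * B; have L0 : 0 < L by rewrite mulr_gt0// exprn_gt0.
have d0 : 0 < sigma - 1 by lra.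
pose M := 1 + ka + L / (sigma - 1).
have LD0 : 0 < L / (sigma - 1) by rewrite divr_gt0.
have M0 : 0 < M by rewrite /M; lra.
exists (4 * M); first by rewrite mulr_gt0.
move=> a r f F j x r0 F0 mf f0 hf.
have r1 := dcube_side_gt0 j r0; have m0 := exprn_gt0 n r1.
have h := @osc_hoelder _ _ _ mu (dcube a r j) _ b f (average b (dcube a r j)) s s' A F
  (measurable_cube _ _) m0 (lebesgue_cube _ r1) lb.1 mf f0 s0 s'1 ss' F0 A0
  (HA _ _ r1) hf x.
apply: (le_trans h); rewrite lee_fin ler_pM2r// ler_pM2r// -!mulrA ler_pM2l//.
have := average_dcube a j r0; rewrite -/L -/ka.
move: (average b (dcube a r j)) (average b (dcube a r 0)) => u w huw.
have sj : 1 + (sigma - 1) * j%:R <= sigma ^+ j.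
  elim: (j) => [|i IH]; first by rewrite mulr0 addr0 expr0.
  rewrite exprS -[i.+1%:R]natr1; have i00 : 0 <= i%:R :> R by [].
  apply: (@le_trans _ _ (sigma * (1 + (sigma - 1) * i%:R))).
    have : 0 <= (sigma - 1) * (sigma - 1) * i%:R by rewrite mulr_ge0// mulr_ge0// ltW.
    lra.
  by rewrite ler_pM2l//; lra.
have X0 : 0 <= `|b x - w| by exact: normr_ge0.
have tri : `|b x - u| <= `|b x - w| + L * j%:R.
  rewrite (_ : b x - u = (b x - w) - (u - w)); last by ring.
  by rewrite (le_trans (ler_normB _ _))// lerD.
set X := `|b x - w| in X0 tri *; set Y := `|b x - u| in tri *.
have sj1 : 1 <= sigma ^+ j by apply: exprn_ege1; lra.
have Lj : L * j%:R <= L / (sigma - 1) * sigma ^+ j.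
  rewrite -mulrA ler_pM2l// ler_pdivlMl//; lra.
have e1 : X + 1 <= sigma ^+ j * (X + 1) by rewrite ler_peMl//; lra.
have e2 : ka <= ka * (sigma ^+ j * (X + 1)) by rewrite ler_peMr ?(ltW ka0)//; nra.
have e3 : L / (sigma - 1) * sigma ^+ j <= L / (sigma - 1) * (sigma ^+ j * (X + 1)).
  by rewrite ler_pM2l// ler_peMr//; lra.
rewrite /M !mulrDl mul1r; lra.
Qed.

Lemma int_osc_dcube_le (sigma : R) : 0 <= sigma -> exists2 K, 0 < K & forall a r, 0 < r ->
  (\int[mu]_(y in cube a r) ((1 + `|b y - average b (dcube a r 0)|) `^ sigma)%:E <=
   (K * r ^+ n)%:E)%E.
Proof.
move=> s0; have [A A0 HA] := john_nirenberg_cube n_gt0 lb B_gt0 osc_b s0.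
exists (2 `^ sigma * (1 + A * 4 ^+ n)).
  by rewrite mulr_gt0 ?powR_gt0// addr_gt0// mulr_gt0// exprn_gt0.
move=> a r r0; have r1 := dcube_side_gt0 0 r0.
have := HA (vec (fun i => rcoord a i - 2 ^+ 1 * r)) _ r1; rewrite -/(dcube a r 0).
have := measurable_abs_sub (average b (dcube a r 0)) lb.1.
move: (average b (dcube a r 0)) => c mY hA.
have Y0 y : 0 <= `|b y - c| by exact: normr_ge0.
have mc := measurable_cube a r.
apply: (le_trans (@int_powRD_le _ _ _ mu _ _ _ _ mc mY ler01 Y0 s0)).
rewrite [X in (_ * (_ * X + _))%E](lebesgue_cube a r0) powR1 mul1e.
rewrite -mulrA EFinM; apply: lee_wpmul2l; first by rewrite lee_fin powR_ge0.
rewrite mulrDl mul1r EFinD; apply: leeD => //.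
have -> : A * 4 ^+ n * r ^+ n = A * (2 ^+ 2 * r) ^+ n.
  by rewrite exprMn mulrA; congr (_ * _ ^+ _ * _); ring.
apply: le_trans hA; apply: (ge0_subset_integral mu mc).
- exact: measurable_cube.
- exact: measurable_funTS (measurable_EFin_powR sigma mY).
- by move=> y _; rewrite lee_fin powR_ge0.
- exact: sub_dcube.
Qed.

End tails.

(** * The majorant by shifted grids and dilates *)

Section shifted_grids.
Context (R : realType) (n : nat) (n_gt0 : (0 < n)%N).
Local Notation mu := (@lebesgue R n).
Context (b1 b2 : Rn R n -> R) (B p1 p2 p e q : R).
Hypotheses (lb1 : loc_integrable b1) (lb2 : loc_integrable b2) (B_gt0 : 0 < B).
Hypothesis osc_b1 : forall a r, 0 < r ->
  (\int[mu]_(x in cube a r) (`|b1 x - average b1 (cube a r)|)%:E <= (B * r ^+ n)%:E)%E.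
Hypothesis osc_b2 : forall a r, 0 < r ->
  (\int[mu]_(x in cube a r) (`|b2 x - average b2 (cube a r)|)%:E <= (B * r ^+ n)%:E)%E.
Hypotheses (p1_gt1 : 1 < p1) (p2_gt1 : 1 < p2) (p_gt0 : 0 < p) (e_gt0 : 0 < e)
  (q_gt0 : 0 < q) (pE : p^-1 = p1^-1 + p2^-1) (qE : q^-1 = p^-1 - e).

Definition shifted_cell (a : Rn R n) rho (t : {ffun 'I_n -> bool}) k (x : Rn R n) : set (Rn R n) :=
  [set y | same_cube (shift a rho t) rho k x y].

(** All the shifted grids have the same ratio 2^-n and the same oscillation bound [2 * B], so one
    constant serves them all, independently of [a] and [rho]. The finite sum over the shifts is
    treated by [powR_sum_le]. *)
Lemma shifted_grids_bound : exists2 C, 0 < C & forall (a : Rn R n) rho (f1 f2 : Rn R n -> R),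
  0 < rho -> measurable_fun [set: Rn R n] f1 -> measurable_fun [set: Rn R n] f2 ->
  (forall x, 0 <= f1 x) -> (forall x, 0 <= f2 x) ->
  (\int[mu]_x (f1 x `^ p1)%:E <= 1)%E -> (\int[mu]_x (f2 x `^ p2)%:E <= 1)%E ->
  exists Z : {ffun 'I_n -> bool} -> nat -> Rn R n -> R,
   [/\ forall t k, measurable_fun [set: Rn R n] (Z t k), forall t k x, 0 <= Z t k x,
    forall t k x, (((side rho k ^+ n) `^ (e - 2))%:E *
       (\int[mu]_(y in shifted_cell a rho t k x) (`|b1 x - b1 y| * f1 y)%:E *
        \int[mu]_(y in shifted_cell a rho t k x) (`|b2 x - b2 y| * f2 y)%:E) <=
        (Z t k x)%:E)%E &
    forall N, (\int[mu]_x ((\sum_(k < N) \sum_t Z t k x) `^ q)%:E <= C%:E)%E].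
Proof.
have B20 : 0 < 2 * B by rewrite mulr_gt0.
have [C C0 HC] := grid_commutator_bound mu (@pow2n_lt1 R n n_gt0) p1_gt1 p2_gt1
  p_gt0 e_gt0 q_gt0 B20 pE qE.
pose m : R := (size (index_enum {ffun 'I_n -> bool}))%:R + 1.
have m0 : 0 < m by rewrite ltr_wpDl.
pose M : R := 1 + \sum_(t : {ffun 'I_n -> bool}) C.
have M0 : 0 < M by rewrite ltr_pwDl// sumr_ge0// => t _; exact: ltW.
exists (m `^ q * M); first by rewrite mulr_gt0 ?powR_gt0.
move=> a rho f1 f2 rho0 mf1 mf2 f10 f20 f11 f21.
have /choice[Z HZ] t := HC (cube_grid (shift a rho t) n_gt0 rho0) b1 b2 f1 f2
  (grid_bmo_cube_grid n_gt0 lb1 osc_b1 _ rho0)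
  (grid_bmo_cube_grid n_gt0 lb2 osc_b2 _ rho0) mf1 mf2 f10 f20 f11 f21.
have mZ t k : measurable_fun [set: Rn R n] (Z t k) by have [h _ _ _] := HZ t; exact: h.
have Z0 t k x : 0 <= Z t k x by have [_ h _ _] := HZ t; exact: h.
exists Z; split => //.
  move=> t k x; have [_ _ h _] := HZ t; have := h k x.
  by rewrite vol_cube_grid.
move=> N.
pose S t x := \sum_(k < N) Z t k x.
have mS t : measurable_fun [set: Rn R n] (S t) by apply: measurable_sum => k; exact: mZ.
have S0 t x : 0 <= S t x by apply: sumr_ge0.
have mSq t : measurable_fun [set: Rn R n] (fun x => (S t x `^ q)%:E).
  exact: measurable_EFin_powR.
have Sq0 t x : (0 <= (S t x `^ q)%:E)%E by rewrite lee_fin powR_ge0.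
apply: (@le_trans _ _ (\int[mu]_x ((m `^ q)%:E * \sum_t (S t x `^ q)%:E))%E).
  apply: (ge0_le_integral mu measurableT).
  - by move=> x _; rewrite lee_fin powR_ge0.
  - apply: measurable_EFin_powR; apply: measurable_sum => k.
    by apply: measurable_sum => t; exact: mZ.
  - apply: emeasurable_funM; first exact: measurable_cst.
    by apply: emeasurable_sum => t; exact: mSq.
  - move=> x _; rewrite exchange_big/= sumEFin -EFinM lee_fin.
    exact: (@powR_sum_le R _ (index_enum _) (fun t => S t x) q q_gt0 (fun t => S0 t x)).
have msum : measurable_fun [set: Rn R n] (fun x => \sum_t (S t x `^ q)%:E)%E.
  by apply: emeasurable_sum => t; exact: mSq.
have sum0 x : setT x -> (0 <= \sum_t (S t x `^ q)%:E)%E by move=> _; apply: sume_ge0.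
have mq0 : (0 <= (m `^ q)%:E)%E by rewrite lee_fin powR_ge0.
rewrite (@ge0_integralZl _ _ _ mu setT measurableT _ msum _ sum0 mq0).
rewrite EFinM; apply: lee_wpmul2l; first by rewrite lee_fin powR_ge0.
rewrite ge0_integral_sum//.
apply: (@le_trans _ _ (\sum_(t : {ffun 'I_n -> bool}) C%:E)%E).
  by apply: lee_sum => t _; have [_ _ _ h] := HZ t; exact: h.
by rewrite sumEFin lee_fin /M lerDr.
Qed.

End shifted_grids.

Section indic_product.
Context d (T : measurableType d) (R : realType) (mu : {sigma_finite_measure set T -> \bar R}).

Lemma int_indicM (A : set T) (u : T -> R) :
  (\int[mu]_x (\1_A x * u x)%:E = \int[mu]_(x in A) (u x)%:E)%E.
Proof.
rewrite [RHS]integral_mkcond; apply: eq_integral => x _; rewrite patchE indicE.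
by case: (x \in A); rewrite ?mul1r ?mul0r.
Qed.

Lemma int_indic_prod (A1 A2 : set T) (c : R) (u v : T -> R) : 0 <= c ->
  measurable A1 -> measurable A2 ->
  measurable_fun [set: T] u -> measurable_fun [set: T] v ->
  (forall x, 0 <= u x) -> (forall y, 0 <= v y) ->
  (\int[mu \x mu]_z (c * ((\1_A1 z.1 * u z.1) * (\1_A2 z.2 * v z.2)))%:E =
   c%:E * ((\int[mu]_(x in A1) (u x)%:E) * (\int[mu]_(y in A2) (v y)%:E)))%E.
Proof.
move=> c0 mA1 mA2 mu_ mv u0 v0; rewrite -(int_indicM A1 u) -(int_indicM A2 v).
have mi A (w : T -> R) : measurable A -> measurable_fun [set: T] w ->
    measurable_fun [set: T] (fun x => \1_A x * w x).
  by move=> mA mw; exact: (measurable_funM (measurable_indic mA) mw).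
have m1 := mi _ _ mA1 mu_; have m2 := mi _ _ mA2 mv.
have i0 A (w : T -> R) : (forall x, 0 <= w x) -> forall x, 0 <= \1_A x * w x.
  by move=> w0 x; rewrite indicE mulr_ge0.
have u1 := i0 A1 _ u0; have v1 := i0 A2 _ v0.
rewrite -(integral_prod_mul mu mu m1 m2 u1 v1).
have mz : measurable_fun [set: T * T]
    (fun z => ((\1_A1 z.1 * u z.1) * (\1_A2 z.2 * v z.2))%:E).
  apply/measurable_EFinP; exact: (measurable_funM (measurableT_comp m1 measurable_fst)
    (measurableT_comp m2 measurable_snd)).
rewrite -(@ge0_integralZl_EFin _ _ _ (mu \x mu)%E _ measurableT _ _ mz _ c0)//.
by move=> z _; rewrite lee_fin mulr_ge0.
Qed.

End indic_product.

Section domination.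
Context (R : realType) (n : nat) (n_gt0 : (0 < n)%N) (alpha : R).
Hypothesis alpha_lt : 0 < alpha < 2 * n%:R.
Local Notation mu := (@lebesgue R n).

Definition weight (b f : Rn R n -> R) x y : R := `|b x - b y| * f y.

Lemma weight_ge0 b f x y : (forall y, 0 <= f y) -> 0 <= weight b f x y.
Proof. by move=> f0; rewrite mulr_ge0. Qed.

Lemma measurable_weight b f x : measurable_fun [set: Rn R n] b ->
  measurable_fun [set: Rn R n] f -> measurable_fun [set: Rn R n] (weight b f x).
Proof.
move=> mb mf; apply: (measurable_funM _ mf).
rewrite (_ : (fun y => _) = (fun y => `|b y - b x|)); last by apply/funext => y; rewrite distrC.
exact: measurable_abs_sub.
Qed.

Context (b1 b2 g1 g2 h1 h2 : Rn R n -> R) (a : Rn R n) (r G1 G2 : R).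
Hypotheses (r_gt0 : 0 < r) (G1_gt0 : 0 < G1) (G2_gt0 : 0 < G2).
Hypotheses (mb1 : measurable_fun [set: Rn R n] b1) (mb2 : measurable_fun [set: Rn R n] b2)
  (mg1 : measurable_fun [set: Rn R n] g1) (mg2 : measurable_fun [set: Rn R n] g2)
  (mh1 : measurable_fun [set: Rn R n] h1) (mh2 : measurable_fun [set: Rn R n] h2).
Hypotheses (g1_ge0 : forall y, 0 <= g1 y) (g2_ge0 : forall y, 0 <= g2 y)
  (h1_ge0 : forall y, 0 <= h1 y) (h2_ge0 : forall y, 0 <= h2 y).
Hypotheses (gh1 : forall y, dcube a r 0 y -> g1 y = G1 * h1 y)
  (gh2 : forall y, dcube a r 0 y -> g2 y = G2 * h2 y).

Local Notation cell t k x := (shifted_cell a (32 * r) t k x).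

Definition local_coef k : R := 12 `^ (2 * n%:R - alpha) *
  (side (32 * r) k ^+ n) `^ (alpha / n%:R - 2) * (G1 * G2).

(** The index k denotes both generation k of the shifted grids and the dilate [k.+1], so that a
    single series covers near and far points. Every term is a constant times a function of y.1 times
    a function of y.2, hence its double integral factors. The grids start at side [32 * r] because a
    point of [cube a r] and one of [dcube a r 0] differ by at most 3 r in each coordinate, which is
    less than 32 r / 6. *)
Definition majorant k (x : Rn R n) (y : Rn R n * Rn R n) : R :=
  \sum_(t : {ffun 'I_n -> bool}) (local_coef k *
    ((\1_(cell t k x) y.1 * weight b1 h1 x y.1) * (\1_(cell t k x) y.2 * weight b2 h2 x y.2))) +
  (2 ^+ k * r) `^ (alpha - 2 * n%:R) *
    ((\1_(dcube a r k.+1) y.1 * weight b1 g1 x y.1) *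
     (\1_(dcube a r k.+1) y.2 * weight b2 g2 x y.2)).

Let local_coef_ge0 k : 0 <= local_coef k.
Proof. by rewrite !mulr_ge0 ?powR_ge0// ltW. Qed.

Let indic_prod_ge0 (A1 A2 : set (Rn R n)) (u v : Rn R n -> R) c y : 0 <= c ->
  (forall y, 0 <= u y) -> (forall y, 0 <= v y) ->
  0 <= c * ((\1_A1 y.1 * u y.1) * (\1_A2 y.2 * v y.2)).
Proof. by move=> c0 u0 v0; rewrite !indicE !mulr_ge0. Qed.

Lemma majorant_ge0 k x y : 0 <= majorant k x y.
Proof.
apply: addr_ge0; first apply: sumr_ge0 => t _; apply: indic_prod_ge0 => //.
- by move=> z; exact: weight_ge0.
- by move=> z; exact: weight_ge0.
- exact: powR_ge0.
- by move=> z; exact: weight_ge0.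
- by move=> z; exact: weight_ge0.
Qed.

Lemma dcube_exhaust y : exists j, dcube a r j y.
Proof.
pose i0 : 'I_n := Ordinal n_gt0.
have [im _ hmax] := @Order.TotalTheory.arg_maxP _ _ _ i0 xpredT
  (fun i => `|rcoord y i - rcoord a i|) isT.
set M := `|rcoord y im - rcoord a im| in hmax.
have M0 : 0 <= M / r by rewrite divr_ge0 ?(ltW r_gt0) ?normr_ge0.
exists (Num.bound (M / r)); apply/in_dcube => i; apply: (le_trans (hmax i isT)).
rewrite -ler_pdivrMr//; apply: (le_trans (ltW (archi_boundP M0))).
rewrite -natrX ler_nat; set N := Num.bound _.
by rewrite (leq_trans (ltnW (ltn_expl N (isT : (1 < 2)%N))))// leq_exp2l.
Qed.

Lemma dcube_le j k : (j <= k)%N -> dcube a r j `<=` dcube a r k.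
Proof.
move=> /subnKC <-; elim: (k - j)%N => [|m IH]; first by rewrite addn0.
by rewrite addnS => y /IH; exact: dcubeS.
Qed.

Lemma not_dcube x y j : cube a r x -> ~ dcube a r j y ->
  exists i, 2 ^+ j * r <= `|rcoord x i - rcoord y i|.
Proof.
move=> xQ; apply: contra_notP => /forallNP h; apply/in_dcube => i.
have := h i; move=> /negP; rewrite -ltNge => hi.
have := xQ i => /andP[x1 x2].
have : `|rcoord y i - rcoord a i| <= `|rcoord x i - rcoord y i| + `|rcoord x i - rcoord a i|.
  rewrite [`|rcoord x i - rcoord y i|]distrC.
  by rewrite (_ : rcoord y i - rcoord a i = (rcoord y i - rcoord x i) + (rcoord x i - rcoord a i))
    ?ler_normD//; ring.
rewrite (@ger0_norm _ (rcoord x i - rcoord a i)); last by lra.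
have : 1 * r <= 2 ^+ j * r by rewrite ler_pM2r// exprn_ege1// ler1n.
rewrite exprS -mulrA; lra.
Qed.

Lemma le_majorant x y : cube a r x -> exists k,
  kernel alpha x y.1 y.2 * (weight b1 g1 x y.1 * weight b2 g2 x y.2) <= majorant k x y.
Proof.
case: y => y1 y2 xQ /=.
have w1 := weight_ge0 b1 x y1 g1_ge0; have w2 := weight_ge0 b2 x y2 g2_ge0.
have ex : exists j, `[< dcube a r j y1 /\ dcube a r j y2 >].
  have [j1 h1'] := dcube_exhaust y1; have [j2 h2'] := dcube_exhaust y2.
  exists (maxn j1 j2); apply/asboolP; split.
    exact: (dcube_le (leq_maxl _ _) h1').
  exact: (dcube_le (leq_maxr _ _) h2').
have tail0 k : 0 <= (2 ^+ k * r) `^ (alpha - 2 * n%:R) *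
    ((\1_(dcube a r k.+1) y1 * weight b1 g1 x y1) *
     (\1_(dcube a r k.+1) y2 * weight b2 g2 x y2)).
  apply: (@indic_prod_ge0 _ _ _ _ _ (y1, y2)); first exact: powR_ge0.
    by move=> z; exact: weight_ge0.
  by move=> z; exact: weight_ge0.
have loc0 k t : 0 <= local_coef k *
    ((\1_(cell t k x) y1 * weight b1 h1 x y1) * (\1_(cell t k x) y2 * weight b2 h2 x y2)).
  apply: (@indic_prod_ge0 _ _ _ _ _ (y1, y2)) => //.
    by move=> z; exact: weight_ge0.
  by move=> z; exact: weight_ge0.
case: (ex_minnP ex) => -[|k] /asboolP[k1 k2] kmin; last first.
  exists k; rewrite /majorant /= -[leLHS]add0r; apply: lerD.
    by apply: sumr_ge0 => t _.
  rewrite !indicE !mem_set// !mul1r; apply: ler_wpM2r; first exact: mulr_ge0.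
  have s0 : 0 < 2 ^+ k * r by rewrite mulr_gt0// exprn_gt0.
  have [d1|d1] := pselect (dcube a r k y1); last first.
    by have [i hi] := not_dcube xQ d1; apply: (kernel_le alpha_lt s0 (or_introl hi)).
  have [d2|d2] := pselect (dcube a r k y2); last first.
    by have [i hi] := not_dcube xQ d2; apply: (kernel_le alpha_lt s0 (or_intror hi)).
  by have /kmin : `[< dcube a r k y1 /\ dcube a r k y2 >] by [exact/asboolP]; rewrite ltnn.
have rho0 : 0 < 32 * r by rewrite mulr_gt0.
have near y : dcube a r 0 y -> forall i, `|rcoord x i - rcoord y i| < 32 * r / 6.
  move=> /in_dcube h i; have := h i; have /andP[x1 x2] := xQ i.
  by rewrite expr1 ler_norml => /andP[y3 y4]; rewrite ltr_norml; apply/andP; split; lra.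
have [[xy1 _]|[k [t [c1 c2 hk]]]] :=
    @local_kernel_le R n n_gt0 alpha alpha_lt a _ x y1 y2 rho0 (near _ k1) (near _ k2).
  (* If the three points coincide, the factor |b1 x - b1 y1| vanishes and any index serves. *)
  exists 0%N; rewrite -xy1 /weight subrr normr0 !mul0r mulr0.
  exact: majorant_ge0.
exists k; rewrite /majorant /= -[leLHS]addr0; apply: lerD => //.
rewrite (bigD1 t)//= -[leLHS]addr0; apply: lerD; last by apply: sumr_ge0 => t' _.
rewrite !indicE !mem_set// !mul1r /local_coef {1}/weight {1}/weight gh1// gh2//.
rewrite -[X in _ <= X]mulrA (_ : G1 * G2 * _ =
  (`|b1 x - b1 y1| * (G1 * h1 y1)) * (`|b2 x - b2 y2| * (G2 * h2 y2))); last first.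
  by rewrite /weight; ring.
by apply: ler_wpM2r hk; rewrite !mulr_ge0// ltW.
Qed.

Lemma measurable_shifted_cell rho t k x : 0 < rho -> measurable (shifted_cell a rho t k x).
Proof.
by move=> rho0; rewrite /shifted_cell (same_cubeE _ rho0); exact: measurable_cobox.
Qed.

Lemma measurable_majorant k x : measurable_fun [set: Rn R n * Rn R n] (majorant k x).
Proof.
have mi A1 A2 c (u v : Rn R n -> R) : measurable A1 -> measurable A2 ->
    measurable_fun [set: Rn R n] u -> measurable_fun [set: Rn R n] v ->
    measurable_fun [set: Rn R n * Rn R n]
      (fun y => c * ((\1_A1 y.1 * u y.1) * (\1_A2 y.2 * v y.2))).
  move=> mA1 mA2 mu_ mv; apply: (measurable_funM (measurable_cst c)).
  exact: (measurable_funM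
    (measurableT_comp (measurable_funM (measurable_indic mA1) mu_) measurable_fst)
    (measurableT_comp (measurable_funM (measurable_indic mA2) mv) measurable_snd)).
have rho0 : 0 < 32 * r by rewrite mulr_gt0.
apply: measurable_funD.
  by apply: measurable_sum => t; apply: mi; try exact: measurable_shifted_cell;
    exact: measurable_weight.
by apply: mi; try exact: measurable_cube; exact: measurable_weight.
Qed.

Lemma int_majorant k x :
  (\int[mu \x mu]_y (majorant k x y)%:E =
   \sum_(t : {ffun 'I_n -> bool}) ((local_coef k)%:E *
    (\int[mu]_(y in cell t k x) (weight b1 h1 x y)%:E *
     \int[mu]_(y in cell t k x) (weight b2 h2 x y)%:E)) +
   ((2 ^+ k * r) `^ (alpha - 2 * n%:R))%:E *
    (\int[mu]_(y in dcube a r k.+1) (weight b1 g1 x y)%:E *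
     \int[mu]_(y in dcube a r k.+1) (weight b2 g2 x y)%:E))%E.
Proof.
have rho0 : 0 < 32 * r by rewrite mulr_gt0.
have mc t := measurable_shifted_cell t k x rho0.
have md : measurable (dcube a r k.+1) by exact: measurable_cube.
have wg1 := fun y => weight_ge0 b1 x y g1_ge0.
have wg2 := fun y => weight_ge0 b2 x y g2_ge0.
have wh1 := fun y => weight_ge0 b1 x y h1_ge0.
have wh2 := fun y => weight_ge0 b2 x y h2_ge0.
have mwg1 := measurable_weight x mb1 mg1; have mwg2 := measurable_weight x mb2 mg2.
have mwh1 := measurable_weight x mb1 mh1; have mwh2 := measurable_weight x mb2 mh2.
have mi A1 A2 c (u v : Rn R n -> R) : measurable A1 -> measurable A2 ->
    measurable_fun [set: Rn R n] u -> measurable_fun [set: Rn R n] v ->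
    measurable_fun [set: Rn R n * Rn R n]
      (fun y => (c * ((\1_A1 y.1 * u y.1) * (\1_A2 y.2 * v y.2)))%:E).
  move=> mA1 mA2 mu_ mv; apply/measurable_EFinP/(measurable_funM (measurable_cst c)).
  exact: (measurable_funM
    (measurableT_comp (measurable_funM (measurable_indic mA1) mu_) measurable_fst)
    (measurableT_comp (measurable_funM (measurable_indic mA2) mv) measurable_snd)).
pose L t (y : Rn R n * Rn R n) := (local_coef k *
    ((\1_(cell t k x) y.1 * weight b1 h1 x y.1) * (\1_(cell t k x) y.2 * weight b2 h2 x y.2)))%:E.
have mL t : measurable_fun [set: Rn R n * Rn R n] (L t) by exact: mi.
have L0 t y : (0 <= L t y)%E by rewrite lee_fin indic_prod_ge0.
pose V (y : Rn R n * Rn R n) := ((2 ^+ k * r) `^ (alpha - 2 * n%:R) *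
    ((\1_(dcube a r k.+1) y.1 * weight b1 g1 x y.1) *
     (\1_(dcube a r k.+1) y.2 * weight b2 g2 x y.2)))%:E.
have mV : measurable_fun [set: Rn R n * Rn R n] V by exact: mi.
have V0 y : (0 <= V y)%E by rewrite lee_fin indic_prod_ge0// powR_ge0.
have -> : (fun y => (majorant k x y)%:E) = (fun y => \sum_t L t y + V y)%E.
  by apply/funext => y; rewrite /majorant EFinD -sumEFin.
have msum : measurable_fun [set: Rn R n * Rn R n] (fun y => \sum_t L t y)%E.
  by apply: emeasurable_sum => t; exact: mL.
have sum0 y : [set: Rn R n * Rn R n] y -> (0 <= \sum_t L t y)%E.
  by move=> _; apply: sume_ge0 => t _; exact: L0.
rewrite (ge0_integralD (mu \x mu)%E measurableT sum0 msum (fun y _ => V0 y) mV).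
congr (_ + _)%E.
  rewrite (ge0_integral_sum (mu \x mu)%E measurableT mL (fun t y _ => L0 t y)).
  by apply: eq_bigr => t _; rewrite -int_indic_prod.
by rewrite -int_indic_prod// powR_ge0.
Qed.

End domination.

(** * Summation of the majorant over a cube *)

Section tools.
Context d (T : measurableType d) (R : realType) (mu : {measure set T -> \bar R}).

Lemma int_powR_combine (D : set T) (S u1 u2 : T -> R) (q A E X Y1 Y2 : R) :
  measurable D -> measurable_fun [set: T] S -> measurable_fun [set: T] u1 ->
  measurable_fun [set: T] u2 -> (forall x, 0 <= S x) -> (forall x, 0 <= u1 x) ->
  (forall x, 0 <= u2 x) -> 0 < q -> 0 <= A -> 0 <= E ->
  (\int[mu]_(x in D) (S x `^ q)%:E <= X%:E)%E ->
  (\int[mu]_(x in D) (u1 x `^ (2 * q))%:E <= Y1%:E)%E ->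
  (\int[mu]_(x in D) (u2 x `^ (2 * q))%:E <= Y2%:E)%E ->
  (\int[mu]_(x in D) ((A * S x + E * (u1 x * u2 x)) `^ q)%:E <=
    (2 `^ q * (A `^ q * X + E `^ q * (Y1 + Y2)))%:E)%E.
Proof.
move=> mD mS mu1 mu2 S0 u10 u20 q0 A0 E0 hX hY1 hY2.
have mp s (f : T -> R) : measurable_fun [set: T] f -> measurable_fun D (fun x => (f x `^ s)%:E).
  by move=> mf; exact: measurable_funTS (measurable_EFin_powR s mf).
have p0 s (f : T -> R) x : D x -> (0 <= (f x `^ s)%:E)%E by move=> _; rewrite lee_fin powR_ge0.
have c0 c : 0 <= c `^ q by exact: powR_ge0.
have cp0 c s (f : T -> R) x : D x -> (0 <= (c `^ q)%:E * (f x `^ s)%:E)%E.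
  by move=> _; rewrite -EFinM lee_fin mulr_ge0 ?powR_ge0.
have cm c s (f : T -> R) : measurable_fun [set: T] f ->
    measurable_fun D (fun x => (c `^ q)%:E * (f x `^ s)%:E)%E.
  by move=> mf; apply: emeasurable_funM; [exact: measurable_cst|exact: mp].
have a0 x : D x -> (0 <= (E `^ q)%:E * (u1 x `^ (2 * q))%:E + (E `^ q)%:E * (u2 x `^ (2 * q))%:E)%E.
  by move=> Dx; apply: adde_ge0; exact: cp0.
have am : measurable_fun D (fun x => (E `^ q)%:E * (u1 x `^ (2 * q))%:E +
    (E `^ q)%:E * (u2 x `^ (2 * q))%:E)%E.
  by apply: emeasurable_funD; exact: cm.
have b0 x : D x -> (0 <= (A `^ q)%:E * (S x `^ q)%:E + ((E `^ q)%:E * (u1 x `^ (2 * q))%:E +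
    (E `^ q)%:E * (u2 x `^ (2 * q))%:E))%E.
  by move=> Dx; apply: adde_ge0; [exact: cp0|exact: a0].
have bm : measurable_fun D (fun x => (A `^ q)%:E * (S x `^ q)%:E +
    ((E `^ q)%:E * (u1 x `^ (2 * q))%:E + (E `^ q)%:E * (u2 x `^ (2 * q))%:E))%E.
  by apply: emeasurable_funD; [exact: cm|exact: am].
apply: (@le_trans _ _ (\int[mu]_(x in D) ((2 `^ q)%:E * ((A `^ q)%:E * (S x `^ q)%:E +
    ((E `^ q)%:E * (u1 x `^ (2 * q))%:E + (E `^ q)%:E * (u2 x `^ (2 * q))%:E))))%E).
  apply: (ge0_le_integral mu mD).
  - by move=> x _; rewrite lee_fin powR_ge0.
  - apply: (mp q (fun x => A * S x + E * (u1 x * u2 x))).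
    exact: (measurable_funD (measurable_funM (measurable_cst A) mS)
      (measurable_funM (measurable_cst E) (measurable_funM mu1 mu2))).
  - by apply: emeasurable_funM; [exact: measurable_cst|exact: bm].
  - move=> x _; rewrite -!EFinM lee_fin.
    apply: (le_trans (powR_add_le (mulr_ge0 A0 (S0 x))
      (mulr_ge0 E0 (mulr_ge0 (u10 x) (u20 x))) (ltW q0))).
    rewrite ler_pM2l ?powR_gt0// (powRM _ A0 (S0 x)) (powRM _ E0 (mulr_ge0 (u10 x) (u20 x))).
    rewrite lerD2l -[leRHS]mulrDr; apply: (ler_wpM2l (c0 E)).
    exact: (powRM_le_add (u10 x) (u20 x) (ltW q0)).
rewrite (ge0_integralZl_EFin mu mD b0 bm (c0 2)) EFinM; apply: lee_wpmul2l; first by rewrite lee_fin.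
rewrite (ge0_integralD mu mD (cp0 A q S) (cm A q S mS) a0 am) EFinD.
rewrite (ge0_integralD mu mD (cp0 E _ u1) (cm E _ u1 mu1) (cp0 E _ u2) (cm E _ u2 mu2)).
rewrite (ge0_integralZl_EFin mu mD (p0 q S) (mp q S mS) (c0 A)).
rewrite (ge0_integralZl_EFin mu mD (p0 _ u1) (mp _ u1 mu1) (c0 E)).
rewrite (ge0_integralZl_EFin mu mD (p0 _ u2) (mp _ u2 mu2) (c0 E)).
rewrite mulrDr EFinD !EFinM; apply: leeD; first by apply: lee_wpmul2l => //; rewrite lee_fin.
by apply: leeD; apply: lee_wpmul2l => //; rewrite lee_fin.
Qed.

Lemma int_normalize_le (D : set T) (f : T -> R) (F s v : R) :
  measurable D -> measurable_fun [set: T] f -> (forall x, 0 <= f x) -> 0 < s -> 0 < F -> 0 < v ->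
  (\int[mu]_(x in D) (f x `^ s)%:E <= (F `^ s * v)%:E)%E ->
  (\int[mu]_x ((\1_D x * f x / (F * v `^ s^-1)) `^ s)%:E <= 1)%E.
Proof.
move=> mD mf f0 s0 F0 v0 h.
have c0 : 0 < F * v `^ s^-1 by rewrite mulr_gt0 ?powR_gt0.
have -> : (\int[mu]_x ((\1_D x * f x / (F * v `^ s^-1)) `^ s)%:E =
    \int[mu]_(x in D) (((F `^ s * v)^-1)%:E * (f x `^ s)%:E))%E.
  rewrite [RHS]integral_mkcond; apply: eq_integral => x _; rewrite patchE indicE.
  case: (x \in D); last by rewrite !mul0r powR0// gt_eqF.
  rewrite mul1r -EFinM powRM ?invr_ge0 ?(ltW c0)//; congr (_%:E).
  rewrite mulrC; congr (_ * _); rewrite -powR_inv1 ?(ltW c0)// -powRrM mulN1r powRN.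
  congr (_^-1); rewrite powRM ?powR_ge0 ?(ltW F0)//.
  by rewrite -powRrM mulVf ?gt_eqF// powRr1// ltW.
have Fv : 0 < F `^ s * v by rewrite mulr_gt0 ?powR_gt0.
have Fv0 : 0 <= (F `^ s * v)^-1 by rewrite invr_ge0 ltW.
have p0 x : D x -> (0 <= (f x `^ s)%:E)%E by move=> _; rewrite lee_fin powR_ge0.
rewrite (ge0_integralZl_EFin mu mD p0 (measurable_funTS (measurable_EFin_powR s mf)) Fv0).
by rewrite lee_pdivrMl// mule1.
Qed.

End tools.

Lemma two_powR_gt1 (R : realType) (x : R) : 0 < x -> 1 < 2 `^ x.
Proof.
move=> x0; rewrite /powR pnatr_eq0/= -[ltLHS]expR0 ltr_expR.
by rewrite mulr_gt0// ln_gt0// ltr1n.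
Qed.

Section exponents.
Context (R : realType) (n : nat) (n_gt0 : (0 < n)%N) (alpha p0 q0 : R).
Hypotheses (q0_gt0 : 0 < q0) (q0E : q0^-1 = p0^-1 - alpha / n%:R).
Local Notation N := (n%:R : R).

(** Each doubling of the dilate gains 2^(-N/q0). Each of the two oscillation factors may spend a
    quarter of this exponent, as [growth]; the remaining half is [decay]. *)
Definition growth : R := 2 `^ (N / (4 * q0)).
Definition decay : R := 2 `^ (- (N / (2 * q0))).

Let N_gt0 : 0 < N. Proof. by rewrite ltr0n. Qed.

Lemma growth_gt1 : 1 < growth.
Proof.
have h : 0 < N / (4 * q0) by rewrite divr_gt0// mulr_gt0.
exact: two_powR_gt1.
Qed.

Lemma decay_lt1 : 0 < decay < 1.
Proof.
have h : 0 < N / (2 * q0) by rewrite divr_gt0// mulr_gt0.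
rewrite /decay powR_gt0//= powRN invf_lt1 ?powR_gt0//.
exact: two_powR_gt1.
Qed.

(** Exponents of the scale: alpha - 2 N from the kernel, 2 N from the two volumes and - N / p0 from
    the norm add up to - N / q0. The 8 is the ratio of the side [2 ^+ k.+3 * r] of the dilate to the
    distance [2 ^+ k * r]. *)
Lemma tail_exponent k (r : R) : 0 < r ->
  (2 ^+ k * r) `^ (alpha - 2 * N) * (growth ^+ k.+1 * (2 ^+ k.+3 * r) ^+ n) ^+ 2 *
    (2 ^+ k.+3 * r) `^ (- (N / p0)) =
  8 `^ (2 * N - N / p0) * growth ^+ 2 * r `^ (- (N / q0)) * decay ^+ k.
Proof.
move=> r0; set s := 2 ^+ k * r; have s0 : 0 < s by rewrite mulr_gt0// exprn_gt0.
have -> : 2 ^+ k.+3 * r = 8 * s by rewrite /s !exprS; ring.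
have s8 : 0 < 8 * s by rewrite mulr_gt0.
have E1 : ((8 * s) ^+ n) ^+ 2 * (8 * s) `^ (- (N / p0)) =
    8 `^ (2 * N - N / p0) * s `^ (2 * N - N / p0).
  rewrite -powRM ?(ltW s0)// -exprM -powR_mulrn ?(ltW s8)// -powRD.
    by rewrite natrM [_ * 2]mulrC.
  by rewrite (gt_eqF s8) implybT.
have E2 : s `^ (alpha - 2 * N) * s `^ (2 * N - N / p0) = s `^ (- (N / q0)).
  rewrite -powRD ?(gt_eqF s0) ?implybT//; congr (_ `^ _).
  by rewrite q0E; move: (p0^-1) => ip; field; rewrite gt_eqF.
have E3 : s `^ (- (N / q0)) * (growth ^+ k.+1) ^+ 2 = growth ^+ 2 * r `^ (- (N / q0)) * decay ^+ k.
  have P : (2 ^+ k) `^ (- (N / q0)) = (2 `^ (- (N / q0))) ^+ k :> R.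
    by rewrite -(powR_mulrn k (powR_ge0 _ _)) -(powR_mulrn k (ler0n _ 2)) -!powRrM mulrC.
  have dk : decay ^+ k = (2 `^ (- (N / q0))) ^+ k * (growth ^+ k) ^+ 2.
    have -> : decay = 2 `^ (- (N / q0)) * growth ^+ 2.
      rewrite /growth -powR_mulrn ?powR_ge0// -powRrM -powRD; last by rewrite pnatr_eq0 implybT.
      by congr (_ `^ _); field; rewrite gt_eqF.
    by rewrite exprMn -!exprM [(2 * k)%N]mulnC.
  rewrite /s powRM ?exprn_ge0 ?(ltW r0)// P dk (exprS growth k).
  move: (_ ^+ k) (growth ^+ k) => u v; ring.
rewrite exprMn.
transitivity (8 `^ (2 * N - N / p0) * (s `^ (alpha - 2 * N) * s `^ (2 * N - N / p0)) *
  (growth ^+ k.+1) ^+ 2).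
  rewrite -[RHS]mulrA -[X in _ = X](mulrC _) -!mulrA.
  transitivity (s `^ (alpha - 2 * N) * (growth ^+ k.+1) ^+ 2 *
     (((8 * s) ^+ n) ^+ 2 * (8 * s) `^ (- (N / p0)))); first by ring.
  by rewrite E1; ring.
by rewrite E2 -!mulrA; congr (_ * _); rewrite E3 !mulrA.
Qed.

End exponents.

Section measurable_kernel.
Context d (T : measurableType d) (R : realType) (n : nat).
Context (fx fy fz : T -> Rn R n).
Hypotheses (mx : measurable_fun [set: T] fx) (my : measurable_fun [set: T] fy)
  (mz : measurable_fun [set: T] fz).

Lemma measurable_sqdist (f g : T -> Rn R n) : measurable_fun [set: T] f ->
  measurable_fun [set: T] g -> measurable_fun [set: T] (fun t => sqdist (f t) (g t)).
Proof.
move=> mf mg; apply: measurable_sum => i; apply: measurable_funX.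
exact: (measurable_funB (measurableT_comp (@measurable_rcoord R n i) mf)
  (measurableT_comp (@measurable_rcoord R n i) mg)).
Qed.

Lemma measurable_kernel alpha :
  measurable_fun [set: T] (fun t => kernel alpha (fx t) (fy t) (fz t)).
Proof.
rewrite /kernel; under eq_fun do rewrite -powRN.
apply/measurable_EFinP/measurable_EFin_powR.
exact: (measurable_funD (measurable_sqdist mx my) (measurable_sqdist mx mz)).
Qed.

End measurable_kernel.

Section commutator_series.
Context (R : realType) (n : nat) (n_gt0 : (0 < n)%N).
Context (alpha p1 p2 p p0 q q0 B : R) (b1 b2 : Rn R n -> R).
Local Notation N := (n%:R : R).
Local Notation mu := (@lebesgue R n).
Local Notation e := (alpha / N).
Hypotheses (alpha_lt : 0 < alpha < 2 * N) (p1_gt1 : 1 < p1) (p2_gt1 : 1 < p2)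
  (p_gt0 : 0 < p) (q_gt0 : 0 < q) (q0_gt0 : 0 < q0) (B_gt0 : 0 < B).
Hypotheses (pE : p^-1 = p1^-1 + p2^-1) (qE : q^-1 = p^-1 - e) (q0E : q0^-1 = p0^-1 - e).
Hypotheses (lb1 : loc_integrable b1) (lb2 : loc_integrable b2).
Hypothesis osc_b1 : forall a r, 0 < r ->
  (\int[mu]_(x in cube a r) (`|b1 x - average b1 (cube a r)|)%:E <= (B * r ^+ n)%:E)%E.
Hypothesis osc_b2 : forall a r, 0 < r ->
  (\int[mu]_(x in cube a r) (`|b2 x - average b2 (cube a r)|)%:E <= (B * r ^+ n)%:E)%E.

(* What a multi-Morrey norm at most M yields on each cube. Real upper bounds are
   used because one of the two means may vanish. *)
Definition cube_factors (M : R) (g1 g2 : Rn R n -> R) := forall (a : Rn R n) (r : R), 0 < r ->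
  exists F1 F2 : R, [/\ 0 < F1, 0 < F2,
    (\int[mu]_(y in cube a r) (g1 y `^ p1)%:E <= (F1 `^ p1 * r ^+ n)%:E)%E,
    (\int[mu]_(y in cube a r) (g2 y `^ p2)%:E <= (F2 `^ p2 * r ^+ n)%:E)%E &
    F1 * F2 <= M * r `^ (- (N / p0))].

Let N_gt0 : 0 < N. Proof. by rewrite ltr0n. Qed.

Lemma scaling_exponent : q * (N / p - N / p0) = N - N * q / q0.
Proof.
have -> : N / p - N / p0 = N * (q^-1 - q0^-1) by rewrite qE q0E; ring.
by field; rewrite !gt_eqF.
Qed.

Lemma tail_term_le : exists2 K, 0 < K & forall (M : R) (a : Rn R n) (r : R)
    (g1 g2 : Rn R n -> R) k (x : Rn R n), 0 < M -> 0 < r ->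
  measurable_fun [set: Rn R n] g1 -> measurable_fun [set: Rn R n] g2 ->
  (forall y, 0 <= g1 y) -> (forall y, 0 <= g2 y) -> cube_factors M g1 g2 ->
  (((2 ^+ k * r) `^ (alpha - 2 * N))%:E *
    (\int[mu]_(y in dcube a r k.+1) (weight b1 g1 x y)%:E *
     \int[mu]_(y in dcube a r k.+1) (weight b2 g2 x y)%:E) <=
   (K * M * r `^ (- (N / q0)) * decay n q0 ^+ k *
     ((1 + `|b1 x - average b1 (dcube a r 0)|) * (1 + `|b2 x - average b2 (dcube a r 0)|)))%:E)%E.
Proof.
have gr1 := growth_gt1 n_gt0 q0_gt0.
have [K1 K10 H1] := dcube_osc_le n_gt0 lb1 B_gt0 osc_b1 p1_gt1 gr1.
have [K2 K20 H2] := dcube_osc_le n_gt0 lb2 B_gt0 osc_b2 p2_gt1 gr1.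
have gr0 : 0 < growth n q0 by exact: lt_trans gr1.
exists (K1 * K2 * (8 `^ (2 * N - N / p0) * growth n q0 ^+ 2)).
  by rewrite !mulr_gt0 ?powR_gt0// exprn_gt0.
move=> M a r g1 g2 k x M0 r0 mg1 mg2 g10 g20 H.
have t0 := dcube_side_gt0 k.+1 r0.
have [F1 [F2 [F10 F20 f1 f2 F12]]] := H (vec (fun i => rcoord a i - 2 ^+ k.+2 * r)) _ t0.
have h1 := H1 a r g1 F1 k.+1 x r0 F10 mg1 g10 f1.
have h2 := H2 a r g2 F2 k.+1 x r0 F20 mg2 g20 f2.
have hc : 0 <= (2 ^+ k * r) `^ (alpha - 2 * N) by exact: powR_ge0.
apply: (@le_trans _ _ (((2 ^+ k * r) `^ (alpha - 2 * N))%:E * (_%:E * _%:E))%E).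
  apply: lee_wpmul2l; first by rewrite lee_fin.
  by apply: lee_pmul h1 h2; apply: integral_ge0 => y _; rewrite lee_fin weight_ge0.
rewrite -!EFinM lee_fin.
have := tail_exponent n_gt0 q0_gt0 q0E k r0.
move: (average b1 _) (average b2 _) => c1 c2.
set u1 := `|b1 x - c1|; set u2 := `|b2 x - c2|.
set s := (_ `^ (alpha - _)); set G := growth n q0 ^+ k.+1; set t := (2 ^+ k.+3 * r) ^+ n.
set v := _ `^ (- (N / p0)); set w := r `^ _; set z := 8 `^ _ => tE.
have u10 : 0 <= u1 by exact: normr_ge0.
have u20 : 0 <= u2 by exact: normr_ge0.
rewrite (_ : s * _ = K1 * K2 * (u1 + 1) * (u2 + 1) * (s * (G * t) ^+ 2) * (F1 * F2)); last by ring.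
apply: (@le_trans _ _ (K1 * K2 * (u1 + 1) * (u2 + 1) * (s * (G * t) ^+ 2) * (M * v))).
  apply: ler_wpM2l F12; apply: mulr_ge0; last by apply: mulr_ge0; [exact: hc|exact: sqr_ge0].
  by rewrite !mulr_ge0 ?(ltW K10) ?(ltW K20) ?addr_ge0.
rewrite (_ : _ * (M * v) = K1 * K2 * (u1 + 1) * (u2 + 1) * M * (s * (G * t) ^+ 2 * v)); last by ring.
rewrite tE le_eqVlt; apply/orP; left; apply/eqP.
move: (decay n q0 ^+ k) (growth n q0) => d g; ring.
Qed.

(** The same terms [Z k] give almost everywhere convergence of the double integral and the bound on
    the cube. The bound is placed on partial sums, uniformly, so that monotone convergence can be
    applied afterwards. *)
Lemma commutator_series : exists2 C, 0 < C & forall (M : R) (a : Rn R n) (r : R)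
    (g1 g2 : Rn R n -> R), 0 < M -> 0 < r ->
  measurable_fun [set: Rn R n] g1 -> measurable_fun [set: Rn R n] g2 ->
  (forall y, 0 <= g1 y) -> (forall y, 0 <= g2 y) -> cube_factors M g1 g2 ->
  exists Z : nat -> Rn R n -> R,
  [/\ forall k, measurable_fun [set: Rn R n] (Z k), forall k x, 0 <= Z k x,
    forall x, cube a r x -> (\int[mu \x mu]_y
      (kernel alpha x y.1 y.2 * (weight b1 g1 x y.1 * weight b2 g2 x y.2))%:E <=
      \sum_(k <oo) (Z k x)%:E)%E &
    forall K, (\int[mu]_(x in cube a r) ((\sum_(k < K) Z k x) `^ q)%:E <=
      (C * M `^ q * r `^ (N - N * q / q0))%:E)%E].
Proof.
have mb1 : measurable_fun [set: Rn R n] b1 := lb1.1.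
have mb2 : measurable_fun [set: Rn R n] b2 := lb2.1.
have al0 : 0 < alpha by case/andP: alpha_lt.
have e0 : 0 < e by rewrite divr_gt0.
have p10 : 0 < p1 by exact: lt_trans p1_gt1.
have p20 : 0 < p2 by exact: lt_trans p2_gt1.
have [C1 C10 HC1] := shifted_grids_bound n_gt0 lb1 lb2 B_gt0 osc_b1 osc_b2
  p1_gt1 p2_gt1 p_gt0 e0 q_gt0 pE qE.
have [Kt Kt0 HKt] := tail_term_le.
have q2 : 0 <= 2 * q by rewrite mulr_ge0// ltW.
have [K3 K30 HK3] := int_osc_dcube_le n_gt0 lb1 B_gt0 osc_b1 q2.
have [K4 K40 HK4] := int_osc_dcube_le n_gt0 lb2 B_gt0 osc_b2 q2.
pose c12 : R := 12 `^ (2 * N - alpha); have c120 : 0 < c12 by exact: powR_gt0.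
have /andP[d0 d1] := decay_lt1 n_gt0 q0_gt0.
pose Kd := Kt * (1 - decay n q0)^-1.
have Kd0 : 0 < Kd by rewrite mulr_gt0// invr_gt0 subr_gt0.
(* By [scaling_exponent], q E = N - N q / q0, so the local part has the same power of r as the tail.
   The 4 is the ratio of the sides of [dcube a r 0] and [cube a r]. *)
pose E := N / p - N / p0.
exists (2 `^ q * (c12 `^ q * 4 `^ (E * q) * C1 + Kd `^ q * (K3 + K4))).
  by rewrite mulr_gt0 ?powR_gt0// addr_gt0// !mulr_gt0 ?powR_gt0// addr_gt0.
move=> M a r g1 g2 M0 r0 mg1 mg2 g10 g20 H.
have R0 := dcube_side_gt0 0 r0; set v := (2 ^+ 2 * r) ^+ n.
have v0 : 0 < v by rewrite exprn_gt0.
have [F1 [F2 [F10 F20 f1 f2 F12]]] := H (vec (fun i => rcoord a i - 2 ^+ 1 * r)) _ R0.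
have md : measurable (dcube a r 0) by exact: measurable_cube.
(* [G1] and [G2] bound the norms of g1 in L^p1 and of g2 in L^p2 over [dcube a r 0], whose volume is
   [v]; the grid estimate is applied to the normalised restrictions, and 1/p = 1/p1 + 1/p2 combines
   the powers of v in the product. *)
pose G1 := F1 * v `^ p1^-1; pose G2 := F2 * v `^ p2^-1.
have G10 : 0 < G1 by rewrite mulr_gt0 ?powR_gt0.
have G20 : 0 < G2 by rewrite mulr_gt0 ?powR_gt0.
pose h1 y := \1_(dcube a r 0) y * g1 y / G1; pose h2 y := \1_(dcube a r 0) y * g2 y / G2.
have mh (g : Rn R n -> R) c : measurable_fun [set: Rn R n] g ->
    measurable_fun [set: Rn R n] (fun y => \1_(dcube a r 0) y * g y / c).
  by move=> mg; exact: (measurable_funM (measurable_funM (measurable_indic md) mg)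
    (measurable_cst c^-1)).
have h0 (g : Rn R n -> R) c : 0 < c -> (forall y, 0 <= g y) ->
    forall y, 0 <= \1_(dcube a r 0) y * g y / c.
  by move=> c0 g0 y; rewrite indicE mulr_ge0 ?invr_ge0 ?mulr_ge0// ltW.
have gh (g : Rn R n -> R) c : 0 < c -> forall y, dcube a r 0 y ->
    g y = c * (\1_(dcube a r 0) y * g y / c).
  by move=> c0 y dy; rewrite indicE mem_set// mul1r mulrC divfK// gt_eqF.
have mh1 : measurable_fun [set: Rn R n] h1 := mh _ G1 mg1.
have mh2 : measurable_fun [set: Rn R n] h2 := mh _ G2 mg2.
have h10 : forall y, 0 <= h1 y := h0 _ _ G10 g10.
have h20 : forall y, 0 <= h2 y := h0 _ _ G20 g20.
have ih1 := int_normalize_le md mg1 g10 p10 F10 v0 f1.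
have ih2 := int_normalize_le md mg2 g20 p20 F20 v0 f2.
have rho0 : 0 < 32 * r by rewrite mulr_gt0.
have [Zt [mZt Zt0 leZt sZt]] := HC1 a (32 * r) h1 h2 rho0 mh1 mh2 h10 h20 ih1 ih2.
have al := alpha_lt.
have majE := int_majorant alpha a r0 G10 G20 mb1 mb2 mg1 mg2 mh1 mh2 g10 g20 h10 h20.
have mmaj := measurable_majorant alpha a G1 G2 r0 mb1 mb2 mg1 mg2 mh1 mh2.
have maj0 := majorant_ge0 alpha b1 b2 a r G10 G20 g10 g20 h10 h20.
have lemaj := le_majorant n_gt0 alpha_lt b1 b2 r0 G10 G20 g10 g20 h10 h20 (gh g1 _ G10) (gh g2 _ G20).
pose u1 (x : Rn R n) : R := 1 + `|b1 x - average b1 (dcube a r 0)|.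
pose u2 (x : Rn R n) : R := 1 + `|b2 x - average b2 (dcube a r 0)|.
have mu1 : measurable_fun [set: Rn R n] u1.
  by apply: measurable_funD; [exact: measurable_cst|exact: measurable_abs_sub].
have mu2 : measurable_fun [set: Rn R n] u2.
  by apply: measurable_funD; [exact: measurable_cst|exact: measurable_abs_sub].
have u10 x : 0 <= u1 x by rewrite addr_ge0.
have u20 x : 0 <= u2 x by rewrite addr_ge0.
pose kap := M * r `^ (- (N / q0)).
have kap0 : 0 < kap by rewrite mulr_gt0 ?powR_gt0.
have Kkap0 : 0 <= Kt * kap := mulr_ge0 (ltW Kt0) (ltW kap0).
pose Z k x := c12 * (G1 * G2) * \sum_t Zt t k x +
  Kt * kap * decay n q0 ^+ k * (u1 x * u2 x).
have A0 : 0 < c12 * (G1 * G2) := mulr_gt0 c120 (mulr_gt0 G10 G20).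
have mZ k : measurable_fun [set: Rn R n] (Z k).
  apply: (measurable_funD (measurable_funM (measurable_cst _) _)
    (measurable_funM (measurable_cst _) (measurable_funM mu1 mu2))).
  by apply: measurable_sum => t; exact: mZt.
have sZt0 k x : 0 <= \sum_t Zt t k x by apply: sumr_ge0.
have Z0 k x : 0 <= Z k x.
  rewrite addr_ge0//; first by rewrite mulr_ge0// ltW.
  apply: mulr_ge0; last exact: mulr_ge0 (u10 x) (u20 x).
  exact: mulr_ge0 Kkap0 (exprn_ge0 _ (ltW d0)).
exists Z; split => //.
  move=> x xQ; have wt1 y := weight_ge0 b1 x y g10; have wt2 y := weight_ge0 b2 x y g20.
  have mf : measurable_fun [set: Rn R n * Rn R n]
      (fun y => (kernel alpha x y.1 y.2 * (weight b1 g1 x y.1 * weight b2 g2 x y.2))%:E).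
    apply/measurable_EFinP; apply: (measurable_funM
      (measurable_kernel (measurable_cst x) measurable_fst measurable_snd alpha)).
    exact: (measurable_funM
      (measurableT_comp (measurable_weight x mb1 mg1) measurable_fst)
      (measurableT_comp (measurable_weight x mb2 mg2) measurable_snd)).
  have f0 (y : Rn R n * Rn R n) :
      (0 <= (kernel alpha x y.1 y.2 * (weight b1 g1 x y.1 * weight b2 g2 x y.2))%:E)%E.
    by rewrite lee_fin; apply: mulr_ge0; [exact: kernel_ge0|exact: mulr_ge0].
  pose phi k y := (majorant alpha b1 b2 g1 g2 h1 h2 a r G1 G2 k x y)%:E.
  have mphi k : measurable_fun [set: Rn R n * Rn R n] (phi k).
    by apply/measurable_EFinP; exact: mmaj.
  have phi0 k y : (0 <= phi k y)%E by rewrite lee_fin; exact: maj0.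
  have lephi y : exists k, ((kernel alpha x y.1 y.2 *
      (weight b1 g1 x y.1 * weight b2 g2 x y.2))%:E <= phi k y)%E.
    by have [k hk] := lemaj x y xQ; exists k; rewrite lee_fin.
  apply: (le_trans (@le_integral_nneseries _ _ R (mu \x mu)%E _ phi mf mphi f0 phi0 lephi)).
  apply: lee_nneseries => k _; first by move=> _; apply: integral_ge0.
  rewrite /phi majE /Z EFinD; apply: leeD; last by rewrite /kap [Kt * (M * _)]mulrA; exact: HKt.
  rewrite mulr_sumr -sumEFin; apply: lee_sum => t _.
  rewrite /local_coef -/c12 mulrAC EFinM -muleA [leRHS]EFinM; apply: lee_wpmul2l.
    by rewrite lee_fin ltW.
  exact: leZt.
move=> K.
pose S x := \sum_(k < K) \sum_t Zt t k x.
have mS : measurable_fun [set: Rn R n] S.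
  by apply: measurable_sum => k; apply: measurable_sum => t; exact: mZt.
have S0 x : 0 <= S x by apply: sumr_ge0.
have Sq : (\int[mu]_(x in cube a r) (S x `^ q)%:E <= C1%:E)%E.
  apply: le_trans (sZt K); apply: (ge0_subset_integral mu (measurable_cube a r) measurableT).
  - exact: measurable_EFin_powR.
  - by move=> x _; rewrite lee_fin powR_ge0.
  - by [].
apply: (@le_trans _ _ (\int[mu]_(x in cube a r)
    ((c12 * (G1 * G2) * S x + Kd * kap * (u1 x * u2 x)) `^ q)%:E)%E).
  apply: (ge0_le_integral mu (measurable_cube a r)).
  - by move=> x _; rewrite lee_fin powR_ge0.
  - by apply: measurable_funTS; apply: measurable_EFin_powR; apply: measurable_sum.
  - apply: measurable_funTS; apply: measurable_EFin_powR.
    exact: (measurable_funD (measurable_funM (measurable_cst _) mS)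
      (measurable_funM (measurable_cst _) (measurable_funM mu1 mu2))).
  - move=> x _; rewrite lee_fin.
    have sZ0 : 0 <= \sum_(k < K) Z k x by apply: sumr_ge0.
    have le : \sum_(k < K) Z k x <= c12 * (G1 * G2) * S x + Kd * kap * (u1 x * u2 x).
      rewrite /Z big_split/= -mulr_sumr lerD2l.
      have -> : \sum_(k < K) Kt * kap * decay n q0 ^+ k * (u1 x * u2 x) =
          Kt * kap * (u1 x * u2 x) * \sum_(k < K) decay n q0 ^+ k.
        by rewrite mulr_sumr; apply: eq_bigr => k _; rewrite mulrAC.
      have -> : Kd * kap * (u1 x * u2 x) = Kt * kap * (u1 x * u2 x) * (1 - decay n q0)^-1.
        by rewrite /Kd; ring.
      apply: ler_wpM2l; last by rewrite geo_sum_le// d0.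
      exact: mulr_ge0 Kkap0 (mulr_ge0 (u10 x) (u20 x)).
    by rewrite ge0_ler_powR ?nnegrE ?(ltW q_gt0)// (le_trans sZ0).
have A0' := ltW A0; have Kk0 : 0 <= Kd * kap := mulr_ge0 (ltW Kd0) (ltW kap0).
apply: (le_trans (int_powR_combine (measurable_cube a r) mS mu1 mu2 S0 u10 u20 q_gt0
  A0' Kk0 Sq (HK3 a r r0) (HK4 a r r0))).
rewrite lee_fin -[leRHS]mulrA -[leRHS]mulrA ler_pM2l ?powR_gt0//.
set W := M `^ q * r `^ (N - N * q / q0); rewrite mulrDl; apply: lerD.
  rewrite [leRHS]mulrAC; apply: ler_wpM2r; first exact: ltW.
  have r40 : 0 < 2 ^+ 2 * r by exact: R0.
  have GG : G1 * G2 <= M * (2 ^+ 2 * r) `^ E.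
    have -> : G1 * G2 = F1 * F2 * (2 ^+ 2 * r) `^ (N / p).
      rewrite /G1 /G2 mulrACA -powRD ?(gt_eqF v0) ?implybT// -pE /v -powR_mulrn ?(ltW r40)//.
      by rewrite -powRrM.
    apply: (@le_trans _ _ (M * (2 ^+ 2 * r) `^ (- (N / p0)) * (2 ^+ 2 * r) `^ (N / p))).
      by apply: ler_wpM2r F12; exact: powR_ge0.
    rewrite -mulrA -powRD ?(gt_eqF r40) ?implybT// [_ + N / p]addrC.
    exact: lexx.
  apply: (@le_trans _ _ ((c12 * (M * (2 ^+ 2 * r) `^ E)) `^ q)).
    have GG0 : 0 <= c12 * (M * (2 ^+ 2 * r) `^ E).
      by rewrite !mulr_ge0 ?powR_ge0 ?(ltW c120) ?(ltW M0).
    by rewrite ge0_ler_powR ?nnegrE ?(ltW q_gt0)// ler_pM2l.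
  rewrite (powRM _ (ltW c120)) ?mulr_ge0 ?powR_ge0 ?(ltW M0)//.
  rewrite (powRM _ (ltW M0)) ?powR_ge0// -powRrM powRM ?exprn_ge0 ?(ltW r0)//.
  rewrite /W -scaling_exponent -/E (mulrC q E) -natrX.
  by rewrite le_eqVlt; apply/orP; left; apply/eqP; ring.
rewrite -mulrDl [(K3 + K4) * _]mulrC mulrA [leRHS]mulrAC; apply: ler_wpM2r.
  by rewrite addr_ge0// ltW.
rewrite (powRM _ (ltW Kd0) (ltW kap0)) -mulrA ler_pM2l ?powR_gt0// /kap.
rewrite (powRM _ (ltW M0) (powR_ge0 _ _)) -powRrM -(powR_mulrn n (ltW r0)) -mulrA.
rewrite -powRD ?(gt_eqF r0) ?implybT// /W (_ : - (N / q0) * q + N = N - N * q / q0)//.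
ring.
Qed.

End commutator_series.

(** * Measurability of the commutator *)

Lemma measurable_snd_fst d1 d2 d3 (T1 : measurableType d1) (T2 : measurableType d2)
  (T3 : measurableType d3) : measurable_fun [set: T1 * (T2 * T3)] (fun z => z.2.1).
Proof. exact: (measurableT_comp measurable_fst measurable_snd). Qed.

Lemma measurable_snd_snd d1 d2 d3 (T1 : measurableType d1) (T2 : measurableType d2)
  (T3 : measurableType d3) : measurable_fun [set: T1 * (T2 * T3)] (fun z => z.2.2).
Proof. exact: (measurableT_comp measurable_snd measurable_snd). Qed.

Section iterated.
Context d (T : measurableType d) (R : realType) (mu : {sigma_finite_measure set T -> \bar R}).

(** The integral is iterated: regrouping (x, (y, z)) as ((x, y), z) lets the measurability part of
    Tonelli's theorem be used twice. *)
Lemma measurable_int_prod (F : T * (T * T) -> \bar R) :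
  measurable_fun [set: T * (T * T)] F -> (forall z, 0 <= F z)%E ->
  measurable_fun [set: T] (fun x => \int[mu \x mu]_y F (x, y))%E.
Proof.
move=> mF F0.
have mS x : measurable_fun [set: T * T] (fun y => F (x, y)).
  exact: (measurableT_comp mF (measurable_fun_pair (measurable_cst x) (@measurable_id _ _ setT))).
pose H (w : (T * T) * T) := F (w.1.1, (w.1.2, w.2)).
have mH : measurable_fun [set: (T * T) * T] H.
  apply: (measurableT_comp mF); apply: measurable_fun_pair.
    exact: (measurableT_comp measurable_fst measurable_fst).
  apply: measurable_fun_pair; last exact: measurable_snd.
  exact: (measurableT_comp measurable_snd measurable_fst).
have mK := @measurable_fun_fubini_tonelli_F _ _ _ _ _ mu H mH (fun w => F0 _).
have K0 w : (0 <= fubini_F mu H w)%E by apply: integral_ge0 => y _; exact: F0.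
have := @measurable_fun_fubini_tonelli_F _ _ _ _ _ mu _ mK K0.
apply: eq_measurable_fun => x _.
by rewrite (fubini_tonelli1 (fun y => F (x, y)) (mS x) (fun y => F0 _)).
Qed.

End iterated.

Section commutator.
Context (R : realType) (n : nat) (b1 b2 f1 f2 : Rn R n -> R) (alpha : R).
Local Notation mu := (@lebesgue R n).
Hypotheses (mb1 : measurable_fun [set: Rn R n] b1) (mb2 : measurable_fun [set: Rn R n] b2)
  (mf1 : measurable_fun [set: Rn R n] f1) (mf2 : measurable_fun [set: Rn R n] f2).
Local Notation integrand := (commutator_integrand b1 b2 alpha f1 f2).

Lemma measurable_integrand2 :
  measurable_fun [set: Rn R n * (Rn R n * Rn R n)] (fun z => (integrand z.1 z.2)%:E).
Proof.
have m1 := @measurable_snd_fst _ _ _ (Rn R n) (Rn R n) (Rn R n).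
have m2 := @measurable_snd_snd _ _ _ (Rn R n) (Rn R n) (Rn R n).
apply/measurable_EFinP; rewrite /commutator_integrand.
have mk := measurable_kernel measurable_fst m1 m2 alpha.
have c (f : Rn R n -> R) (g : Rn R n * (Rn R n * Rn R n) -> Rn R n) :
    measurable_fun [set: Rn R n] f -> measurable_fun [set: Rn R n * (Rn R n * Rn R n)] g ->
    measurable_fun [set: Rn R n * (Rn R n * Rn R n)] (fun z => f (g z)).
  by move=> mf mg; exact: (measurableT_comp mf mg).
exact: (measurable_funM (measurable_funM (measurable_funM (measurable_funM
  (measurable_funB (c _ _ mb1 measurable_fst) (c _ _ mb1 m1))
  (measurable_funB (c _ _ mb2 measurable_fst) (c _ _ mb2 m2))) (c _ _ mf1 m1)) (c _ _ mf2 m2)) mk).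
Qed.

Lemma measurable_integrand x : measurable_fun [set: Rn R n * Rn R n] (EFin \o integrand x).
Proof.
exact: (measurableT_comp measurable_integrand2
  (measurable_fun_pair (measurable_cst x) (@measurable_id _ _ setT))).
Qed.

(** No convergence is assumed: the integral is the difference of those of the positive and negative
    parts, and [fine] is measurable on the extended reals. *)
Lemma measurable_commutator : measurable_fun [set: Rn R n] (commutator b1 b2 alpha f1 f2).
Proof.
rewrite /commutator /Rintegral; apply: (measurableT_comp (@fine_measurable R setT measurableT)).
rewrite (_ : (fun x => _) = (fun x =>
  \int[mu \x mu]_y ((fun z => (integrand z.1 z.2)%:E)^\+ (x, y)) -
  \int[mu \x mu]_y ((fun z => (integrand z.1 z.2)%:E)^\- (x, y))))%E; last first.
  by apply/funext => x; rewrite [LHS]integralE; congr (_ - _)%E; apply: eq_integral => y _; rewrite ?funeposE ?funenegE.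
apply: emeasurable_funB; apply: measurable_int_prod => //.
- exact: (measurable_funepos measurable_integrand2).
- exact: (measurable_funeneg measurable_integrand2).
Qed.

Lemma abs_integrandE x y : `|integrand x y| =
  kernel alpha x y.1 y.2 * (weight b1 (fun z => `|f1 z|) x y.1 * weight b2 (fun z => `|f2 z|) x y.2).
Proof.
rewrite /commutator_integrand !normrM normfV (ger0_norm (powR_ge0 _ _)) /kernel /weight.
ring.
Qed.

(** Where the integral is infinite, [fine] returns 0 and the inequality still holds. *)
Lemma le_abs_commutator x :
  ((`|commutator b1 b2 alpha f1 f2 x|)%:E <= \int[mu \x mu]_y (`|integrand x y|)%:E)%E.
Proof.
apply: le_trans (le_abse_integral (mu \x mu)%E measurableT (measurable_integrand x)).
rewrite /commutator /Rintegral; case: (integral _ _ _) => [c| |]; rewrite /= ?leey//.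
Qed.

End commutator.

(** * Morrey norms and integrals over cubes *)

Lemma morrey_norm_le (R : realType) n (q0 q K : R) (g : Rn R n -> R) : 0 < q -> 0 < q0 -> 0 <= K ->
  (forall a r, 0 < r -> (\int[@lebesgue R n]_(x in cube a r) (`|g x| `^ q)%:E <=
     (K `^ q * r `^ (n%:R - n%:R * q / q0))%:E)%E) ->
  (morrey_norm q0 q g <= K%:E)%E.
Proof.
move=> q_gt0 q0_gt0 K0 h; apply: ge_ereal_sup => _ [Q [a [r [r0 ->]]] <-].
have rn0 : 0 < r ^+ n by rewrite exprn_gt0.
rewrite /pmean lebesgue_cube// inver gt_eqF// poweR_EFin.
set I := (\int[_]_(x in _) _)%E.
have I0 : (0 <= I)%E by apply: integral_ge0 => y _; rewrite lee_fin powR_ge0.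
have hI : (I <= (K `^ q * r `^ (n%:R - n%:R * q / q0))%:E)%E by exact: h.
have : I \is a fin_num by rewrite ge0_fin_numE//; exact: le_lt_trans hI (ltry _).
move=> /fineK Ie; rewrite -Ie in I0 hI *; move: (fine I) I0 hI => i.
rewrite !lee_fin => i0 hi.
apply: (@le_trans _ _ ((r ^+ n) `^ q0^-1 *
    ((r ^+ n)^-1 * (K `^ q * r `^ (n%:R - n%:R * q / q0))) `^ q^-1)).
  have rni : 0 <= (r ^+ n)^-1 by rewrite invr_ge0 ltW.
  rewrite ler_wpM2l ?powR_ge0// ge0_ler_powR ?nnegrE ?invr_ge0 ?(ltW q_gt0)//.
  - exact: mulr_ge0.
  - by rewrite mulr_ge0// mulr_ge0 ?powR_ge0.
  - exact: ler_wpM2l.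
have -> : (r ^+ n)^-1 * (K `^ q * r `^ (n%:R - n%:R * q / q0)) =
    K `^ q * r `^ (- (n%:R * q / q0)).
  rewrite powRD ?(gt_eqF r0) ?implybT// powR_mulrn ?(ltW r0)//.
  by field; rewrite gt_eqF.
rewrite (powRM _ (powR_ge0 _ _) (powR_ge0 _ _)) -!powRrM mulfV ?gt_eqF// powRr1//.
rewrite -powR_mulrn ?(ltW r0)// -powRrM mulrCA -powRD ?(gt_eqF r0) ?implybT//.
rewrite (_ : _ + _ = 0) ?powRr0 ?mulr1//.
by field; rewrite !gt_eqF.
Qed.

(** If one factor vanishes, the other one, x, is raised to x + 1 and the vanishing one to M / (x +
    1), which keeps the product at M. *)
Lemma choose_factors (R : realType) (x1 x2 M : R) : 0 <= x1 -> 0 <= x2 -> 0 < M ->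
  x1 * x2 <= M -> exists F1 F2 : R, [/\ 0 < F1, 0 < F2, x1 <= F1, x2 <= F2 & F1 * F2 <= M].
Proof.
move=> h1 h2 M0 h; move: h1 h2; rewrite le_eqVlt => /predU1P[<-|h1].
  move=> h2; have e : 0 < x2 + 1 by rewrite ltr_wpDl.
  exists (M / (x2 + 1)), (x2 + 1); split => //; first by rewrite divr_gt0.
  - by rewrite divr_ge0// ltW.
  - by rewrite lerDl.
  - by rewrite divfK// gt_eqF.
rewrite le_eqVlt => /predU1P[<-|h2]; last by exists x1, x2.
have e : 0 < x1 + 1 by rewrite ltr_pwDl// ltW.
exists (x1 + 1), (M / (x1 + 1)); split => //; first by rewrite divr_gt0.
- by rewrite lerDl.
- by rewrite divr_ge0// ltW.
- by rewrite mulrC divfK// gt_eqF.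
Qed.

Section norms.
Context (R : realType) (n : nat).
Local Notation mu := (@lebesgue R n).

Lemma pmean_cube s (f : Rn R n -> R) a r : 0 < r ->
  pmean s f (cube a r) =
  ((((r ^+ n)^-1)%:E * \int[mu]_(x in cube a r) (`|f x| `^ s)%:E) `^ s^-1)%E.
Proof. by move=> r0; rewrite /pmean lebesgue_cube// inver gt_eqF// exprn_gt0. Qed.

Lemma pmean_ge0 s (f : Rn R n -> R) Q : (0 <= pmean s f Q)%E.
Proof. exact: poweR_ge0. Qed.

Lemma multi_morrey_norm_ge p0 p1 p2 (f1 f2 : Rn R n -> R) a r : 0 < r ->
  (((r ^+ n) `^ p0^-1)%:E * (pmean p1 f1 (cube a r) * pmean p2 f2 (cube a r)) <=
   multi_morrey_norm p0 p1 p2 f1 f2)%E.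
Proof.
move=> r0; apply: ereal_sup_ubound; exists (cube a r); first by exists a, r.
by rewrite lebesgue_cube.
Qed.

Lemma multi_morrey_norm_ge0 p0 p1 p2 (f1 f2 : Rn R n -> R) :
  (0 <= multi_morrey_norm p0 p1 p2 f1 f2)%E.
Proof.
apply: le_trans (multi_morrey_norm_ge p0 p1 p2 f1 f2 (vec (fun=> 0)) ltr01).
by rewrite mule_ge0 ?lee_fin ?powR_ge0// mule_ge0 ?pmean_ge0.
Qed.

Lemma fin_factors (c N : R) (x y : \bar R) : 0 < c -> (0 < x)%E -> (0 < y)%E ->
  (c%:E * (x * y) <= N%:E)%E -> (x < +oo)%E /\ (y < +oo)%E.
Proof.
move=> c0; case: x => [x| |]//; case: y => [y| |]//.
- by move=> _ _ _; rewrite !ltry.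
- by move=> x0 _; rewrite gt0_muley// gt0_muley.
- by move=> _ y0; rewrite gt0_mulye// gt0_muley.
- by move=> _ _; rewrite mulyy gt0_muley.
Qed.

Lemma lty_scale_poweR (c s : R) (x : \bar R) : 0 < c -> 0 < s -> (0 < x)%E ->
  ((c%:E * x) `^ s^-1 < +oo)%E -> (x < +oo)%E.
Proof.
move=> c0 s0; case: x => [x _ _| _|//]; first exact: ltry.
by rewrite gt0_muley ?lte_fin// poweRyr// invr_eq0 gt_eqF.
Qed.

Lemma int_powR_ge0 s (f : Rn R n -> R) Q : (0 <= \int[mu]_(x in Q) (`|f x| `^ s)%:E)%E.
Proof. by apply: integral_ge0 => y _; rewrite lee_fin powR_ge0. Qed.

Lemma le_int_powR s (f : Rn R n -> R) P Q : measurable_fun [set: Rn R n] f ->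
  measurable P -> measurable Q -> P `<=` Q ->
  (\int[mu]_(x in P) (`|f x| `^ s)%:E <= \int[mu]_(x in Q) (`|f x| `^ s)%:E)%E.
Proof.
move=> mf mP mQ PQ; apply: (ge0_subset_integral mu mP mQ _ _ PQ).
- apply: measurable_funTS; apply: measurable_EFin_powR.
  exact: (measurableT_comp (@normr_measurable R setT) mf).
- by move=> x _; rewrite lee_fin powR_ge0.
Qed.

End norms.

Section cases.
Context (R : realType) (n : nat) (n_gt0 : (0 < n)%N).
Context (p0 p1 p2 : R) (f1 f2 : Rn R n -> R).
Hypotheses (p1_gt1 : 1 < p1) (p2_gt1 : 1 < p2).
Hypotheses (mf1 : measurable_fun [set: Rn R n] f1) (mf2 : measurable_fun [set: Rn R n] f2).
Local Notation mu := (@lebesgue R n).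
Local Notation Q j := (dcube (vec (fun=> 0 : R)) 1 j : set (Rn R n)).

Lemma cube_sub_dcube (a : Rn R n) r : exists j, cube a r `<=` Q j.
Proof.
have [j /in_dcube hj] := @dcube_exhaust R n n_gt0 (vec (fun=> 0)) 1 ltr01
  (vec (fun i => `|rcoord a i| + `|r|)).
exists j => y h; apply/in_dcube => i; have := hj i; rewrite !rcoord_vec !subr0.
rewrite ger0_norm ?addr_ge0//; apply: le_trans.
have /andP[y1 y2] := h i; have := ler_norm r; have := normr_ge0 r.
have := ler_norm (rcoord a i); have := ler_norm (- rcoord a i); rewrite normrN => *.
by rewrite ler_norml; apply/andP; split; lra.
Qed.

(** On a dilate large enough for both integrals to be nonzero, a finite norm forces both to be
    finite, and every cube contained in it inherits this. On small cubes a mean may still vanish,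
    hence the use of [choose_factors]. *)
Lemma cube_factors_norm N j1 j2 :
  multi_morrey_norm p0 p1 p2 f1 f2 = N%:E ->
  (\int[mu]_(x in Q j1) (`|f1 x| `^ p1)%:E != 0)%E ->
  (\int[mu]_(x in Q j2) (`|f2 x| `^ p2)%:E != 0)%E ->
  0 < N /\ cube_factors p1 p2 p0 N (fun y => `|f1 y|) (fun y => `|f2 y|).
Proof.
move=> NE nz1 nz2.
have p10 : 0 < p1 by exact: lt_trans p1_gt1.
have p20 : 0 < p2 by exact: lt_trans p2_gt1.
have mQ j : measurable (Q j) by exact: measurable_cube.
have big j : (j1 <= j)%N -> (j2 <= j)%N ->
  [/\ 0 < N, (\int[mu]_(x in Q j) (`|f1 x| `^ p1)%:E < +oo)%E &
    (\int[mu]_(x in Q j) (`|f2 x| `^ p2)%:E < +oo)%E].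
  move=> h1 h2.
  have I1 : (0 < \int[mu]_(x in Q j) (`|f1 x| `^ p1)%:E)%E.
    apply: (@lt_le_trans _ _ (\int[mu]_(x in Q j1) (`|f1 x| `^ p1)%:E)%E).
      by rewrite lt0e nz1 int_powR_ge0.
    by apply: le_int_powR mf1 (mQ _) (mQ _) _; exact: dcube_le.
  have I2 : (0 < \int[mu]_(x in Q j) (`|f2 x| `^ p2)%:E)%E.
    apply: (@lt_le_trans _ _ (\int[mu]_(x in Q j2) (`|f2 x| `^ p2)%:E)%E).
      by rewrite lt0e nz2 int_powR_ge0.
    by apply: le_int_powR mf2 (mQ _) (mQ _) _; exact: dcube_le.
  have s0 := @dcube_side_gt0 R 1 j ltr01; have sn0 := exprn_gt0 n s0.
  have := multi_morrey_norm_ge p0 p1 p2 f1 f2 (vec (fun i => rcoord (vec (fun=> 0 : R)) i - 2 ^+ j.+1 * 1)) s0.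
  rewrite NE !pmean_cube//.
  move: I1 I2; set X := integral _ _ _; set Y := integral _ _ _ => X0 Y0 le.
  have c0 : 0 < ((2 ^+ j.+2 * 1) ^+ n) `^ p0^-1 :> R by exact: powR_gt0.
  have X1 : (0 < (((2 ^+ j.+2 * 1) ^+ n)^-1%:E * X) `^ p1^-1)%E.
    by apply: poweR_gt0; rewrite mule_gt0// lte_fin invr_gt0.
  have Y1 : (0 < (((2 ^+ j.+2 * 1) ^+ n)^-1%:E * Y) `^ p2^-1)%E.
    by apply: poweR_gt0; rewrite mule_gt0// lte_fin invr_gt0.
  have [Xoo Yoo] := fin_factors c0 X1 Y1 le.
  split.
  - by rewrite -lte_fin; apply: lt_le_trans le; rewrite mule_gt0 ?lte_fin// mule_gt0.
  - by apply: lty_scale_poweR X0 Xoo => //; rewrite invr_gt0.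
  - by apply: lty_scale_poweR Y0 Yoo => //; rewrite invr_gt0.
have N0 : 0 < N by have [] := big _ (leq_maxl j1 j2) (leq_maxr j1 j2).
split => // a r r0; have [j0 hj0] := cube_sub_dcube a r.
pose j := maxn j0 (maxn j1 j2).
have [|| _ fin1 fin2] := big j.
- by rewrite /j !leq_max leqnn orbT.
- by rewrite /j !leq_max leqnn !orbT.
have sub : cube a r `<=` Q j.
  by move=> y /hj0; apply: dcube_le => //; rewrite leq_maxl.
have mc := measurable_cube a r; have rn0 : 0 < r ^+ n by rewrite exprn_gt0.
have := le_lt_trans (le_int_powR p1 mf1 mc (mQ j) sub) fin1.
have := le_lt_trans (le_int_powR p2 mf2 mc (mQ j) sub) fin2.
have := multi_morrey_norm_ge p0 p1 p2 f1 f2 a r0; rewrite NE !pmean_cube//.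
have := int_powR_ge0 p1 f1 (cube a r); have := int_powR_ge0 p2 f2 (cube a r).
case: (\int[mu]_(x in cube a r) (`|f2 x| `^ p2)%:E)%E => // i2.
case: (\int[mu]_(x in cube a r) (`|f1 x| `^ p1)%:E)%E => // i1.
rewrite !lee_fin => i20 i10 le _ _.
have c0 : 0 < r `^ (- (n%:R / p0)) by exact: powR_gt0.
have : ((r ^+ n)^-1 * i1) `^ p1^-1 * ((r ^+ n)^-1 * i2) `^ p2^-1 <= N * r `^ (- (n%:R / p0)).
  rewrite powRN ler_pdivlMr ?powR_gt0// mulrC.
  by rewrite powRrM powR_mulrn ?(ltW r0).
move=> /(choose_factors (powR_ge0 _ _) (powR_ge0 _ _) (mulr_gt0 N0 c0))[F1 [F2 [F10 F20 x1 x2 F12]]].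
have fin s i F : 0 < s -> 0 <= i -> 0 < F -> ((r ^+ n)^-1 * i) `^ s^-1 <= F ->
    i <= F `^ s * r ^+ n.
  move=> s0 i0 F0 h; rewrite -ler_pdivrMr// mulrC.
  have w0 : 0 <= (r ^+ n)^-1 * i by rewrite mulr_ge0// invr_ge0 ltW.
  have sN0 : s != 0 by rewrite gt_eqF.
  rewrite -[leLHS]powRr1// -(mulVf sN0) powRrM.
  by rewrite ge0_ler_powR ?nnegrE ?powR_ge0 ?(ltW s0) ?(ltW F0).
by exists F1, F2; split => //; rewrite lee_fin; apply: fin.
Qed.

Lemma ae_zero s (f : Rn R n -> R) : measurable_fun [set: Rn R n] f -> 0 < s ->
  (forall j, \int[mu]_(x in Q j) (`|f x| `^ s)%:E = 0)%E -> {ae mu, forall x, f x = 0}.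
Proof.
move=> mf s0 h.
have mp : measurable_fun [set: Rn R n] (fun x => (`|f x| `^ s)%:E).
  apply: measurable_EFin_powR.
  exact: (measurableT_comp (@normr_measurable R setT) mf).
have /ae_foralln : forall j, {ae mu, forall x, Q j x -> (`|f x| `^ s)%:E = cst 0%E x}.
  move=> j; apply/(ae_eq_integral_abs mu (measurable_cube _ _) (measurable_funTS mp)).
  rewrite -[RHS](h j); apply: eq_integral => x _.
  by rewrite gee0_abs// lee_fin powR_ge0.
apply: filterS => x hx; have [j hj] := @dcube_exhaust R n n_gt0 (vec (fun=> 0)) 1 ltr01 x.
have [/eqP] := hx j hj; rewrite powR_eq0 => /andP[/eqP/normr0_eq0].
by [].
Qed.

End cases.

Section null.
Context d (T : measurableType d) (R : realType) (mu : {sigma_finite_measure set T -> \bar R}).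
Context (F : T * T -> \bar R).
Hypotheses (mF : measurable_fun [set: T * T] F) (F_ge0 : forall z, (0 <= F z)%E).

Lemma int_prod_null1 : {ae mu, forall x, forall y, F (x, y) = 0%E} ->
  (\int[mu \x mu]_z F z = 0)%E.
Proof.
move=> h; rewrite (fubini_tonelli1 F mF F_ge0).
have mG := @measurable_fun_fubini_tonelli_F _ _ _ _ _ mu F mF F_ge0.
rewrite (@ge0_ae_eq_integral _ _ _ mu setT _ (cst 0%E) measurableT mG (measurable_cst _)) //.
- by rewrite integral0_eq.
- by move=> x _; apply: integral_ge0.
- by apply: filterS h => x hx _; apply: integral0_eq => y _; exact: hx.
Qed.

Lemma int_prod_null2 : {ae mu, forall y, forall x, F (x, y) = 0%E} ->
  (\int[mu \x mu]_z F z = 0)%E.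
Proof.
move=> h; rewrite (fubini_tonelli2 F mF F_ge0).
have mG := @measurable_fun_fubini_tonelli_G _ _ _ _ _ mu F mF F_ge0.
rewrite (@ge0_ae_eq_integral _ _ _ mu setT _ (cst 0%E) measurableT mG (measurable_cst _)) //.
- by rewrite integral0_eq.
- by move=> x _; apply: integral_ge0.
- by apply: filterS h => x hx _; apply: integral0_eq => y _; exact: hx.
Qed.

End null.

Section part1.
Context (R : realType) (n : nat) (n_gt0 : (0 < n)%N).
Context (alpha p1 p2 p p0 q q0 : R) (b1 b2 : Rn R n -> R).
Local Notation N := (n%:R : R).
Local Notation mu := (@lebesgue R n).
Local Notation e := (alpha / N).
Hypotheses (alpha_lt : 0 < alpha < 2 * N) (p1_gt1 : 1 < p1) (p2_gt1 : 1 < p2)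
  (p_gt0 : 0 < p) (q_gt0 : 0 < q) (q0_gt0 : 0 < q0).
Hypotheses (pE : p^-1 = p1^-1 + p2^-1) (qE : q^-1 = p^-1 - e) (q0E : q0^-1 = p0^-1 - e).

Lemma commutator_bound_of_bmo : BMO b1 -> BMO b2 -> exists2 C : R, 0 < C & forall f1 f2,
  multi_morrey p0 p1 p2 f1 f2 ->
  commutator_defined b1 b2 alpha f1 f2 /\
  (morrey_norm q0 q (commutator b1 b2 alpha f1 f2) <=
   C%:E * multi_morrey_norm p0 p1 p2 f1 f2)%E.
Proof.
move=> bmo1 bmo2; have lb1 := bmo1.1; have lb2 := bmo2.1.
have [B1 B10 osc1'] := bmo_bound bmo1; have [B2 B20 osc2'] := bmo_bound bmo2.
have B0 : 0 < B1 + B2 by exact: addr_gt0.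
have osc1 a r : 0 < r -> (\int[mu]_(x in cube a r) (`|b1 x - average b1 (cube a r)|)%:E <=
    ((B1 + B2) * r ^+ n)%:E)%E.
  move=> r0; apply: (le_trans (osc1' a r r0)); rewrite lee_fin ler_wpM2r ?exprn_ge0 ?(ltW r0)//.
  by rewrite lerDl ltW.
have osc2 a r : 0 < r -> (\int[mu]_(x in cube a r) (`|b2 x - average b2 (cube a r)|)%:E <=
    ((B1 + B2) * r ^+ n)%:E)%E.
  move=> r0; apply: (le_trans (osc2' a r r0)); rewrite lee_fin ler_wpM2r ?exprn_ge0 ?(ltW r0)//.
  by rewrite lerDr ltW.
have [C C0 HC] := commutator_series n_gt0 alpha_lt p1_gt1 p2_gt1 p_gt0 q_gt0 q0_gt0 B0
  pE qE q0E lb1 lb2 osc1 osc2.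
exists (C `^ q^-1); first exact: powR_gt0.
move=> f1 f2 [mf1 mf2 noo].
have mI x := measurable_integrand alpha lb1.1 lb2.1 mf1 mf2 x.
have mAI x : measurable_fun [set: Rn R n * Rn R n]
    (fun y => (`|commutator_integrand b1 b2 alpha f1 f2 x y|)%:E).
  have /measurable_EFinP h := mI x.
  by apply/measurable_EFinP; exact: (measurableT_comp (@normr_measurable R setT) h).
have AI0 x y : (0 <= (`|commutator_integrand b1 b2 alpha f1 f2 x y|)%:E)%E by rewrite lee_fin.
have defined x : (\int[mu \x mu]_y (`|commutator_integrand b1 b2 alpha f1 f2 x y|)%:E < +oo)%E ->
    (mu \x mu)%E.-integrable [set: Rn R n * Rn R n]
     (EFin \o commutator_integrand b1 b2 alpha f1 f2 x).
  by move=> h; apply/integrableP; split; [exact: mI|exact: h].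
have n0 := multi_morrey_norm_ge0 p0 p1 p2 f1 f2.
have Cq0 : 0 <= C `^ q^-1 by exact: powR_ge0.
have mc := measurable_commutator alpha lb1.1 lb2.1 mf1 mf2.
have mac : measurable_fun [set: Rn R n] (fun x => `|commutator b1 b2 alpha f1 f2 x|).
  exact: (measurableT_comp (@normr_measurable R setT) mc).
(* Serves the cases where f1 or f2 vanishes almost everywhere, which [cube_factors_norm] leaves
   out. *)
have zero : (forall x, \int[mu \x mu]_y
    (`|commutator_integrand b1 b2 alpha f1 f2 x y|)%:E = 0)%E ->
    commutator_defined b1 b2 alpha f1 f2 /\
    (morrey_norm q0 q (commutator b1 b2 alpha f1 f2) <=
     (C `^ q^-1)%:E * multi_morrey_norm p0 p1 p2 f1 f2)%E.
  move=> h; split; first by apply: aeW => x; apply: defined; rewrite h ltry.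
  apply: (@le_trans _ _ 0%:E); last by rewrite mule_ge0 ?lee_fin.
  apply: morrey_norm_le => // a r r0; rewrite powR0 ?gt_eqF// mul0r integral0_eq// => x _.
  have := le_abs_commutator alpha lb1.1 lb2.1 mf1 mf2 x; rewrite h lee_fin => c0.
  have -> : `|commutator b1 b2 alpha f1 f2 x| = 0 by apply/eqP; rewrite eq_le c0 normr_ge0.
  by rewrite powR0// gt_eqF.
have p10 : 0 < p1 by exact: lt_trans p1_gt1.
have p20 : 0 < p2 by exact: lt_trans p2_gt1.
pose Q j : set (Rn R n) := dcube (vec (fun=> 0 : R)) 1 j.
have [h1|/existsNP[j1 /eqP nz1]] :=
    pselect (forall j, \int[mu]_(x in Q j) (`|f1 x| `^ p1)%:E = 0)%E.
  apply: zero => x; apply: (int_prod_null1 (mAI x) (AI0 x)).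
  have := ae_zero n_gt0 mf1 p10 h1; apply: filterS => y1 hy y2.
  by rewrite /commutator_integrand/= hy mulr0 !mul0r normr0.
have [h2|/existsNP[j2 /eqP nz2]] :=
    pselect (forall j, \int[mu]_(x in Q j) (`|f2 x| `^ p2)%:E = 0)%E.
  apply: zero => x; apply: (int_prod_null2 (mAI x) (AI0 x)).
  have := ae_zero n_gt0 mf2 p20 h2; apply: filterS => y1 hy y2.
  by rewrite /commutator_integrand/= hy mulr0 !mul0r normr0.
have /fineK NE : multi_morrey_norm p0 p1 p2 f1 f2 \is a fin_num by rewrite ge0_fin_numE.
set M := fine _ in NE; rewrite -NE.
have [M0 HM] := cube_factors_norm n_gt0 p1_gt1 p2_gt1 mf1 mf2 (esym NE) nz1 nz2.
have mg (f : Rn R n -> R) : measurable_fun [set: Rn R n] f ->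
    measurable_fun [set: Rn R n] (fun y => `|f y|).
  by move=> mf; exact: (measurableT_comp (@normr_measurable R setT) mf).
have series a r : 0 < r -> exists Z : nat -> Rn R n -> R,
  [/\ forall k, measurable_fun [set: Rn R n] (Z k), forall k x, 0 <= Z k x,
    forall x, cube a r x -> (\int[mu \x mu]_y
      (`|commutator_integrand b1 b2 alpha f1 f2 x y|)%:E <= \sum_(k <oo) (Z k x)%:E)%E &
    forall K, (\int[mu]_(x in cube a r) ((\sum_(k < K) Z k x) `^ q)%:E <=
      (C * M `^ q * r `^ (N - N * q / q0))%:E)%E].
  move=> r0; have [Z [mZ Z0 leZ sZ]] := HC M a r _ _ M0 r0 (mg _ mf1) (mg _ mf2)
    (fun y => normr_ge0 (f1 y)) (fun y => normr_ge0 (f2 y)) HM.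
  exists Z; split => // x xQ; apply: le_trans (leZ x xQ).
  by apply: le_of_eq; apply: eq_integral => y _; rewrite abs_integrandE.
split.
  (* The series controls one cube at a time; countably many dilates exhaust the space, so the
     exceptional null sets can be united. *)
  have /ae_foralln : forall j, {ae mu, forall x, Q j x -> (\int[mu \x mu]_y
      (`|commutator_integrand b1 b2 alpha f1 f2 x y|)%:E < +oo)%E}.
    move=> j; have [Z [mZ Z0 leZ sZ]] := series
      (vec (fun i => rcoord (vec (fun=> 0 : R)) i - 2 ^+ j.+1 * 1)) _ (dcube_side_gt0 j ltr01).
    have := ae_series_lty (measurable_cube _ _) q_gt0 mZ Z0 sZ.
    by apply: filterS => x h xQ; exact: le_lt_trans (leZ x xQ) (h xQ).
  apply: filterS => x hx; apply: defined.
  have [j hj] := @dcube_exhaust R n n_gt0 (vec (fun=> 0)) 1 ltr01 x.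
  exact: hx j hj.
rewrite -EFinM; apply: morrey_norm_le => //; first by rewrite mulr_ge0// ltW.
move=> a r r0; have [Z [mZ Z0 leZ sZ]] := series a r r0.
have -> : (C `^ q^-1 * M) `^ q = C * M `^ q.
  rewrite (powRM _ Cq0 (ltW M0)) -powRrM mulVf ?gt_eqF// powRr1//.
  exact: ltW.
apply: (int_powR_le_series (measurable_cube a r) q_gt0 mZ Z0 sZ mac) => x.
  exact: normr_ge0.
by move=> xQ; exact: le_trans (le_abs_commutator alpha lb1.1 lb2.1 mf1 mf2 x) (leZ x xQ).
Qed.

Lemma commutator_bounded_of_bmo : BMO b1 -> BMO b2 ->
  commutator_bounded b1 b2 alpha p0 p1 p2 q0 q.
Proof.
move=> bmo1 bmo2; have [C C0 HC] := commutator_bound_of_bmo bmo1 bmo2.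
split; last by exists C => f1 f2 mm; have [] := HC f1 f2 mm.
move=> f1 f2 mm; have [def le] := HC f1 f2 mm; split; first exact: def.
case: mm => mf1 mf2 noo.
split; first exact: (measurable_commutator alpha bmo1.1.1 bmo2.1.1 mf1 mf2).
apply: (le_lt_trans le); have C0' : (0 <= C%:E)%E by rewrite lee_fin ltW.
exact: (lte_mul_pinfty C0' isT noo).
Qed.

End part1.

(** * Necessity of BMO *)

Section median.
Context d (T : measurableType d) (R : realType) (mu : {measure set T -> \bar R}).

Lemma measure_bigcap_ge (A : nat -> set T) (c : \bar R) :
  (mu (A 0%N) < +oo)%E -> (forall k, measurable (A k)) ->
  (forall k, A k.+1 `<=` A k) -> (forall k, c <= mu (A k))%E ->
  (c <= mu (\bigcap_k A k))%E.
Proof.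
move=> A0 mA ndA h.
have nd : nonincreasing_seq A.
  move=> i j /subnKC <-; apply/subsetPset; elim: (j - i)%N => [|k IH]; first by rewrite addn0.
  by rewrite addnS; apply: subset_trans IH; exact: ndA.
have := nonincreasing_cvg_mu A0 mA (bigcapT_measurable mA) nd.
by apply: cvge_ge; apply: nearW => k; exact: h.
Qed.

Context (D : set T) (v : R) (b : T -> R).
Hypotheses (mD : measurable D) (v_gt0 : 0 < v) (muD : mu D = v%:E).
Hypothesis mb : measurable_fun [set: T] b.

Let le_set t := D `&` [set x | b x <= t].
Let ge_set t := D `&` [set x | t <= b x].
Let half := (v / 2)%:E.

Let m_le t : measurable (le_set t).
Proof.
apply: measurableI => //; rewrite -[X in measurable X]setTI.
rewrite (_ : [set x | b x <= t] = b @^-1` `]-oo, t]%classic); first exact: mb.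
by apply/seteqP; split => x /=; rewrite in_itv.
Qed.

Let m_ge t : measurable (ge_set t).
Proof.
apply: measurableI => //; rewrite -[X in measurable X]setTI.
rewrite (_ : [set x | t <= b x] = b @^-1` `[t, +oo[%classic); first exact: mb.
by apply/seteqP; split => x /=; rewrite in_itv/= andbT.
Qed.

Let le_fin t : (mu (le_set t) < +oo)%E.
Proof.
apply: (@le_lt_trans _ _ (mu D)); last by rewrite muD ltry.
by apply: le_measure; rewrite ?inE//; exact: subIsetl.
Qed.

Let ge_fin t : (mu (ge_set t) < +oo)%E.
Proof.
apply: (@le_lt_trans _ _ (mu D)); last by rewrite muD ltry.
by apply: le_measure; rewrite ?inE//; exact: subIsetl.
Qed.

Let le_or_ge t : (half <= mu (le_set t))%E \/ (half <= mu (ge_set t))%E.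
Proof.
have [|h1] := leP half (mu (le_set t)); first by left.
have [|h2] := leP half (mu (ge_set t)); first by right.
have : (mu D <= mu (le_set t) + mu (ge_set t))%E.
  apply: le_trans (measureU2 _ (m_le t) (m_ge t)); apply: le_measure; rewrite ?inE//.
    exact: measurableU.
  by move=> x Dx; case: (leP (b x) t) => [|/ltW] h; [left|right].
have := lteD h1 h2; rewrite muD -EFinD => lt /le_lt_trans/(_ lt).
by rewrite lte_fin; lra.
Qed.

Let half_gt0 : (0 < half)%E. Proof. by rewrite lte_fin divr_gt0. Qed.

(** The infimum of the levels t for which b <= t on at least half of D. Such levels exist and are
    bounded below because b takes only finite values. By continuity from above the first inequality
    passes to the infimum; below it the opposite inequality holds on half of D, and this passes to
    the limit too. *)
Lemma median_exists : exists m : R,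
  (half <= mu (D `&` [set x | (b x <= m)%R]))%E /\ (half <= mu (D `&` [set x | (m <= b x)%R]))%E.
Proof.
pose S := [set t : R | (half <= mu (le_set t))%E].
have mono s t : s <= t -> (mu (le_set s) <= mu (le_set t))%E.
  move=> st; apply: le_measure; rewrite ?inE// => x [Dx bx]; split => //.
  exact: le_trans bx st.
have bnd (x : R) : exists k : nat, x < k%:R.
  exists (Num.bound `|x|); apply: (le_lt_trans (ler_norm x)).
  exact: archi_boundP (normr_ge0 x).
have S0 : S !=set0.
  apply/set0P/negP => /eqP S0.
  have : (half <= mu (\bigcap_k ge_set k%:R))%E.
    apply: measure_bigcap_ge => //.
      by move=> k x [Dx] /= h; split => //=; apply: le_trans h; rewrite ler_nat.
    move=> k; have [h|//] := le_or_ge k%:R.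
    by exfalso; have : S k%:R by []; rewrite S0.
  rewrite (_ : \bigcap_k _ = set0) ?measure0; first by rewrite leNgt half_gt0.
  apply/seteqP; split => // x h; have [k hk] := bnd (b x).
  by have [_] := h k I; rewrite /= leNgt hk.
have Slb : has_lbound S.
  apply: contrapT => h.
  have : (half <= mu (\bigcap_k le_set (- k%:R)%R))%E.
    apply: measure_bigcap_ge => //.
      by move=> k x [Dx] /= bx; split => //=; apply: (le_trans bx); rewrite lerN2 ler_nat.
    move=> k; apply: contrapT => hk; apply: h; exists (- k%:R) => t St.
    rewrite leNgt; apply/negP => /ltW tk; apply: hk.
    exact: le_trans St (mono _ _ tk).
  rewrite (_ : \bigcap_k _ = set0) ?measure0; first by rewrite leNgt half_gt0.
  apply/seteqP; split => // x hx; have [k hk] := bnd (- b x).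
  by have [_] := hx k I; rewrite /= lerNr leNgt hk.
have inv0 k : 0 < k.+1%:R^-1 :> R by rewrite invr_gt0.
have invS k : k.+2%:R^-1 <= k.+1%:R^-1 :> R by rewrite lef_pV2 ?posrE ?ler_nat.
have small (e : R) : 0 < e -> exists k, k.+1%:R^-1 < e :> R.
  move=> e0; have [k hk] := bnd e^-1; exists k.
  have k0 : 0 < k.+1%:R :> R by rewrite ltr0n.
  rewrite invf_plt ?posrE//; apply: (lt_trans hk); by rewrite ltr_nat.
set m := inf S; exists m; split.
  rewrite (_ : _ `&` _ = \bigcap_k le_set (m + k.+1%:R^-1)).
    apply: measure_bigcap_ge => //.
      by move=> k x [Dx] /= bx; split => //=; apply: (le_trans bx); rewrite lerD2l.
    move=> k; have [t St tm] := inf_adherent (inv0 k) (conj S0 Slb).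
    exact: le_trans St (mono _ _ (ltW tm)).
  apply/seteqP; split => x.
    by move=> [Dx] /= bx k _; split => //=; rewrite (le_trans bx)// lerDl ltW.
  move=> h; split; first by have [] := h 0%N I.
  rewrite /= leNgt; apply/negP => mbx.
  have [k hk] := small (b x - m) ltac:(by rewrite subr_gt0).
  have [_ /= hh] := h k I; rewrite ltrBrDl in hk.
  by have := le_lt_trans hh hk; rewrite ltxx.
rewrite (_ : _ `&` _ = \bigcap_k ge_set (m - k.+1%:R^-1)).
  apply: measure_bigcap_ge => //.
    move=> k x [Dx] /= bx; split => //=; apply: le_trans bx.
    by rewrite lerD2l lerN2.
  move=> k; have [h|//] := le_or_ge (m - k.+1%:R^-1).
  have : m <= m - k.+1%:R^-1 by exact: ge_inf Slb _ h.
  by rewrite lerDl oppr_ge0 leNgt inv0.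
apply/seteqP; split => x.
  by move=> [Dx] /= bx k _; split => //=; apply: le_trans bx; rewrite gerBl ltW.
move=> h; split; first by have [] := h 0%N I.
rewrite /= leNgt; apply/negP => mbx.
have [k hk] := small (m - b x) ltac:(by rewrite subr_gt0).
have [_ /= hh] := h k I; rewrite ltrBrDl in hk; rewrite lerBlDr in hh.
by have := le_lt_trans hh hk; rewrite ltxx.
Qed.

End median.

(** * Testing on indicators *)

Section indicator.
Context (R : realType) (n : nat) (p0 p1 p2 p : R).
Hypotheses (p1_gt0 : 0 < p1) (p2_gt0 : 0 < p2) (p_gt0 : 0 < p) (pp0 : p <= p0)
  (pE : p^-1 = p1^-1 + p2^-1).
Local Notation mu := (@lebesgue R n).

Lemma pmean_indic (E : set (Rn R n)) a r s : measurable E -> 0 < r -> 0 < s ->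
  exists w : R, [/\ 0 <= w, mu (E `&` cube a r) = w%:E &
    pmean s \1_E (cube a r) = ((w / r ^+ n) `^ s^-1)%:E].
Proof.
move=> mE r0 s0; have mc := measurable_cube a r.
have le : (mu (E `&` cube a r) <= (r ^+ n)%:E)%E.
  rewrite -(lebesgue_cube a r0); apply: le_measure; rewrite ?inE//.
    exact: measurableI.
have : mu (E `&` cube a r) \is a fin_num.
  by rewrite ge0_fin_numE//; exact: le_lt_trans le (ltry _).
move=> /fineK; set w := fine _ => wE; exists w; split => //.
  by rewrite -lee_fin wE; exact: measure_ge0.
rewrite pmean_cube// (_ : (\int[_]_(x in _) _)%E = w%:E); first by rewrite -EFinM poweR_EFin mulrC.
rewrite wE -(integral_indic mu mc mE).
apply: eq_integral => x _; rewrite indicE; case: (x \in E); first by rewrite normr1 powR1.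
by rewrite normr0 powR0// gt_eqF.
Qed.

(** On a cube of volume v that meets E in measure w, the product of the means is (w/v)^(1/p), at
    most (w/v)^(1/p0) because w <= v and p <= p0. The volume v then cancels, and w <= r^n. *)
Lemma multi_morrey_norm_indic (E : set (Rn R n)) a r : measurable E -> 0 < r ->
  E `<=` cube a r ->
  (multi_morrey_norm p0 p1 p2 \1_E \1_E <= ((r ^+ n) `^ p0^-1)%:E)%E.
Proof.
move=> mE r0 Er; apply: ge_ereal_sup => _ [Q [a' [r' [r'0 ->]]] <-].
have [w [w0 wE ->]] := pmean_indic a' mE r'0 p1_gt0.
have [w' [_ wE' ->]] := pmean_indic a' mE r'0 p2_gt0.
have {w' wE'} <- : w = w' by apply: EFin_inj; rewrite -wE -wE'.
rewrite lebesgue_cube// poweR_EFin -!EFinM lee_fin.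
have v0 : 0 < r' ^+ n by rewrite exprn_gt0.
have u0 : 0 < r ^+ n by rewrite exprn_gt0.
have wv : w <= r' ^+ n.
  rewrite -lee_fin -wE -(lebesgue_cube a' r'0); apply: le_measure; rewrite ?inE.
  - by apply: measurableI => //; exact: measurable_cube.
  - exact: measurable_cube.
  - exact: subIsetr.
have wu : w <= r ^+ n.
  rewrite -lee_fin -wE -(lebesgue_cube a r0); apply: le_measure; rewrite ?inE.
  - by apply: measurableI => //; exact: measurable_cube.
  - exact: measurable_cube.
  - by apply: subset_trans Er; exact: subIsetl.
have p00 : 0 < p0 by exact: lt_le_trans pp0.
have i0 : 0 < p0^-1 by rewrite invr_gt0.
have ip : p0^-1 <= p^-1 by rewrite lef_pV2.
set v := r' ^+ n in v0 wv *; set u := r ^+ n in u0 wu *.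
have wv0 : 0 <= w / v by rewrite divr_ge0// ltW.
have wv1 : w / v <= 1 by rewrite ler_pdivrMr// mul1r.
have -> : (w / v) `^ p1^-1 * (w / v) `^ p2^-1 = (w / v) `^ p^-1.
  have [e|ne] := eqVneq (w / v) 0; last by rewrite pE powRD// ne implybT.
  by rewrite e !powR0 ?mul0r// ?invr_eq0 gt_eqF.
apply: (@le_trans _ _ (v `^ p0^-1 * (w / v) `^ p0^-1)).
  rewrite ler_pM2l ?powR_gt0//; have [e|ne] := eqVneq (w / v) 0.
    by rewrite e !powR0// gt_eqF// invr_gt0.
  by apply: ger_powR => //; rewrite wv1 andbT lt0r ne.
rewrite -powRM ?(ltW v0)// mulrC divfK ?gt_eqF//.
by rewrite ge0_ler_powR ?nnegrE ?(ltW i0) ?(ltW u0).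
Qed.

End indicator.

Section lower_bound.
Context (R : realType) (n : nat) (n_gt0 : (0 < n)%N) (alpha : R).
Local Notation N := (n%:R : R).
Local Notation mu := (@lebesgue R n).
Hypothesis alpha_lt : 0 < alpha < 2 * N.

Lemma sqdist_le (a x y : Rn R n) r : 0 < r -> cube a r x -> cube a r y ->
  sqdist x y <= N * r ^+ 2.
Proof.
move=> r0 hx hy; rewrite /sqdist.
apply: (@le_trans _ _ (\sum_(i < n) r ^+ 2)); last by rewrite sumr_const card_ord mulr_natl.
apply: ler_sum => i _; have /andP[x1 x2] := hx i; have /andP[y1 y2] := hy i.
by rewrite -(real_normK (num_real (_ - _))) ler_pXn2r ?nnegrE ?(ltW r0)// ler_norml;
  apply/andP; split; lra.
Qed.

Lemma sqdist_eq0 (x y : Rn R n) : sqdist x y <= 0 -> x = y.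
Proof.
move=> h; apply: eq_from_tnth => i; apply/eqP; rewrite -subr_eq0 -sqrf_eq0 eq_le sqr_ge0 andbT.
exact: le_trans (sqdist_ge x y i) h.
Qed.

(** The positivity hypothesis excludes x = y = z, where the kernel is 0 by convention. *)
Lemma kernel_ge (a x y z : Rn R n) r : 0 < r -> cube a r x -> cube a r y -> cube a r z ->
  0 < sqdist x y + sqdist x z ->
  (2 * N * r ^+ 2) `^ (- (N - alpha / 2)) <= kernel alpha x y z.
Proof.
move=> r0 hx hy hz S0; rewrite /kernel -powRN; apply: powR_le_neg => //.
  by rewrite -mulrA mulrDl mul1r; apply: lerD; exact: sqdist_le r0 hx _.
have := alpha_lt; lra.
Qed.

Lemma commutator_lower_bound (b : Rn R n -> R) (E : set (Rn R n)) (a x : Rn R n) (r w c : R) :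
  0 < r -> measurable_fun [set: Rn R n] b -> measurable E -> E `<=` cube a r ->
  cube a r x -> 0 <= w -> 0 <= c -> (c%:E <= mu E)%E ->
  (forall y, E y -> w <= b x - b y) \/ (forall y, E y -> w <= b y - b x) ->
  (mu \x mu)%E.-integrable [set: Rn R n * Rn R n]
     (EFin \o commutator_integrand b b alpha \1_E \1_E x) ->
  (2 * N * r ^+ 2) `^ (- (N - alpha / 2)) * w ^+ 2 * c ^+ 2 <=
    commutator b b alpha \1_E \1_E x.
Proof.
move=> r0 mb mE Er xQ w0 c0 cE hw int.
set k := _ `^ _; have k0 : 0 <= k by exact: powR_ge0.
have kw0 : 0 <= k * w ^+ 2 by rewrite mulr_ge0// sqr_ge0.
pose g (y : Rn R n * Rn R n) : R := k * w ^+ 2 * ((\1_E y.1 * 1) * (\1_E y.2 * 1)).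
have g0 y : 0 <= g y by rewrite /g !indicE mulr_ge0// mulr_ge0.
have le y : g y <= commutator_integrand b b alpha \1_E \1_E x y.
  case: y => y z; rewrite /g /commutator_integrand /= !indicE !mulr1.
  have [yE|yE] := boolP (y \in E); last by rewrite !(mul0r, mulr0).
  have [zE|zE] := boolP (z \in E); last by rewrite !(mul0r, mulr0).
  rewrite !mulr1; move: yE zE; rewrite !inE => yE zE.
  rewrite -/(kernel alpha x y z).
  have prod : w ^+ 2 <= (b x - b y) * (b x - b z).
    rewrite expr2; case: hw => hw; first by apply: ler_pM => //; exact: hw.
    rewrite -[leRHS]mulrNN !opprB.
    by apply: ler_pM => //; exact: hw.
  have [S0|S0] := ltP 0 (sqdist x y + sqdist x z).
    have kk := kernel_ge r0 xQ (Er _ yE) (Er _ zE) S0.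
    by rewrite mulrC; apply: ler_pM => //; exact: sqr_ge0.
  (* Only the point where the kernel is 0 remains. There x itself lies in E, and the hypothesis on b
     forces w = 0. *)
  have xy : x = y.
    by apply: sqdist_eq0; apply: le_trans S0; rewrite lerDl sqdist_ge0.
  have wz : w = 0.
    apply/eqP; rewrite eq_le w0 andbT.
    by case: hw => /(_ y yE); rewrite xy subrr.
  by rewrite wz expr0n mulr0 xy subrr !mul0r.
have mg : measurable_fun [set: Rn R n * Rn R n] (fun y => (g y)%:E).
  have me : measurable_fun [set: Rn R n] (fun y => \1_E y * (1 : R)).
    exact: (measurable_funM (measurable_indic mE) (measurable_cst _)).
  apply/measurable_EFinP; apply: (measurable_funM (measurable_cst _)).
  exact: (measurable_funM (measurableT_comp me measurable_fst)
    (measurableT_comp me measurable_snd)).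
have mI : measurable_fun [set: Rn R n * Rn R n]
    (EFin \o commutator_integrand b b alpha \1_E \1_E x) by case/integrableP: int.
have If := integrable_fin_num measurableT int.
rewrite -lee_fin /commutator /Rintegral fineK//.
apply: (@le_trans _ _ (\int[mu \x mu]_y (g y)%:E)%E); last first.
  apply: (ge0_le_integral (mu \x mu)%E measurableT) => //.
  - by move=> y _; rewrite lee_fin.
  - by move=> y _; rewrite lee_fin.
have one0 (y : Rn R n) : 0 <= (1 : R) by [].
rewrite (int_indic_prod mu kw0 mE mE (measurable_cst (1 : R)) (measurable_cst (1 : R)) one0 one0).
rewrite (integral_cst mu mE 1) mul1e expr2 EFinM; apply: lee_wpmul2l; first by rewrite lee_fin.
by rewrite EFinM; apply: lee_pmul; rewrite ?lee_fin.
Qed.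

End lower_bound.

Lemma int_le_morrey_norm (R : realType) n (q0 q K : R) (g : Rn R n -> R) a r :
  0 < q -> 0 < q0 -> 0 <= K -> 0 < r -> (morrey_norm q0 q g <= K%:E)%E ->
  (\int[@lebesgue R n]_(x in cube a r) (`|g x| `^ q)%:E <=
     (K `^ q * r `^ (n%:R - n%:R * q / q0))%:E)%E.
Proof.
move=> q_gt0 q0_gt0 K0 r0 h.
have rn0 : 0 < r ^+ n by rewrite exprn_gt0.
have : ((((r ^+ n) `^ q0^-1)%:E) * pmean q g (cube a r) <= K%:E)%E.
  apply: le_trans h; apply: ereal_sup_ubound; exists (cube a r); first by exists a, r.
  by rewrite lebesgue_cube.
have v0 : 0 < (r ^+ n) `^ q0^-1 by exact: powR_gt0.
rewrite pmean_cube//.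
have := int_powR_ge0 q g (cube a r); case: (integral _ _ _) => [i| |] // i0; last first.
  by rewrite gt0_muley ?lte_fin ?invr_gt0// poweRyr ?invr_eq0 ?gt_eqF// gt0_muley ?lte_fin.
rewrite lee_fin mulrC -ler_pdivlMr// => le.
rewrite lee_fin in i0.
have w0 : 0 <= (r ^+ n)^-1 * i by rewrite mulr_ge0// invr_ge0 ltW.
have : ((r ^+ n)^-1 * i) `^ q^-1 `^ q <= (K / (r ^+ n) `^ q0^-1) `^ q.
  by rewrite ge0_ler_powR ?nnegrE ?powR_ge0 ?(ltW q_gt0)// divr_ge0// ltW.
rewrite -powRrM mulVf ?gt_eqF// powRr1// [_^-1 * i]mulrC ler_pdivrMr// => /le_trans; apply.
rewrite le_eqVlt; apply/orP; left; apply/eqP.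
rewrite powRM ?invr_ge0 ?(ltW v0)// -[LHS]mulrA; congr (_ * _).
have -> : ((r ^+ n) `^ q0^-1)^-1 `^ q = r `^ (- (n%:R * q / q0)).
  rewrite -powRN -(powR_mulrn n (ltW r0)) -!powRrM; congr (_ `^ _).
  by field; rewrite gt_eqF.
rewrite -(powR_mulrn n (ltW r0)) -powRD ?(gt_eqF r0) ?implybT//; congr (_ `^ _).
by rewrite addrC.
Qed.

Section part2.
Context (R : realType) (n : nat) (n_gt0 : (0 < n)%N).
Context (alpha p1 p2 p p0 q q0 : R) (b : Rn R n -> R).
Local Notation N := (n%:R : R).
Local Notation mu := (@lebesgue R n).
Local Notation e := (alpha / N).
Hypotheses (alpha_lt : 0 < alpha < 2 * N) (p1_gt1 : 1 < p1) (p2_gt1 : 1 < p2)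
  (p_gt0 : 0 < p) (pp0 : p <= p0) (q_gt0 : 0 < q) (q0_gt0 : 0 < q0).
Hypotheses (pE : p^-1 = p1^-1 + p2^-1) (qE : q^-1 = p^-1 - e) (q0E : q0^-1 = p0^-1 - e).
Hypothesis lb : loc_integrable b.

Lemma int_osc_le_commutator (a : Rn R n) (r m K : R) (Em Ep : set (Rn R n)) :
  0 < r -> 0 <= K -> measurable Em -> measurable Ep ->
  Em `<=` cube a r -> Ep `<=` cube a r ->
  ((r ^+ n / 2)%:E <= mu Em)%E -> ((r ^+ n / 2)%:E <= mu Ep)%E ->
  (forall y, Em y -> b y <= m) -> (forall y, Ep y -> m <= b y) ->
  commutator_defined b b alpha \1_Em \1_Em -> commutator_defined b b alpha \1_Ep \1_Ep ->
  (\int[mu]_(x in cube a r) (`|commutator b b alpha \1_Em \1_Em x| `^ q)%:E <=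
    (K * r `^ (alpha * q) * r ^+ n)%:E)%E ->
  (\int[mu]_(x in cube a r) (`|commutator b b alpha \1_Ep \1_Ep x| `^ q)%:E <=
    (K * r `^ (alpha * q) * r ^+ n)%:E)%E ->
  (\int[mu]_(x in cube a r) (`|b x - m| `^ (2 * q))%:E <=
    ((4 * (2 * N) `^ (N - alpha / 2)) `^ q * 2 `^ q * (2 * K) * r ^+ n)%:E)%E.
Proof.
move=> r0 K0 mEm mEp Emr Epr hm hp bm bp defm defp.
have al := alpha_lt; have N0 : 0 < N by rewrite ltr0n.
have rn0 : 0 < r ^+ n by rewrite exprn_gt0.
have half0 : 0 <= r ^+ n / 2 by rewrite divr_ge0// ltW.
set Tm := commutator b b alpha \1_Em \1_Em; set Tp := commutator b b alpha \1_Ep \1_Ep.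
move=> im ip; have mb := lb.1; have mc := measurable_cube a r.
have mT E : measurable E -> measurable_fun [set: Rn R n]
    (fun x => `|commutator b b alpha \1_E \1_E x|).
  move=> mE; have h := measurable_commutator alpha mb mb (measurable_indic mE) (measurable_indic mE).
  exact: (measurableT_comp (@normr_measurable R setT) h).
have mTm : measurable_fun [set: Rn R n] (fun x => `|Tm x|) by exact: mT.
have mTp : measurable_fun [set: Rn R n] (fun x => `|Tp x|) by exact: mT.
(* The inverse of the constant of [commutator_lower_bound] when c is half the volume: the square of
   that half gives the 4, and r^(2N) cancels against the kernel up to r^alpha. *)
pose k := 4 * (2 * N) `^ (N - alpha / 2) * r `^ (- alpha).
have c0 : 0 < (2 * N) `^ (N - alpha / 2) by rewrite powR_gt0// mulr_gt0.
have four0 : 0 < 4 :> R by [].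
have k0 : 0 < k := mulr_gt0 (mulr_gt0 four0 c0) (powR_gt0 _ r0).
have kE w : (2 * N * r ^+ 2) `^ (- (N - alpha / 2)) * w ^+ 2 * (r ^+ n / 2) ^+ 2 = k^-1 * w ^+ 2.
  have -> : (r ^+ n / 2) ^+ 2 = r `^ (2 * N) / 4.
    rewrite exprMn -exprM -powR_mulrn ?(ltW r0)// natrM [_ * 2%:R]mulrC.
    by congr (_ * _); field.
  have -> : (2 * N * r ^+ 2) `^ (- (N - alpha / 2)) =
      ((2 * N) `^ (N - alpha / 2))^-1 * r `^ (- (2 * N) + alpha).
    rewrite powRM ?exprn_ge0 ?mulr_ge0 ?(ltW r0) ?(ltW N0)// powRN; congr (_ * _).
    rewrite -powR_mulrn ?(ltW r0)// -powRrM; congr (_ `^ _); by field.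
  rewrite (@powRD _ r) ?(gt_eqF r0) ?implybT// [r `^ (- (2 * N))]powRN /k [r `^ (- alpha)]powRN.
  have z0 : 0 < r `^ (2 * N) by rewrite powR_gt0.
  have y0 : 0 < r `^ alpha by rewrite powR_gt0.
  move: (_ `^ (N - _)) (r `^ (2 * N)) (r `^ alpha) c0 z0 y0 => x z y x0 z0 y0.
  by field; rewrite !gt_eqF.
(* Almost everywhere only, since the lower bound needs the double integral at x to converge. The set
   [Em] is used where b is at least m, and [Ep] elsewhere, so that both differences have the same
   sign. *)
have ptw : {ae mu, forall x, cube a r x -> `|b x - m| `^ (2 * q) <=
    k `^ q * 2 `^ q * (`|Tm x| `^ q + `|Tp x| `^ q)}.
  move: defm defp; apply: filterS2 => x dm dp xQ.
  have sq : `|b x - m| ^+ 2 <= k * (`|Tm x| + `|Tp x|).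
    rewrite -ler_pdivrMl//.
    have [mx|/ltW mx] := leP m (b x).
      have w0 : 0 <= b x - m by rewrite subr_ge0.
      have := commutator_lower_bound alpha_lt r0 mb mEm Emr xQ w0 half0 hm
        (or_introl (fun y Ey => lerB (lexx (b x)) (bm y Ey))) dm.
      rewrite kE -/Tm ger0_norm// => h; apply: (le_trans h).
      by rewrite (le_trans (ler_norm _))// lerDl.
    have w0 : 0 <= m - b x by rewrite subr_ge0.
    have := commutator_lower_bound alpha_lt r0 mb mEp Epr xQ w0 half0 hp
      (or_intror (fun y Ey => lerB (bp y Ey) (lexx (b x)))) dp.
    rewrite kE -/Tp distrC ger0_norm// => h; apply: (le_trans h).
    by rewrite (le_trans (ler_norm _))// lerDr.
  have T0 : 0 <= `|Tm x| + `|Tp x| by rewrite addr_ge0.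
  rewrite powRrM powR_mulrn//.
  apply: (@le_trans _ _ ((k * (`|Tm x| + `|Tp x|)) `^ q)).
    by rewrite ge0_ler_powR ?nnegrE ?sqr_ge0 ?(ltW q_gt0)// mulr_ge0// ltW.
  rewrite (powRM _ (ltW k0) T0) -mulrA ler_pM2l ?powR_gt0//.
  exact: powR_add_le (normr_ge0 _) (normr_ge0 _) (ltW q_gt0).
have mp (f : Rn R n -> R) s : measurable_fun [set: Rn R n] f ->
    measurable_fun (cube a r) (fun x => (f x `^ s)%:E).
  by move=> mf; exact: measurable_funTS (measurable_EFin_powR s mf).
have p0' (f : Rn R n -> R) s x : cube a r x -> (0 <= (f x `^ s)%:E)%E.
  by move=> _; rewrite lee_fin powR_ge0.
have kk0 : 0 <= k `^ q * 2 `^ q by rewrite mulr_ge0 ?powR_ge0.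
pose H x := ((`|Tm x| `^ q)%:E + (`|Tp x| `^ q)%:E)%E.
have mH : measurable_fun (cube a r) H by apply: emeasurable_funD; exact: mp.
have H0 x : cube a r x -> (0 <= H x)%E.
  by move=> xQ; apply: adde_ge0; rewrite lee_fin powR_ge0.
apply: (@le_trans _ _ (\int[mu]_(x in cube a r) ((k `^ q * 2 `^ q)%:E * H x))%E).
  apply: (@ae_ge0_le_integral _ _ _ mu (cube a r) mc).
  - by move=> x _; rewrite lee_fin powR_ge0.
  - by apply: mp; exact: measurable_abs_sub.
  - by move=> x xQ; apply: mule_ge0; [rewrite lee_fin|exact: H0].
  - by apply: emeasurable_funM; [exact: measurable_cst|exact: mH].
  - by apply: filterS ptw => x h xQ; rewrite /H -EFinD -EFinM lee_fin; exact: h.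
rewrite (ge0_integralZl_EFin mu mc H0 mH kk0).
have rE : k `^ q * 2 `^ q * (2 * (K * r `^ (alpha * q) * r ^+ n)) =
    (4 * (2 * N) `^ (N - alpha / 2)) `^ q * 2 `^ q * (2 * K) * r ^+ n.
  have c40 : 0 <= 4 * (2 * N) `^ (N - alpha / 2) by rewrite mulr_ge0 ?powR_ge0.
  rewrite /k (powRM _ c40 (powR_ge0 _ _)) -(powRrM r) mulNr powRN.
  by field; rewrite gt_eqF// powR_gt0.
rewrite -rE [leRHS]EFinM; apply: lee_wpmul2l; first by rewrite lee_fin.
rewrite /H (ge0_integralD mu mc (p0' _ _) (mp _ q mTm) (p0' _ _) (mp _ q mTp)).
have -> : 2 * (K * r `^ (alpha * q) * r ^+ n) =
  K * r `^ (alpha * q) * r ^+ n + K * r `^ (alpha * q) * r ^+ n by ring.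
by rewrite EFinD; exact: (leeD im ip).
Qed.

End part2.

Section necessity.
Context (R : realType) (n : nat) (n_gt0 : (0 < n)%N).
Context (alpha p1 p2 p p0 q q0 : R) (b : Rn R n -> R).
Local Notation N := (n%:R : R).
Local Notation mu := (@lebesgue R n).
Local Notation e := (alpha / N).
Hypotheses (alpha_lt : 0 < alpha < 2 * N) (p1_gt1 : 1 < p1) (p2_gt1 : 1 < p2)
  (p_gt0 : 0 < p) (pp0 : p <= p0) (q_gt0 : 0 < q) (q0_gt0 : 0 < q0).
Hypotheses (pE : p^-1 = p1^-1 + p2^-1) (qE : q^-1 = p^-1 - e) (q0E : q0^-1 = p0^-1 - e).
Hypothesis lb : loc_integrable b.

Lemma bmo_of_commutator_bounded : commutator_bounded b b alpha p0 p1 p2 q0 q -> BMO b.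
Proof.
move=> [bd [C HC]]; split => //.
have N0 : 0 < N by rewrite ltr0n.
have alpha0 : 0 < alpha by case/andP: alpha_lt.
have p10 : 0 < p1 by exact: lt_trans p1_gt1.
have p20 : 0 < p2 by exact: lt_trans p2_gt1.
have mb : measurable_fun [set: Rn R n] b := lb.1.
(* Since p1 and p2 exceed 1 and alpha > 0, one has 1/q < 2. This is what allows |b - m| to be
   bounded by 1 + |b - m|^(2q). *)
have q21 : 1 <= 2 * q.
  have i1 : p1^-1 < 1 by rewrite invf_lt1.
  have i2 : p2^-1 < 1 by rewrite invf_lt1.
  have e0 : 0 < e by rewrite divr_gt0.
  have : q^-1 < 2 by rewrite qE pE; lra.
  by rewrite invf_plt ?posrE// => h; rewrite -ler_pdivrMl// mulr1 ltW.
(* The constant of a bounded operator carries no sign condition, hence the absolute value. *)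
set K := `|C| `^ q; have K0 : 0 <= K by exact: powR_ge0.
set A := (4 * (2 * N) `^ (N - alpha / 2)) `^ q * 2 `^ q * (2 * K).
suff osc a r : 0 < r ->
    (\int[mu]_(x in cube a r) (`|b x - average b (cube a r)|)%:E <= (2 * ((1 + A) * r ^+ n))%:E)%E.
  apply: (@le_lt_trans _ _ (2 * (1 + A))%:E); last exact: ltry.
  apply: ge_ereal_sup => _ [Q [a [r [r0 ->]]] <-].
  have rn0 : 0 < r ^+ n by rewrite exprn_gt0.
  rewrite lebesgue_cube// inver gt_eqF// lee_pdivrMl//.
  apply: (le_trans (osc a r r0)); rewrite -EFinM lee_fin.
  by rewrite mulrA mulrC.
move=> r0; have rn0 : 0 < r ^+ n by rewrite exprn_gt0.
have mc := measurable_cube a r.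
have [m [hm hp]] := median_exists mc rn0 (lebesgue_cube a r0) mb.
set Em := cube a r `&` _ in hm; set Ep := cube a r `&` _ in hp.
have mEm : measurable Em.
  apply: measurableI => //; rewrite -[X in measurable X]setTI.
  rewrite (_ : [set x | b x <= m] = b @^-1` `]-oo, m]%classic); first exact: mb.
  by apply/seteqP; split => x /=; rewrite in_itv.
have mEp : measurable Ep.
  apply: measurableI => //; rewrite -[X in measurable X]setTI.
  rewrite (_ : [set x | m <= b x] = b @^-1` `[m, +oo[%classic); first exact: mb.
  by apply/seteqP; split => x /=; rewrite in_itv/= andbT.
have Emr : Em `<=` cube a r by exact: subIsetl.
have Epr : Ep `<=` cube a r by exact: subIsetl.
have test E : measurable E -> E `<=` cube a r ->
    commutator_defined b b alpha \1_E \1_E /\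
    (\int[mu]_(x in cube a r) (`|commutator b b alpha \1_E \1_E x| `^ q)%:E <=
      (K * r `^ (alpha * q) * r ^+ n)%:E)%E.
  move=> mE Er.
  have nE := multi_morrey_norm_indic p10 p20 p_gt0 pp0 pE mE r0 Er.
  have mm : multi_morrey p0 p1 p2 \1_E \1_E.
    by split; [exact: measurable_indic|exact: measurable_indic|exact: le_lt_trans nE (ltry _)].
  have [def _] := bd _ _ mm; split; first exact: def.
  have v0 : 0 <= (r ^+ n) `^ p0^-1 by exact: powR_ge0.
  have hK : (morrey_norm q0 q (commutator b b alpha \1_E \1_E) <=
      (`|C| * (r ^+ n) `^ p0^-1)%:E)%E.
    apply: (le_trans (HC _ _ mm)); rewrite EFinM.
    apply: (@le_trans _ _ (`|C|%:E * multi_morrey_norm p0 p1 p2 \1_E \1_E)%E).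
      apply: lee_wpmul2r; first exact: multi_morrey_norm_ge0.
      by rewrite lee_fin ler_norm.
    by apply: lee_wpmul2l; [rewrite lee_fin|exact: nE].
  have hK0 : 0 <= `|C| * (r ^+ n) `^ p0^-1 by rewrite mulr_ge0.
  apply: (le_trans (int_le_morrey_norm a q_gt0 q0_gt0 hK0 r0 hK)).
  rewrite lee_fin powRM// -/K -!mulrA; apply: ler_wpM2l => //.
  (* The scales match because 1/p0 - 1/q0 = alpha / N: the power q/p0 of the volume, times r^(N - N
     q / q0), is r^(alpha q) r^n. *)
  rewrite le_eqVlt; apply/orP; left; apply/eqP.
  rewrite -(powR_mulrn n (ltW r0)) -!powRrM -!powRD ?(gt_eqF r0) ?implybT//.
  congr (_ `^ _); rewrite q0E; move: (p0^-1) => ip; field.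
  by rewrite gt_eqF.
have [defm im] := test _ mEm Emr; have [defp ip] := test _ mEp Epr.
have := int_osc_le_commutator n_gt0 alpha_lt q_gt0 lb r0 K0 mEm mEp Emr Epr hm hp
  (fun y => @proj2 _ _) (fun y => @proj2 _ _) defm defp im ip.
rewrite -/A => h.
rewrite averageE//; apply: (@mean_osc_le _ _ _ mu _ _ mc rn0 (lebesgue_cube a r0) b m).
  exact: integrable_cube.
have mY := measurable_abs_sub m mb.
apply: (@le_trans _ _ (\int[mu]_(x in cube a r) (1%:E + (`|b x - m| `^ (2 * q))%:E))%E).
  apply: (ge0_le_integral mu mc).
  - by move=> x _; rewrite lee_fin.
  - exact/measurable_EFinP/measurable_funTS.
  - apply: emeasurable_funD; first exact: measurable_cst.
    exact: measurable_funTS (measurable_EFin_powR _ mY).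
  - move=> x _; rewrite -EFinD lee_fin -[leLHS]powRr1//.
    exact: powR_le_1D.
have o0 (x : Rn R n) : cube a r x -> (0 <= 1%:E :> \bar R)%E by rewrite lee_fin.
have w0 (x : Rn R n) : cube a r x -> (0 <= (`|b x - m| `^ (2 * q))%:E)%E.
  by rewrite lee_fin powR_ge0.
rewrite (ge0_integralD mu mc o0 (measurable_cst _) w0
  (measurable_funTS (measurable_EFin_powR _ mY))).
rewrite (integral_cst mu mc 1%:E) mul1e [(1 + A) * _]mulrDl mul1r EFinD; apply: leeD; last exact: h.
by apply: le_of_eq; exact: lebesgue_cube.
Qed.

End necessity.

Theorem lemma3p3 (R : realType) (n : nat) (alpha p1 p2 p p0 q q0 : R)
    (b1 b2 : Rn R n -> R)
    (halpha : 0 < alpha < 2 * n%:R)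
    (hp1 : 1 < p1) (hp2 : 1 < p2)
    (hp : 0 < p) (hpp0 : p <= p0)
    (hq : 0 < q) (hqq0 : q <= q0)
    (hpE : 1 / p = 1 / p1 + 1 / p2)
    (hq0E : 1 / q0 = 1 / p0 - alpha / n%:R)
    (hqE : 1 / q = 1 / p - alpha / n%:R)
    (hb1 : loc_integrable b1) (hb2 : loc_integrable b2) :
  (BMO b1 -> BMO b2 -> commutator_bounded b1 b2 alpha p0 p1 p2 q0 q) /\
  (b1 = b2 -> commutator_bounded b1 b2 alpha p0 p1 p2 q0 q ->
     BMO b1 /\ BMO b2).
Proof.
(* The bounds on alpha exclude n = 0; the grids need n > 0 for their ratio 2^-n to be less than
   1. *)
have n_gt0 : (0 < n)%N.
  rewrite lt0n; apply/eqP => n0; move: halpha; rewrite n0 mulr0 => /andP[h1 h2].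
  by have := lt_trans h1 h2; rewrite ltxx.
have q0_gt0 : 0 < q0 by exact: lt_le_trans hqq0.
rewrite !div1r in hpE hq0E hqE.
split; first exact: (commutator_bounded_of_bmo n_gt0 halpha hp1 hp2 hp hq q0_gt0 hpE hqE hq0E).
move=> e; rewrite -{b2}e in hb2 * => bounded.
have := bmo_of_commutator_bounded n_gt0 halpha hp1 hp2 hp hpp0 hq q0_gt0 hpE hqE hq0E hb1 bounded.
by move=> bmo1; split.
Qed.
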